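(* Run the algorithm MDPP-U (described in the context) for $T$ episodes in a Markov decision process with unknown transition kernel $p$ and initial state-action distribution $\rho$, against an arbitrary sequence of objectives $F_t(\mu)=\sum_{n=1}^N f_{t,n}(\mu_n)$, where each $f_{t,n}:\mathbb{R}^{\mathcal X\times\mathcal A}\to\mathbb{R}$ is convex and $\ell$-Lipschitz with respect to $\|\cdot\|_1$. Assume the set of periodic policies is non-empty and that there is $0\le\alpha<1$ with $\|\nu P_\pi-\nu'P_\pi\|_1\le\alpha\|\nu-\nu'\|_1$ for all policies $\pi$ and all $\nu,\nu'\in\Delta_{\mathcal X\times\mathcal A}$. Run the algorithm with $\bar\alpha=\alpha$ and the optimal choice of $\eta>0$, and suppose $\|\nabla\psi(\mu_t)\|_{1,\infty}\le\Psi$ for all $t$. Then, for any periodic policy $\pi$, with high probability, $$R_T(\pi)\le\tilde O\Big(\ell N^3(1-\alpha)^{-1}|\mathcal X|^{5/4}|\mathcal A|^{1/4}\Psi^{1/2}T^{3/4}+\ell N^4(1-\alpha)^{-2}|\mathcal X|^2\sqrt{|\mathcal A|T}\Big),$$ where $R_T(\pi)=\sum_{t=1}^T[F_t(\mu^{\pi_t,\rho_t})-F_t(\mu^{\pi,\rho})]+\gamma\sum_{t=1}^T\|\rho_t-\rho\|_1$ is the periodic regret, $\gamma>0$ being fixed.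
   Context: MDP. $\mathcal X,\mathcal A$ are finite; $\Delta_S$ is the probability simplex over a finite set $S$; $[N]=\{1,\dots,N\}$. The horizon is $N$, the kernel is $p=(p_n)_{n\in[N]}$ with $p_n(\cdot|x,a)\in\Delta_{\mathcal X}$, and $\rho\in\Delta_{\mathcal X\times\mathcal A}$. A policy is $\pi=(\pi_n)_{n\in[N]}$ with $\pi_n(\cdot|x)\in\Delta_{\mathcal A}$. For $\nu\in\Delta_{\mathcal X\times\mathcal A}$, $\mu^{\pi,\nu}=(\mu_n^{\pi,\nu})_{0\le n\le N}$ is given by $\mu_0^{\pi,\nu}=\nu$ and $\mu_{n+1}^{\pi,\nu}(x,a)=\sum_{x',a'}\mu_n^{\pi,\nu}(x',a')p_{n+1}(x|x',a')\pi_{n+1}(a|x)$. $P_\pi$ is the stochastic matrix on $\mathcal X\times\mathcal A$ with $\nu P_\pi=\mu_N^{\pi,\nu}$ for all $\nu$. A policy $\pi$ is periodic if $\rho P_\pi=\rho$. Given another kernel $q$, $\mathcal M_\nu^q$ is the set of sequences $\mu=(\mu_n)_{0\le n\le N}$ of distributions on $\mathcal X\times\mathcal A$ with $\mu_0=\nu$ and $\sum_a\mu_{n+1}(x,a)=\sum_{x',a'}\mu_n(x',a')q_{n+1}(x|x',a')$. Each such $\mu$ is induced by the policy $\pi_n(a|x)=\mu_n(x,a)/\sum_{a'}\mu_n(x,a')$ (arbitrary where the denominator is zero). Interaction ($M>1$ homogeneous agents). $\rho_1=\rho$, $\rho_{t+1}=\rho_tP_{\pi_t}$ when $\pi_t$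 is played in episode $t$; the learner does not observe $\rho_t$ for $t>1$. In each episode two trajectories are observed; with $\mathcal F_t$ the sigma-algebra of all trajectories observed before episode $t$, conditionally on $\mathcal F_t$: (a) $(x_{t,n},a_{t,n})_{0\le n\le N}$, of a sampled non-reset agent, starts from $\rho_t$ and follows $\pi_t$ and $p$; (b) $(\tilde x_{t,n},\tilde a_{t,n})_{0\le n\le N}$, of the single restarted agent, starts from the estimate $\tilde\rho_t$ (below) and follows $\pi_t$ and $p$. $F_t$ is revealed at the end of episode $t$. Estimates. From trajectories (a): $N_{t,n}(x,a)$ is the number of $s<t$ with $(x_{s,n},a_{s,n})=(x,a)$, $M_{t,n}(x'|x,a)$ the number of $s<t$ with also $x_{s,n+1}=x'$, and $\hat p_{t,n+1}(x'|x,a)=M_{t,n}(x'|x,a)/\max\{1,N_{t,n}(x,a)\}$ (uniform if unvisited). $\tilde p_t$ is the same estimator built from trajectories (b). $\hat\mu_t^{\pi,\nu}$ is defined as $\mu^{\pi,\nu}$ with $\hat p_t$ instead of $p$; $\widetilde P^t_\pi$ is defined as $P_\pi$ with $\tilde p_t$ instead of $p$. $\tilde\rho_1=\rho$, $\tilde\rho_{t+1}=\tilde\rho_t\widetilde P^t_{\pi_t}$. $\widetilde{\mathcal M}_t=\mathcal M^{\hat p_t}_{\tilde\rho_t}$. For $\delta\in(0,1)$ let $C_\delta=\sqrt{2|\mathcal X|\log(|\mathcal X||\mathcal A|NT/\delta)}$ and, for $0\le n\le N-1$, $b_{t,n}(x,a)=C_\delta/\sqrt{\max\{1,N_{t,n}(x,a)\}}$,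 $\bar b_{t,n}(x,a)=\ell(N-n)C_\delta/\sqrt{\max\{1,N_{t,n}(x,a)\}}$. $\langle u,v\rangle=\sum_n\sum_{x,a}u_n(x,a)v_n(x,a)$, undefined components being zero. MDPP-U. Start with a policy $\pi_1$, $\mu_1=\hat\mu_1^{\pi_1,\tilde\rho_1}$. With $\tilde\ell_t=\nabla F_t(\mu_t)$, compute $\mu_{t+1}\in\arg\min\{\eta\langle\tilde\ell_t-\bar b_t,\mu\rangle+D_\psi(\mu,\mu_t)\}$ over $\mu\in\widetilde{\mathcal M}_{t+1}$ with $\|\mu_N-\rho\|_1\le\langle\mu,b_{t+1}\rangle+\bar\alpha\|\tilde\rho_{t+1}-\rho\|_1$, and let $\pi_{t+1}$ be the policy inducing $\mu_{t+1}$, so that $\mu_t=\hat\mu_t^{\pi_t,\tilde\rho_t}$. Divergence. $D_\psi(\mu,\mu')=\psi(\mu)-\psi(\mu')-\langle\nabla\psi(\mu'),\mu-\mu'\rangle$ is one of: (KL) $\sum_{n=0}^N\sum_{x,a}\mu_n\log(\mu_n/\mu_n')$; or ($\Gamma$) $\sum_{n=1}^N\sum_{x,a}\mu_n(x,a)\log(\pi_n(a|x)/\pi_n'(a|x))+\sum_{x,a}\mu_0\log(\mu_0/\mu_0')$, with $\pi,\pi'$ the policies inducing $\mu,\mu'$. $\|v\|_{1,\infty}=\sum_n\|v_n\|_\infty$. Conventions. ''With high probability'': for every $\delta\in(0,1)$ (the parameter in $C_\delta$), with probability at least $1-c\delta$, $c$ universal. $\tilde O(g)$: at most $C\,g\,\log^k(|\mathcal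 X||\mathcal A|NT/\delta)$ with universal $C,k$, for all $T$ larger than a threshold depending on the other parameters. ''Optimal choice of $\eta$'': the choice, depending only on $T,N,|\mathcal X|,|\mathcal A|,\alpha,\ell,\Psi,\delta$ and $\psi(\mu_1)$, that optimises the regret bound. *)

(* Defs.v *)
(* Finite MathComp structures; MathComp-Analysis for the reals and the
   probability space. *)
From HB Require Import structures.
From mathcomp Require Import all_boot all_order all_algebra.
From mathcomp Require Import all_classical all_reals all_analysis.

Set Implicit Arguments.
Unset Strict Implicit.
Unset Printing Implicit Defensive.
Import Order.TTheory GRing.Theory Num.Theory.
Local Open Scope ring_scope.

(* Everything indexed by a step or an episode is a function of a natural number,
   of which only the indices of the mathematical object are ever used:
   0 <= n <= N for distributions, 1 <= n <= N for policies and kernels,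
   t >= 1 for episodes. *)

Section MDP.
Context {R : realType} {X A : finType} (N : nat).

Definition savec := {ffun X * A -> R}.
Definition saseq := nat -> savec.
(* p n (x, a) x' is p_n(x' | x, a), and pi n x a is pi_n(a | x). *)
Definition trans_kernel := nat -> X * A -> X -> R.
Definition policy := nat -> X -> A -> R.
Definition traj := {ffun 'I_N.+1 -> X * A}.

Definition is_dist (S : finType) (q : S -> R) : Prop :=
  (forall s, 0 <= q s) /\ \sum_s q s = 1.

Definition is_kernel (p : trans_kernel) : Prop :=
  forall n, (1 <= n <= N)%N -> forall ya, is_dist (p n ya).

Definition is_policy (pi : policy) : Prop :=
  forall n, (1 <= n <= N)%N -> forall x, is_dist (pi n x).

Fixpoint occ (p : trans_kernel) (pi : policy) (nu : savec) (n : nat) : savec :=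
  if n is m.+1 then
    [ffun xa => (\sum_ya occ p pi nu m ya * p m.+1 ya xa.1) * pi m.+1 xa.1 xa.2]
  else nu.

(* nu P_pi *)
Definition push (p : trans_kernel) (pi : policy) (nu : savec) : savec := occ p pi nu N.

Definition norm1 (u : savec) : R := \sum_xa `|u xa|.

Definition norm1oo (v : saseq) : R :=
  \sum_(n < N.+1) \big[Num.max/0]_xa `|v n xa|.

Definition inner (u v : saseq) : R := \sum_(n < N.+1) \sum_xa u n xa * v n xa.

Definition periodic_policy (p : trans_kernel) (rho : savec) (pi : policy) : Prop :=
  is_policy pi /\ push p pi rho = rho.

Definition contracting (p : trans_kernel) (alpha : R) : Prop :=
  forall pi, is_policy pi -> forall nu nu' : savec, is_dist nu -> is_dist nu' ->
    norm1 (push p pi nu - push p pi nu') <= alpha * norm1 (nu - nu').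

(* The set M_nu^q. *)
Definition consistent (q : trans_kernel) (nu : savec) (mu : saseq) : Prop :=
  [/\ forall n, (n <= N)%N -> is_dist (mu n),
      mu 0%N = nu
    & forall n, (n < N)%N -> forall x,
        \sum_a mu n.+1 (x, a) = \sum_ya mu n ya * q n.+1 ya x].

Definition cond_policy (mu : saseq) : policy :=
  fun n x a => mu n (x, a) / \sum_a' mu n (x, a').

Definition induces (pi : policy) (mu : saseq) : Prop :=
  forall n, (1 <= n <= N)%N -> forall x a, \sum_a' mu n (x, a') != 0 ->
    pi n x a = cond_policy mu n x a.

Definition traj_prob (p : trans_kernel) (pi : policy) (nu : savec) (tau : traj) : R :=
  nu (tau ord0) *
  \prod_(n < N) (p n.+1 (tau (inord n)) (tau (inord n.+1)).1
                 * pi n.+1 (tau (inord n.+1)).1 (tau (inord n.+1)).2).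

(* Estimators, from the trajectories w s of the episodes 1 <= s < t. *)

Definition visits (w : nat -> traj) (t n : nat) (xa : X * A) : nat :=
  (\sum_(1 <= s < t) (w s (inord n) == xa))%N.

Definition transitions (w : nat -> traj) (t n : nat) (xa : X * A) (x' : X) : nat :=
  (\sum_(1 <= s < t) ((w s (inord n) == xa) && ((w s (inord n.+1)).1 == x')))%N.

Definition est_kernel (w : nat -> traj) (t : nat) : trans_kernel :=
  fun n xa x' =>
    if visits w t n.-1 xa == 0%N then #|X|%:R^-1
    else (transitions w t n.-1 xa x')%:R / (maxn 1%N (visits w t n.-1 xa))%:R.

(* rho_t = state_dist (fun=> p) pi rho t, and the estimate of rho_t is
   state_dist (est_kernel w) pi rho t. *)
Definition state_dist (p : nat -> trans_kernel) (pi : nat -> policy) (rho : savec)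
    (t : nat) : savec :=
  iteri t.-1 (fun s nu => push (p s.+1) (pi s.+1) nu) rho.

Definition logfactor (T : nat) (delta : R) : R :=
  ln (#|X|%:R * #|A|%:R * N%:R * T%:R / delta).

Definition Cdelta (T : nat) (delta : R) : R :=
  Num.sqrt (2 * #|X|%:R * logfactor T delta).

Definition bonus (T : nat) (delta : R) (w : nat -> traj) (t : nat) : saseq :=
  fun n => [ffun xa =>
    if (n < N)%N then Cdelta T delta / Num.sqrt (maxn 1%N (visits w t n xa))%:R
    else 0].

Definition bonus_bar (l : R) (T : nat) (delta : R) (w : nat -> traj) (t : nat)
    : saseq :=
  fun n => [ffun xa => l * (N - n)%:R * bonus T delta w t n xa].

Inductive divergence := KL | Gam.

(* ln vanishes on nonpositive reals, so x * ln x is 0 at 0, where it is not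
   differentiable. *)
Definition psi (K : divergence) (mu : saseq) : R :=
  match K with
  | KL => \sum_(n < N.+1) \sum_xa mu n xa * ln (mu n xa)
  | Gam => \sum_(1 <= n < N.+1) \sum_x \sum_a
             mu n (x, a) * ln (cond_policy mu n x a)
           + \sum_xa mu 0%N xa * ln (mu 0%N xa)
  end.

(* m * log (q / q'), with 0 * log _ = 0 and m * log (q / 0) = +oo *)
Definition xlog (m q q' : R) : \bar R :=
  if m == 0 then 0%E else if q' == 0 then +oo%E else (m * ln (q / q'))%:E.

(* D_psi(mu, mu'); the policy pi' inducing mu' is an argument, because mu' does
   not determine it at states without mass. *)
Definition bregman (K : divergence) (mu mu' : saseq) (pi' : policy) : \bar R :=
  match K with
  | KL => (\sum_(n < N.+1) \sum_xa xlog (mu n xa) (mu n xa) (mu' n xa))%E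
  | Gam => (\sum_(1 <= n < N.+1) \sum_x \sum_a
              xlog (mu n (x, a)) (cond_policy mu n x a) (pi' n x a)
            + \sum_xa xlog (mu 0%N xa) (mu 0%N xa) (mu' 0%N xa))%E
  end.

(* g is the (Frechet) gradient at mu of a function of (mu_0, ..., mu_N). *)
Definition is_gradient (Phi : saseq -> R) (mu g : saseq) : Prop :=
  forall e : R, 0 < e -> exists2 d : R, 0 < d & forall h : saseq,
    \sum_(n < N.+1) norm1 (h n) <= d ->
    `|Phi (fun n => mu n + h n) - Phi mu - inner g h|
      <= e * \sum_(n < N.+1) norm1 (h n).

Definition is_subgradient (Phi : saseq -> R) (mu g : saseq) : Prop :=
  forall mu' : saseq, Phi mu + inner g (fun n => mu' n - mu n) <= Phi mu'.

Definition convex_fun (f : savec -> R) : Prop :=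
  forall (u v : savec) (s : R), 0 <= s <= 1 ->
    f [ffun xa => s * u xa + (1 - s) * v xa] <= s * f u + (1 - s) * f v.

Definition lipschitz_fun (l : R) (f : savec -> R) : Prop :=
  forall u v : savec, `|f u - f v| <= l * norm1 (u - v).

Definition objective (f : nat -> savec -> R) (mu : saseq) : R :=
  \sum_(1 <= n < N.+1) f n (mu n).

(* The sets and iterates of the algorithm along one sample path: w and w' are the
   trajectories of the sampled and of the restarted agents, pi the policies. *)

Definition rho_est (rho : savec) (w' : nat -> traj) (pi : nat -> policy) (t : nat)
    : savec :=
  state_dist (est_kernel w') pi rho t.

Definition iterate (rho : savec) (w w' : nat -> traj) (pi : nat -> policy)
    (t : nat) : saseq :=
  occ (est_kernel w t) (pi t) (rho_est rho w' pi t).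

Definition feasible (T : nat) (delta alphabar : R) (rho : savec)
    (w w' : nat -> traj) (pi : nat -> policy) (t : nat) (mu : saseq) : Prop :=
  consistent (est_kernel w t) (rho_est rho w' pi t) mu /\
  norm1 (mu N - rho) <= inner mu (bonus T delta w t)
                        + alphabar * norm1 (rho_est rho w' pi t - rho).

Definition step_objective (K : divergence) (eta l : R) (T : nat) (delta : R)
    (rho : savec) (w w' : nat -> traj) (pi : nat -> policy) (g : nat -> saseq)
    (t : nat) (mu : saseq) : \bar R :=
  ((eta * inner (fun n => (g t n : savec) - bonus_bar l T delta w t n) mu)%:E
   + bregman K mu (iterate rho w w' pi t) (pi t))%E.

(* A T-episode run of MDPP-U in which the loss vector g t is a subgradient of the
   t-th objective at the t-th iterate (the gradient, if it exists).  The update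
   constrains the run only where its feasible set is nonempty: an empty one has
   positive probability in general, and the learner may then play any policy. *)
Definition mdpp_u (K : divergence) (eta l : R) (T : nat) (delta alphabar : R)
    (rho : savec) (w w' : nat -> traj) (f : nat -> nat -> savec -> R)
    (pi : nat -> policy) (g : nat -> saseq) : Prop :=
  [/\ forall t, (1 <= t <= T)%N -> is_policy (pi t),
      forall t, (1 <= t <= T)%N ->
        is_subgradient (objective (f t)) (iterate rho w w' pi t) (g t)
    & forall t, (1 <= t < T)%N ->
        (exists mu, feasible T delta alphabar rho w w' pi t.+1 mu) ->
        exists mu : saseq,
          [/\ feasible T delta alphabar rho w w' pi t.+1 mu,
              forall mu', feasible T delta alphabar rho w w' pi t.+1 mu' ->
                (step_objective K eta l T delta rho w w' pi g t mu
                 <= step_objective K eta l T delta rho w w' pi g t mu')%E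
            & induces (pi t.+1) mu]].

Definition periodic_regret (p : trans_kernel) (rho : savec) (gamma : R)
    (f : nat -> nat -> savec -> R) (pi : nat -> policy) (T : nat) (pi0 : policy)
    : R :=
  \sum_(1 <= t < T.+1)
     (objective (f t) (occ p (pi t) (state_dist (fun=> p) pi rho t))
      - objective (f t) (occ p pi0 rho))
  + gamma * \sum_(1 <= t < T.+1) norm1 (state_dist (fun=> p) pi rho t - rho).

Definition regret_rate (alpha l Psi : R) (T : nat) : R :=
  l * N%:R ^+ 3 * (1 - alpha)^-1 * #|X|%:R `^ (5 / 4) * #|A|%:R `^ (1 / 4)
    * Psi `^ (1 / 2) * T%:R `^ (3 / 4)
  + l * N%:R ^+ 4 * (1 - alpha) ^- 2 * #|X|%:R ^+ 2 * Num.sqrt (#|A|%:R * T%:R).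

End MDP.

Arguments savec R X A : clear implicits.
Arguments saseq R X A : clear implicits.
Arguments trans_kernel R X A : clear implicits.
Arguments policy R X A : clear implicits.
Arguments traj X A N : clear implicits.
Arguments logfactor {R} X A N T delta.
Arguments regret_rate {R} X A N alpha l Psi T.

Section Interaction.
Context {R : realType} {X A : finType} (N : nat).
Context {d : measure_display} {Omega : measurableType d} (P : probability Omega R).
Local Open Scope classical_set_scope.

Definition past (w w' : nat -> Omega -> traj X A N) (t : nat) (om : Omega)
    : seq (traj X A N * traj X A N) :=
  [seq (w s om, w' s om) | s <- iota 1 t.-1].

(* The trajectory observed in episode t has, conditionally on the past (a finitely
   valued random variable), the law of the chain with kernel p started from
   nu om and controlled by pi om, both functions of the past. *)
Definition follows (H : Omega -> seq (traj X A N * traj X A N))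
    (w : Omega -> traj X A N) (p : trans_kernel R X A)
    (nu : Omega -> savec R X A) (pi : Omega -> policy R X A) : Prop :=
  forall (om : Omega) (tau : traj X A N),
    P ([set o | H o = H om] `&` [set o | w o = tau])
    = (P [set o | H o = H om] * (traj_prob p (pi om) (nu om) tau)%:E)%E.

(* No joint law of w t and w' t given the past is prescribed. *)
Definition interaction (T : nat) (p : trans_kernel R X A) (rho : savec R X A)
    (w w' : nat -> Omega -> traj X A N) (pi : nat -> Omega -> policy R X A) : Prop :=
  forall t, (1 <= t <= T)%N ->
  [/\ forall tau, measurable [set om | w t om = tau] /\
                  measurable [set om | w' t om = tau],
      forall om om', past w w' t om = past w w' t om' -> pi t om = pi t om',
      follows (past w w' t) (w t) p
        (fun om => state_dist N (fun=> p) (pi ^~ om) rho t) (pi t)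
    & follows (past w w' t) (w' t) p
        (fun om => rho_est rho (w' ^~ om) (pi ^~ om) t) (pi t)].

End Interaction.

(* Main.v *)
(* The transition kernel enters the regret only through two kinds of weighted
   sums.  On an event of probability at least 1 - 10 delta, the empirical kernels
   are within the bonus of the truth and the expected bonus under the true law of
   an agent is comparable with the bonus at the visited pairs, whose sum over the
   episodes is of order sqrt T.  Both facts come from exponential supermartingales.
   Contraction then turns one-episode errors into summable errors for the
   distance between rho_t and its estimate and, through the constraint of the
   algorithm, for the distance to rho.

   The comparator in episode t is the occupancy measure of the periodic policy in
   the empirical model; it is feasible, and the part of its loss that visits do
   not control is compensated by the bonus in the loss vector.  Mirror descent with
   moving feasible sets costs Psi times the path length of these comparators,
   which is of order sqrt T, divided by eta, plus eta T: hence eta = T^(-1/4) and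
   the rate T^(3/4).  As the threshold on T may depend on all other parameters,
   constants are absorbed by a logarithmic factor. *)
Require Import Defs.
From HB Require Import structures.
From mathcomp Require Import all_boot all_order all_algebra.
From mathcomp Require Import all_classical all_reals all_analysis.
From mathcomp Require Import ring lra.
Set Implicit Arguments.
Unset Strict Implicit.
Unset Printing Implicit Defensive.
Import Order.TTheory GRing.Theory Num.Theory numFieldNormedType.Exports.
Local Open Scope classical_set_scope.
Local Open Scope ring_scope.

(** * Elementary inequalities *)

(** Confidence weights are summable only under the law that generates the visits. [occ_gap]
    therefore lets either of the two compared models carry the weight of the kernel error. Carried
    by the true law, the weights sum to order sqrt T. Carried by the comparator in the empirical
    model, they give the bonus of the constraint and, summed over the steps, [bonus_bar]. This is
    also why the second stream restarts from the estimate: its visits control the error made in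
    pushing that very estimate forward.

    The existence of a gradient replaces any lower bound on the iterates. The slope of x ln x at 0
    is infinite, so a gradient exists only where the relevant probabilities are positive; the
    divergences are then finite and equal to the Bregman expressions. It also forces [Psi] to be
    positive, so that the target rate can absorb constants.

    Optimality of an update is used only along the segment to the next comparator. Since the history
    takes finitely many values, supermartingales are treated by sums over its atoms instead of
    conditional expectations. *)

Section Scalar.
Context {R : realType}.
Implicit Types x y b : R.

(** From exp(b) >= 1 + b, because 1 / (1 + b) <= 1 - b / 2 on [0, 1]. With b a visit weight and q
    the probability of a visit, it bounds the mean of exp(- b 1{visit}) by exp(- q b / 2). *)
Lemma expRN_le_half b : 0 <= b <= 1 -> expR (- b) <= 1 - b / 2.
Proof.
move=> /andP[b0 b1].
have e0 := expR_gt0 (- b); have := expR_ge1Dx b.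
have : expR b * expR (- b) = 1 by rewrite expRxMexpNx_1.
nra.
Qed.

Lemma expR_sub_opp_ge0 x : 0 <= x -> 0 <= expR x - expR (- x).
Proof. by move=> x0; rewrite subr_ge0 ler_expR; lra. Qed.

Lemma sinh_le_mul_cosh x : 0 <= x -> expR x - expR (- x) <= x * (expR x + expR (- x)).
Proof.
move=> x0.
pose F (y : R) : R := y * (expR y + expR (- y)) - (expR y - expR (- y)).
have dF y : is_derive y 1 F (y * (expR y - expR (- y))).
  by apply: is_derive_eq; rewrite /GRing.scale /= ; ring.
have cF : {within `[0, x], continuous F}.
  apply: derivable_within_continuous => y _.
  by case: (dF y).
have [c + e] := MVT_segment x0 (fun y _ => dF y) cF.
rewrite in_itv /= => /andP[c0 _].
have : 0 <= F x - F 0 by rewrite e subr0 mulr_ge0 // mulr_ge0 // expR_sub_opp_ge0.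
by rewrite /F oppr0 !expR0; lra.
Qed.

(** The derivative of cosh(x) exp(- x^2 / 2) has the sign of sinh x - x cosh x, which
    [sinh_le_mul_cosh] settles for x >= 0; evenness does the rest. *)
Lemma cosh_le_expR x : (expR x + expR (- x)) / 2 <= expR (x ^+ 2 / 2).
Proof.
wlog x0 : x / 0 <= x.
  move=> h; case: (lerP 0 x) => [/h //|xn]; have := h (- x).
  by rewrite opprK sqrrN (addrC (expR (- x))); apply; rewrite oppr_ge0 ltW.
pose F (y : R) : R := (expR y + expR (- y)) * expR (- (y * y) / 2).
have dF y : is_derive y 1 F
    (- (y * (expR y + expR (- y)) - (expR y - expR (- y))) * expR (- (y * y) / 2)).
  by apply: is_derive_eq; rewrite /GRing.scale /=; field.
have cF : {within `[0, x], continuous F}.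
  apply: derivable_within_continuous => y _.
  by case: (dF y).
have [c + e] := MVT_segment x0 (fun y _ => dF y) cF.
rewrite in_itv /= => /andP[c0 _].
have : F x - F 0 <= 0.
  rewrite e subr0 mulr_le0_ge0 // mulr_le0_ge0 ?expR_ge0 // oppr_le0 subr_ge0.
  exact: sinh_le_mul_cosh.
rewrite /F !mul0r oppr0 mul0r !expR0 mulr1 mulNr -expr2 subr_le0 => h.
have := expRxMexpNx_1 (x ^+ 2 / 2); have := expR_gt0 (x ^+ 2 / 2).
have := expR_gt0 (- (x ^+ 2 / 2)).
set E := expR (x ^+ 2 / 2) in h *; set E' := expR (- (x ^+ 2 / 2)) in h *.
set a := expR x + _ in h * => E'0 E0 EE.
have : a * (E * E') <= 2 * E by nra.
by rewrite EE; lra.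
Qed.

End Scalar.

Section Scalar2.
Context {R : realType}.

(** Average the tangent line of exp at the mean. *)
Lemma expR_jensen (S : finType) (q h : S -> R) : is_dist q ->
  expR (\sum_s q s * h s) <= \sum_s q s * expR (h s).
Proof.
move=> [q0 q1]; set m := \sum_s q s * h s.
have -> : expR m = expR m * \sum_s q s * (1 + (h s - m)).
  under eq_bigr do rewrite mulrDr mulr1 mulrBr.
  by rewrite big_split sumrB /= -mulr_suml q1 mul1r -/m subrr addr0 mulr1.
rewrite mulr_sumr ler_sum // => s _.
rewrite mulrCA ler_wpM2l //; have -> : expR (h s) = expR m * expR (h s - m).
  by rewrite -expRD addrC subrK.
by rewrite ler_wpM2l ?expR_ge0 ?expR_ge1Dx.
Qed.

(* Symmetrisation, at the price of a factor 2 in the variance proxy. *)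
Lemma hoeffding_sign (S : finType) (q h : S -> R) (a : R) : is_dist q ->
  (forall s, `|h s| = 1) ->
  \sum_s q s * expR (a * (h s - \sum_s' q s' * h s')) <= expR (a ^+ 2).
Proof.
move=> qd h1; have [q0 q1] := qd; set m := \sum_s' q s' * h s'.
pose U := \sum_s q s * expR (a * h s); pose V := \sum_s q s * expR (- (a * h s)).
have -> : \sum_s q s * expR (a * (h s - m)) = U * expR (- (a * m)).
  by rewrite mulr_suml; apply: eq_bigr => s _; rewrite mulrBr expRD mulrA.
have U0 : 0 <= U by apply: sumr_ge0 => s _; rewrite mulr_ge0 ?expR_ge0.
have V0 : 0 <= V by apply: sumr_ge0 => s _; rewrite mulr_ge0 ?expR_ge0.
have mV : expR (- (a * m)) <= V.
  apply: le_trans (expR_jensen (fun s => - (a * h s)) qd); rewrite ler_expR.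
  rewrite mulr_sumr -sumrN ler_sum // => s _; lra.
have UV : U + V = expR a + expR (- a).
  rewrite -big_split /= -[RHS]mul1r -q1 mulr_suml; apply: eq_bigr => s _.
  rewrite -mulrDr; congr (_ * _).
  have /eqP := h1 s; rewrite eqr_norml => /andP[/orP[]/eqP -> _].
    by rewrite mulr1.
  by rewrite mulrN1 opprK addrC.
have C : expR a + expR (- a) <= 2 * expR (a ^+ 2 / 2).
  by have := cosh_le_expR a; lra.
have -> : expR (a ^+ 2) = expR (a ^+ 2 / 2) ^+ 2.
  by rewrite -expRM_natl; congr expR; field.
(* Jensen replaced exp(- a m) by V. Now U V <= ((U + V) / 2)^2 = cosh(a)^2 <= E^2, and this square
   turns a^2 / 2 into a^2. *)
set E := expR (a ^+ 2 / 2) in C *; apply: le_trans (ler_wpM2l U0 mV) _.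
have : (U + V) ^+ 2 <= (2 * E) ^+ 2 by rewrite ler_pXn2r ?nnegrE ?addr_ge0 ?UV //; nra.
by have := sqr_ge0 (U - V); nra.
Qed.

Lemma ln_le_subr1 (x : R) : 0 < x -> ln x <= x - 1.
Proof. move=> x0; have := @le_ln1Dx _ (x - 1); have -> : 1 + (x - 1) = x by ring.
by move=> h; apply: h; lra. Qed.

Lemma ln_ge_1subV (x : R) : 0 < x -> 1 - x^-1 <= ln x.
Proof.
move=> x0; have := @ln_le_subr1 x^-1; rewrite invr_gt0 => /(_ x0).
by rewrite lnV ?posrE //; lra.
Qed.

Lemma xlnx_ge (x : R) : 0 <= x -> -1 <= x * ln x.
Proof.
rewrite le_eqVlt => /predU1P[<-|x0]; first by rewrite mul0r; lra.
have := ler_wpM2l (ltW x0) (ln_ge_1subV x0).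
by rewrite mulrBr divff ?gt_eqF // mulr1; lra.
Qed.

Lemma xlnx_le0 (x : R) : 0 <= x <= 1 -> x * ln x <= 0.
Proof. by move=> /andP[x0 x1]; rewrite mulr_ge0_le0 // ln_le0. Qed.

Lemma ln_diff (y x : R) : 0 < y -> 0 < x -> ln (y / x) = ln y - ln x.
Proof. by move=> *; rewrite ln_div ?posrE. Qed.

(** A pointwise form of Pinsker's inequality. With u = sqrt y and v = sqrt x, the right side is at
    least (u - v)^2, and y - x = (u - v)(u + v) with u + v <= 2. The linear terms cancel when summed
    over two distributions. *)
Lemma rel_entropy_term (y x : R) : 0 <= y <= 1 -> 0 < x <= 1 ->
  (y - x) ^+ 2 / 4 <= y * ln (y / x) - y + x.
Proof.
move=> /andP[y0 y1] /andP[x0 x1]; set u := Num.sqrt y; set v := Num.sqrt x.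
have u0 : 0 <= u by apply: sqrtr_ge0.
have v0 : 0 < v by rewrite sqrtr_gt0.
have ey : y = u ^+ 2 by rewrite sqr_sqrtr.
have ex : x = v ^+ 2 by rewrite sqr_sqrtr // ltW.
have u1 : u <= 1 by rewrite -sqrtr1 ler_sqrt.
have v1 : v <= 1 by rewrite -sqrtr1 ler_sqrt.
have : (u - v) ^+ 2 <= y * ln (y / x) - y + x.
  move: y0; rewrite le_eqVlt => /predU1P[y0|y0].
    have -> : u = 0 by rewrite /u -y0 sqrtr0.
    by rewrite -y0 mul0r ex; nra.
  have u0' : 0 < u by rewrite sqrtr_gt0.
  have -> : ln (y / x) = 2 * ln (u / v).
    rewrite ey ex -expr_div_n lnXn ?divr_gt0 // mulr_natl //.
  have := ln_ge_1subV (divr_gt0 u0' v0); rewrite invf_div => h.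
  have : y * (1 - v / u) <= y * ln (u / v) by rewrite ler_wpM2l // ltW.
  have -> : y * (1 - v / u) = y - u * v.
    by rewrite ey; field; rewrite gt_eqF.
  by rewrite ex [in (u - v) ^+ 2]expr2; rewrite ey; nra.
have : (y - x) ^+ 2 <= 4 * (u - v) ^+ 2.
  rewrite ey ex; have -> : u ^+ 2 - v ^+ 2 = (u - v) * (u + v) by ring.
  rewrite exprMn mulrC ler_wpM2r ?sqr_ge0 //; nra.
lra.
Qed.

(** Both bounds come from 1 - 1/r <= ln r <= r - 1 at r = (x + s) / x. *)
Lemma xlnx_deriv (x s : R) : 0 < x -> - x < s ->
  0 <= (x + s) * ln (x + s) - x * ln x - s * (1 + ln x) <= s ^+ 2 / x.
Proof.
move=> x0 xs; have xs0 : 0 < x + s by lra.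
have e : (x + s) * ln (x + s) - x * ln x - s * (1 + ln x)
   = (x + s) * ln ((x + s) / x) - s by rewrite ln_diff //; ring.
rewrite e; apply/andP; split.
  have := ler_wpM2l (ltW xs0) (ln_ge_1subV (divr_gt0 xs0 x0)).
  rewrite invf_div mulrBr mulr1 [_ * (x / _)]mulrC divfK ?gt_eqF //; lra.
have := ler_wpM2l (ltW xs0) (ln_le_subr1 (divr_gt0 xs0 x0)).
have -> : (x + s) * ((x + s) / x - 1) = s ^+ 2 / x + s by field; rewrite gt_eqF.
lra.
Qed.

(** Makes the weights of successive visits telescope. For k >= 1, b <= 2 a gives b - a = 1 / (a + b)
    >= 1 / (3 a), whence the constant 3. *)
Lemma inv_sqrt_le_incr (k : nat) :
  (Num.sqrt (maxn 1 k)%:R)^-1 <= 3 * (Num.sqrt k.+1%:R - Num.sqrt k%:R) :> R.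
Proof.
case: k => [|k]; first by rewrite maxn0 sqrtr0 sqrtr1 invr1; lra.
rewrite (maxn_idPr _) //; set a := Num.sqrt k.+1%:R; set b := Num.sqrt k.+2%:R.
have a1 : 1 <= a by rewrite -[leLHS]sqrtr1 ler_sqrt ?ler1n.
have b0 : 0 <= b by apply: sqrtr_ge0.
have ea : a ^+ 2 = k.+1%:R by rewrite sqr_sqrtr.
have eb : b ^+ 2 = a ^+ 2 + 1 by rewrite sqr_sqrtr // ea -natr1.
rewrite -[leLHS]mul1r ler_pdivrMr; last by lra.
have : b <= 2 * a by nra.
nra.
Qed.

Lemma contraction_sum (a : R) (u e : nat -> R) (T : nat) : 0 <= a < 1 ->
  (forall t, 0 <= u t) ->
  (forall t, (1 <= t < T)%N -> u t.+1 <= a * u t + e t) ->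
  (forall t, (1 <= t <= T)%N -> 0 <= e t) ->
  (1 - a) * (\sum_(1 <= t < T.+1) u t) <= u 1%N + \sum_(1 <= t < T.+1) e t.
Proof.
move=> /andP[a0 a1] u0 ue e0.
(* Keeping [u n] on the left closes the induction: the step adds [u n.+1 - a * u n] there, which is
   at most [e n]. The last term serves [n = 0], where the sums are empty and [u 0] stands on the
   left. *)
suff H : forall n, (n <= T)%N ->
    (1 - a) * (\sum_(1 <= t < n) u t) + u n <= u 1%N + \sum_(1 <= t < n) e t + (n == 0)%:R * u 0%N.
  have := H T (leqnn _); case: T {H} e0 ue => [|T] e0 ue.
    rewrite !big_geq // mulr0 !addr0 mul1r add0r; have := u0 1%N; lra.
  rewrite !(@big_nat_recr _ _ _ T.+1) //= mul0r addr0 => H.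
  by have := u0 T.+1; have := e0 T.+1; rewrite leqnn => /(_ isT); nra.
elim=> [|[|n] IH] nT.
  by rewrite !big_geq //= mul1r; have := u0 1%N; lra.
  by rewrite !big_geq //= mul0r; lra.
have {}IH := IH (ltnW nT); have := ue n.+1 nT.
rewrite !(@big_nat_recr _ _ _ n.+1) //= mul0r !addr0 in IH *; lra.
Qed.

End Scalar2.

(** * Occupancy measures *)

Section Occupancy.
Context {R : realType} {X A : finType} (N : nat).
Implicit Types (p q : trans_kernel R X A) (pi : policy R X A) (u v nu : savec R X A).

Lemma sum_pair (F : X * A -> R) : \sum_xa F xa = \sum_x \sum_a F (x, a).
Proof. by rewrite pair_bigA; apply: eq_bigr => -[]. Qed.

Lemma norm1E u v : norm1 (u - v) = \sum_xa `|u xa - v xa|.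
Proof. by apply: eq_bigr => xa _; rewrite !ffunE. Qed.

Lemma norm1_ge0 u : 0 <= norm1 u.
Proof. exact: sumr_ge0. Qed.

Lemma norm1C u v : norm1 (u - v) = norm1 (v - u).
Proof. by rewrite !norm1E; apply: eq_bigr => xa _; rewrite distrC. Qed.

Lemma norm1_triangle u v w : norm1 (u - v) <= norm1 (u - w) + norm1 (w - v).
Proof.
rewrite !norm1E -big_split /= ler_sum // => xa _; exact: ler_distD.
Qed.

Lemma norm1_dist_le2 u v : is_dist u -> is_dist v -> norm1 (u - v) <= 2.
Proof.
move=> [u0 u1] [v0 v1]; rewrite norm1E.
have -> : 2 = \sum_xa (u xa + v xa) :> R by rewrite big_split /= u1 v1.
apply: ler_sum => xa _; apply: le_trans (ler_normB _ _) _.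
by rewrite !ger0_norm.
Qed.

Lemma dist_le1 (S : finType) (q : S -> R) s : is_dist q -> q s <= 1.
Proof.
move=> [q0 q1]; rewrite -q1 (bigD1 s) //= lerDl.
by apply: sumr_ge0.
Qed.

Lemma occS p pi nu n xa : occ p pi nu n.+1 xa =
  (\sum_ya occ p pi nu n ya * p n.+1 ya xa.1) * pi n.+1 xa.1 xa.2.
Proof. by rewrite /= ffunE. Qed.

Lemma sum_occS p pi nu n x : is_dist (pi n.+1 x) ->
  \sum_a occ p pi nu n.+1 (x, a) = \sum_ya occ p pi nu n ya * p n.+1 ya x.
Proof.
by move=> [_ pi1]; under eq_bigr do rewrite occS /=; rewrite -mulr_sumr pi1 mulr1.
Qed.

Lemma occ_dist p pi nu n : is_kernel N p -> is_policy N pi -> is_dist nu ->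
  (n <= N)%N -> is_dist (occ p pi nu n).
Proof.
move=> pk pip nud; elim: n => [//|n IH] nN; have {}IH := IH (ltnW nN).
have [oc0 oc1] := IH; split=> [xa|].
  rewrite occS mulr_ge0 //; last by case: (pip n.+1 nN xa.1).
  by apply: sumr_ge0 => ya _; rewrite mulr_ge0 //; case: (pk n.+1 nN ya).
rewrite sum_pair; under eq_bigr do rewrite (sum_occS _ _ (pip n.+1 nN _)).
rewrite exchange_big /= -[RHS]oc1; apply: eq_bigr => ya _.
by rewrite -mulr_sumr; case: (pk n.+1 nN ya) => _ ->; rewrite mulr1.
Qed.

Definition kernel_gap p q (n : nat) (ya : X * A) : R := \sum_x `|p n ya x - q n ya x|.

Lemma kernel_gap_ge0 p q n ya : 0 <= kernel_gap p q n ya.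
Proof. exact: sumr_ge0. Qed.

Lemma kernel_gap_le2 p q n ya : is_dist (p n ya) -> is_dist (q n ya) ->
  kernel_gap p q n ya <= 2.
Proof.
move=> [u0 u1] [v0 v1].
have -> : 2 = \sum_x (p n ya x + q n ya x) :> R by rewrite big_split /= u1 v1.
apply: ler_sum => xa _; apply: le_trans (ler_normB _ _) _.
by rewrite !ger0_norm.
Qed.

Lemma kernel_gapC p q n ya : kernel_gap p q n ya = kernel_gap q p n ya.
Proof. by apply: eq_bigr => x _; rewrite distrC. Qed.

(** Each difference of products is split so that the new error is weighted by the first occupancy,
    that of [p], [pi], [nu], while [q] and [pi'] only transport the error already made. Choosing
    which model comes first is choosing the law under which kernel errors are measured. *)
Lemma occ_gap p q pi pi' nu nu' n :
  is_kernel N p -> is_kernel N q -> is_policy N pi -> is_policy N pi' ->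
  is_dist nu -> (n <= N)%N ->
  norm1 (occ p pi nu n - occ q pi' nu' n) <= norm1 (nu - nu') +
    \sum_(k < n) (\sum_ya occ p pi nu k ya * kernel_gap p q k.+1 ya +
       \sum_x (\sum_a occ p pi nu k.+1 (x, a)) *
          \sum_a `|pi k.+1 x a - pi' k.+1 x a|).
Proof.
move=> pk qk pip pip' nud; elim: n => [|n IH] nN; first by rewrite big_ord0 addr0.
have {}IH := IH (ltnW nN).
rewrite big_ord_recr /= addrA; apply: le_trans (lerD IH (lexx _)) => {IH}.
set m := occ p pi nu n; set m' := occ q pi' nu' n.
have [m0 m1] : is_dist m by apply: occ_dist => //; exact: ltnW.
rewrite norm1E sum_pair.
pose S x := \sum_ya m ya * p n.+1 ya x; pose S' x := \sum_ya m' ya * q n.+1 ya x.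
have S0 x : 0 <= S x.
  by apply: sumr_ge0 => ya _; rewrite mulr_ge0 //; case: (pk n.+1 nN ya).
have H1 : \sum_x \sum_a `|occ p pi nu n.+1 (x, a) - occ q pi' nu' n.+1 (x, a)| <=
   \sum_x S x * \sum_a `|pi n.+1 x a - pi' n.+1 x a| + \sum_x `|S x - S' x|.
  rewrite -big_split /=; apply: ler_sum => x _.
  have [pi'0 pi'1] := pip' n.+1 nN x.
  rewrite -[X in _ + X]mulr1 -pi'1 !mulr_sumr -big_split /=; apply: ler_sum => a _.
  rewrite !ffunE /= -/m -/m' -/(S x) -/(S' x).
  have -> : S x * pi n.+1 x a - S' x * pi' n.+1 x a =
     S x * (pi n.+1 x a - pi' n.+1 x a) + (S x - S' x) * pi' n.+1 x a by ring.
  apply: le_trans (ler_normD _ _) _.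
  by rewrite !normrM (ger0_norm (S0 x)) (ger0_norm (pi'0 a)).
apply: le_trans H1 _.
have H2 : \sum_x `|S x - S' x| <= norm1 (m - m') + \sum_ya m ya * kernel_gap p q n.+1 ya.
  rewrite norm1E -big_split /=.
  have -> : \sum_ya (`|m ya - m' ya| + m ya * kernel_gap p q n.+1 ya) =
    \sum_x \sum_ya (`|m ya - m' ya| * q n.+1 ya x + m ya * `|p n.+1 ya x - q n.+1 ya x|).
    rewrite exchange_big /=; apply: eq_bigr => ya _.
    by rewrite big_split /= -!mulr_sumr; case: (qk n.+1 nN ya) => _ ->; rewrite mulr1.
  apply: ler_sum => x _; rewrite -sumrB; apply: le_trans (ler_norm_sum _ _ _) _.
  apply: ler_sum => ya _; have [q0 _] := qk n.+1 nN ya.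
  have -> : m ya * p n.+1 ya x - m' ya * q n.+1 ya x =
     (m ya - m' ya) * q n.+1 ya x + m ya * (p n.+1 ya x - q n.+1 ya x) by ring.
  by apply: le_trans (ler_normD _ _) _; rewrite !normrM (ger0_norm (q0 x)) (ger0_norm (m0 ya)).
have -> : \sum_x (\sum_a occ p pi nu n.+1 (x, a)) * \sum_a `|pi n.+1 x a - pi' n.+1 x a| =
   \sum_x S x * \sum_a `|pi n.+1 x a - pi' n.+1 x a|.
  by apply: eq_bigr => x _; rewrite sum_occS //; exact: pip.
lra.
Qed.

Lemma occ_gap_kernel p q pi nu nu' n :
  is_kernel N p -> is_kernel N q -> is_policy N pi -> is_dist nu -> (n <= N)%N ->
  norm1 (occ p pi nu n - occ q pi nu' n) <= norm1 (nu - nu') +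
    \sum_(k < n) \sum_ya occ p pi nu k ya * kernel_gap p q k.+1 ya.
Proof.
move=> pk qk pip nud nN; apply: le_trans (occ_gap nu' pk qk pip pip nud nN) _.
rewrite lerD2l ler_sum // => k _; rewrite gerDl big1 // => x _.
by rewrite [X in _ * X]big1 ?mulr0 // => a _; rewrite subrr normr0.
Qed.

(* States without mass are harmless: there the conditional policy is
   arbitrary but both sides vanish. *)
Lemma consistent_induces q pi nu (mu : saseq R X A) n :
  consistent N q nu mu -> induces N pi mu -> (n <= N)%N -> mu n = occ q pi nu n.
Proof.
move=> [mud mu0 muS] ind; elim: n => [//|n IH] nN; apply/ffunP => -[x a].
rewrite occS /= -(IH (ltnW nN)) -muS //.
have [z|nz] := eqVneq (\sum_a0 mu n.+1 (x, a0)) 0.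
  rewrite z mul0r; have [m0 _] := mud n.+1 nN.
  by apply/eqP; move/eqP: z; rewrite psumr_eq0 // => /allP/(_ a); rewrite mem_index_enum => /(_ isT).
by rewrite ind // /cond_policy mulrC divfK.
Qed.

Lemma occ_consistent q pi nu : is_kernel N q -> is_policy N pi -> is_dist nu ->
  consistent N q nu (occ q pi nu).
Proof.
move=> qk pip nud; split=> // [n nN|n nN x]; first exact: occ_dist.
by rewrite sum_occS //; exact: pip.
Qed.

Lemma state_dist_dist (p : nat -> trans_kernel R X A) (pi : nat -> policy R X A) (rho : savec R X A) t :
  (forall s, (1 <= s < t)%N -> is_kernel N (p s) /\ is_policy N (pi s)) -> is_dist rho ->
  is_dist (state_dist N p pi rho t).
Proof.
move=> h rd; rewrite /state_dist; case: t h => [//|t] /= h.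
elim: t h => [//|t IH] h /=; have [pk pip] := h t.+1 (leqnn _).
by apply: occ_dist => //; apply: IH => s /andP[s1 st]; apply: h; rewrite s1 ltnW.
Qed.

Lemma state_distS (p : nat -> trans_kernel R X A) (pi : nat -> policy R X A) (rho : savec R X A) t :
  (0 < t)%N ->
  state_dist N p pi rho t.+1 = push N (p t) (pi t) (state_dist N p pi rho t).
Proof. by case: t. Qed.

End Occupancy.

(** * Empirical kernels *)

Section Estimator.
Context {R : realType} {X A : finType} (N : nat).
Implicit Types (w : nat -> traj X A N).

Lemma visitsS w t n xa : (0 < t)%N ->
  visits w t.+1 n xa = (visits w t n xa + (w t (inord n) == xa))%N.
Proof. by move=> t0; rewrite /visits big_nat_recr. Qed.

Lemma transitionsS w t n xa x : (0 < t)%N ->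
  transitions w t.+1 n xa x =
  (transitions w t n xa x + ((w t (inord n) == xa) && ((w t (inord n.+1)).1 == x)))%N.
Proof. by move=> t0; rewrite /transitions big_nat_recr. Qed.

Lemma sum_transitions w t n xa : (\sum_x transitions w t n xa x)%N = visits w t n xa.
Proof.
rewrite /transitions /visits exchange_big /=; apply: eq_bigr => s _.
case: (w s (inord n) == xa) => /=; last by rewrite big1.
rewrite (bigD1 (w s (inord n.+1)).1) //= eqxx big1 ?addn0 // => x /negPf.
by rewrite eq_sym => ->.
Qed.

Lemma visits_le w t n xa : (0 < t)%N -> (visits w t n xa <= t.-1)%N.
Proof.
move=> t0; rewrite /visits -[leqRHS](_ : \sum_(1 <= s < t) 1 = _)%N; last first.
  by rewrite sum_nat_const_nat muln1 subn1.
by apply: leq_sum => s _; case: eqP.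
Qed.

Lemma est_kernel_dist w t n ya : (0 < #|X|)%N ->
  is_dist (est_kernel w t n ya : X -> R).
Proof.
move=> X0; rewrite /est_kernel /is_dist /=; have [v0|v0] := posnP (visits w t n.-1 ya).
  split=> [x|]; first by rewrite invr_ge0.
  by rewrite sumr_const -[LHS]mulr_natl; apply: divff; rewrite pnatr_eq0 -lt0n.
split=> [x|]; first by rewrite divr_ge0.
rewrite -mulr_suml -natr_sum sum_transitions (maxn_idPr _) // divff //.
by rewrite pnatr_eq0 -lt0n.
Qed.

Lemma est_kernel_is_kernel w t : (0 < #|X|)%N ->
  is_kernel N (est_kernel w t : trans_kernel R X A).
Proof. by move=> X0 n _ ya; exact: est_kernel_dist. Qed.

(** The bonus with its factor [Cdelta] divided out. *)
Definition visit_weight w t n xa : R := (Num.sqrt (maxn 1 (visits w t n xa))%:R)^-1.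

Definition scored_visit w t n xa : R := (w t (inord n) == xa)%:R * visit_weight w t n xa.

Lemma visit_weight_01 w t n xa : 0 <= visit_weight w t n xa <= 1.
Proof.
rewrite /visit_weight invr_ge0 sqrtr_ge0 /= invf_le1 ?sqrtr_gt0 ?ltr0n ?leq_max //.
by rewrite -[leLHS]sqrtr1 ler_sqrt ?ler1n ?leq_max.
Qed.

Lemma scored_visit_ge0 w t n xa : 0 <= scored_visit w t n xa.
Proof. by rewrite mulr_ge0 //; case/andP: (visit_weight_01 w t n xa). Qed.

(** Successive visits to [xa] contribute 1 / sqrt(max(1, k)) for k = 0, 1, 2, ..., whatever the
    trajectories are, so the bound is deterministic. *)
Lemma sum_scored_visit w T n xa :
  \sum_(1 <= t < T.+1) scored_visit w t n xa <= 3 * Num.sqrt T%:R.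
Proof.
have H : forall m, \sum_(1 <= t < m.+1) scored_visit w t n xa
    <= 3 * Num.sqrt (visits w m.+1 n xa)%:R.
  elim=> [|m IH]; first by rewrite big_geq // mulr_ge0 // sqrtr_ge0.
  rewrite big_nat_recr //= [visits w m.+2 n xa]visitsS //.
  rewrite [scored_visit w m.+1 n xa]/scored_visit /visit_weight.
  case: eqP => _ /=; last by rewrite mul0r addr0 addn0.
  by rewrite mul1r addn1; have := @inv_sqrt_le_incr R (visits w m.+1 n xa); lra.
apply: le_trans (H T) _; rewrite ler_wpM2l // ler_wsqrtr // ler_nat.
exact: visits_le.
Qed.

(** After v >= 1 earlier visits, one more moves the empirical law by at most 2 / (v + 1) in l1, and
    v + 1 >= sqrt v. At the first visit the uniform default is replaced and the trivial bound 2
    applies, the weight being 1. *)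
Lemma est_kernel_step w t n xa : (0 < #|X|)%N -> (0 < t)%N ->
  kernel_gap (est_kernel w t.+1) (est_kernel w t) n.+1 xa <= 2 * scored_visit w t n xa.
Proof.
move=> X0 t0; have [v0|v0] := posnP (visits w t n xa).
  have [e|ne] := eqVneq (w t (inord n)) xa.
    rewrite /scored_visit /visit_weight v0 e eqxx maxn0 sqrtr1 invr1 !mulr1.
    by apply: kernel_gap_le2; exact: est_kernel_dist.
  rewrite /scored_visit (negPf ne) mul0r mulr0 /kernel_gap big1 // => x _.
  by rewrite /est_kernel /= visitsS // transitionsS // (negPf ne) !addn0 subrr normr0.
have [e|ne] := eqVneq (w t (inord n)) xa; last first.
  rewrite /scored_visit (negPf ne) mul0r mulr0 /kernel_gap big1 // => x _.
  by rewrite /est_kernel /= visitsS // transitionsS // (negPf ne) !addn0 subrr normr0.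
rewrite /scored_visit /visit_weight e eqxx mul1r (maxn_idPr v0).
set v := visits w t n xa in v0 *.
have vR : 0 < v%:R :> R by rewrite ltr0n.
have H x : `|est_kernel w t.+1 n.+1 xa x - est_kernel w t n.+1 xa x| <=
   (((w t (inord n.+1)).1 == x)%:R + (transitions w t n xa x)%:R / v%:R) / (v%:R + 1) :> R.
  rewrite /est_kernel /= visitsS // transitionsS // e eqxx /= addn1 /= -/v.
  rewrite (negPf (lt0n_neq0 v0)) (maxn_idPr v0) (maxn_idPr _) // natrD -natr1.
  clear e; set c := (transitions _ _ _ _ _)%:R; set b := (_ == x)%:R.
  have -> : (c + b) / (v%:R + 1) - c / v%:R = (b - c / v%:R) / (v%:R + 1).
    by field; rewrite !gt_eqF //; lra.
  rewrite normrM [X in _ * X]gtr0_norm ?invr_gt0; last by lra.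
  rewrite ler_wpM2r ?invr_ge0; try lra.
  apply: le_trans (ler_normB _ _) _.
  by rewrite !ger0_norm ?divr_ge0 ?ler0n.
apply: le_trans (ler_sum _ (fun x _ => H x)) _.
rewrite -mulr_suml big_split /= -mulr_suml -!natr_sum sum_transitions -/v divff ?gt_eqF //.
have -> : (\sum_i ((w t (inord n.+1)).1 == i) = 1)%N.
  rewrite (bigD1 (w t (inord n.+1)).1) //= eqxx big1 // => x /negPf.
  by rewrite eq_sym => ->.
clear e H; rewrite ler_wpM2l // lef_pV2 ?posrE ?sqrtr_gt0 //.
have s1 : 1 <= Num.sqrt v%:R :> R by rewrite -[leLHS]sqrtr1 ler_sqrt // ler1n.
have : v%:R = Num.sqrt v%:R ^+ 2 :> R by rewrite sqr_sqrtr // ltW.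
by nra.
Qed.

Lemma eq_visits w w2 t n xa : (forall s, (1 <= s < t)%N -> w s = w2 s) ->
  visits w t n xa = visits w2 t n xa.
Proof. by move=> h; apply: eq_big_nat => s /h ->. Qed.

Lemma eq_est_kernel w w2 t : (forall s, (1 <= s < t)%N -> w s = w2 s) ->
  est_kernel w t = est_kernel w2 t :> trans_kernel R X A.
Proof.
move=> h; apply/funext => n; apply/funext => xa; apply/funext => x.
rewrite /est_kernel (eq_visits _ _ h).
suff -> : transitions w t n.-1 xa x = transitions w2 t n.-1 xa x by [].
by apply: eq_big_nat => s /h ->.
Qed.

Lemma eq_state_dist (p p2 : nat -> trans_kernel R X A) (pi pi2 : nat -> policy R X A)
    (rho : savec R X A) t :
  (forall s, (1 <= s < t)%N -> p s = p2 s /\ pi s = pi2 s) ->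
  state_dist N p pi rho t = state_dist N p2 pi2 rho t.
Proof.
case: t => [//|t]; rewrite /state_dist /=; elim: t => [//|t IH] h /=.
have [-> ->] := h t.+1 (leqnn _); congr push; apply: IH => s /andP[s1 st].
by apply: h; rewrite s1 ltnW.
Qed.

End Estimator.

(** * Divergences and their gradients *)

Section Gradient.
Context {R : realType} {X A : finType} (N : nat).
Implicit Types (mu g h z : saseq R X A).

Lemma innerBr g (u v : saseq R X A) : inner N g (fun n => (u n : savec R X A) - v n) = inner N g u - inner N g v.
Proof.
rewrite /inner -sumrB; apply: eq_bigr => n _; rewrite -sumrB; apply: eq_bigr => xa _.
by rewrite !ffunE mulrBr.
Qed.

Definition shift mu h (s : R) : saseq R X A :=
  fun n => mu n + [ffun xa => s * h n xa].

Lemma gradient_dir (Phi : saseq R X A -> R) mu g h :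
  is_gradient N Phi mu g ->
  forall e : R, 0 < e -> exists2 d : R, 0 < d & forall s, 0 < s <= d ->
    `|Phi (shift mu h s) - Phi mu - s * inner N g h| <= e * s.
Proof.
move=> G e e0; set H := \sum_(n < N.+1) norm1 (h n).
have H0 : 0 <= H by apply: sumr_ge0 => n _; exact: norm1_ge0.
have [|d d0 Gd] := G (e / (H + 1)); first by rewrite divr_gt0 //; lra.
exists (d / (H + 1)); first by rewrite divr_gt0 //; lra.
move=> s /andP[s0 sd].
have E : \sum_(n < N.+1) norm1 ([ffun xa => s * h n xa] : savec R X A) = s * H.
  rewrite mulr_sumr; apply: eq_bigr => n _; rewrite mulr_sumr; apply: eq_bigr => xa _.
  by rewrite ffunE normrM gtr0_norm.
have : \sum_(n < N.+1) norm1 ([ffun xa => s * h n xa] : savec R X A) <= d.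
  rewrite E; move: sd; rewrite ler_pdivlMr; last by lra.
  by nra.
move=> /(Gd (fun n => [ffun xa => s * h n xa])).
have -> : inner N g (fun n => [ffun xa => s * h n xa]) = s * inner N g h.
  rewrite mulr_sumr; apply: eq_bigr => n _; rewrite mulr_sumr; apply: eq_bigr => xa _.
  by rewrite ffunE mulrCA.
rewrite E => /le_trans; apply.
have -> : e * s = e / (H + 1) * (s * (H + 1)) by field; rewrite gt_eqF //; lra.
by rewrite ler_wpM2l ?divr_ge0 ?ltW //; try lra; nra.
Qed.

Definition delta_dir (n0 : nat) (xa0 : X * A) : saseq R X A :=
  fun n => [ffun xa => ((n == n0) && (xa == xa0))%:R].

Lemma inner_delta g n0 xa0 : (n0 <= N)%N -> inner N g (delta_dir n0 xa0) = g n0 xa0.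
Proof.
move=> nN; rewrite /inner (bigD1 (Ordinal (nN : (n0 < N.+1)%N))) //= [X in _ + X]big1 ?addr0; last first.
  move=> n; rewrite -val_eqE /= => /negPf ne; apply: big1 => xa _.
  by rewrite ffunE ne mulr0.
rewrite (bigD1 xa0) //= big1 ?addr0 ?ffunE ?eqxx ?mulr1 // => xa /negPf ne.
by rewrite ffunE ne andbF mulr0.
Qed.

(** Only increments s > 0 occur, so the boundary m = 0 is included: there the difference quotient of
    x ln x is ln s, which is unbounded as s tends to 0, and this excludes m = 0. The perturbation
    [r], of slope [rho], later carries the total mass of a state in the [Gam] case. *)
Lemma phi_slope (m G rho K : R) (r : R -> R) : 0 <= m -> 0 <= K ->
  (forall s, 0 < s -> `|r s - s * rho| <= K * s ^+ 2) ->
  (forall e : R, 0 < e -> exists2 d : R, 0 < d & forall s, 0 < s <= d ->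
    `|((m + s) * ln (m + s) - m * ln m) - r s - s * G| <= e * s) ->
  0 < m /\ G + rho = 1 + ln m.
Proof.
move=> m0 K0 Hr HG.
have HG' : forall e : R, 0 < e -> exists2 d : R, 0 < d & forall s, 0 < s <= d ->
    `|((m + s) * ln (m + s) - m * ln m) - s * (G + rho)| <= (e + K * s) * s.
  move=> e /HG[d d0 Hd]; exists d => // s sd; have s0 : 0 < s by case/andP: sd.
  have := Hd s sd; have := Hr s s0; rewrite !ler_norml; lra.
move: m0; rewrite le_eqVlt => /predU1P[m0|m0].
  have [d d0 Hd] := HG' 1 ltr01.
  (* So small that ln s lies below G + rho - (1 + K s), against the estimate [HG'] with e = 1. *)
  pose s := Num.min (Num.min d 1) (expR (G + rho - K - 3)).
  have s0 : 0 < s by rewrite !lt_min d0 ltr01 expR_gt0.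
  have sd : s <= d by rewrite !ge_min lexx.
  have s1 : s <= 1 by rewrite !ge_min lexx orbT.
  have sE : ln s <= G + rho - K - 3.
    by rewrite -[leRHS]expRK ler_ln ?posrE ?expR_gt0 // !ge_min lexx orbT.
  have := Hd s; rewrite s0 sd => /(_ isT); rewrite -m0 add0r mul0r subr0.
  rewrite -mulrBr normrM gtr0_norm // mulrC ler_pM2r // ler_norml => /andP[h _].
  have : K * s <= K by rewrite ler_piMr.
  by lra.
split=> //; apply/eqP/negP => /negP ne.
set D := `|G + rho - (1 + ln m)|.
have D0 : 0 < D by rewrite normr_gt0 subr_eq0.
have [d d0 Hd] := HG' (D / 3) (divr_gt0 D0 (ltr0n _ 3)).
(* [L] collects the quadratic errors of [r] and of x ln x. Once L s <= D / 3, the two estimates give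
   D <= 2 D / 3. *)
pose L := K + m^-1.
have L0 : 0 < L by rewrite ltr_wpDl ?invr_gt0.
pose s := Num.min d (D / 3 / L).
have s0 : 0 < s by rewrite lt_min d0 !divr_gt0.
have sd : s <= d by rewrite ge_min lexx.
have sL : L * s <= D / 3 by rewrite mulrC -ler_pdivlMr // ge_min lexx orbT.
have := Hd s; rewrite s0 sd => /(_ isT).
have := @xlnx_deriv _ m s m0; have -> : - m < s by lra.
move=> /(_ isT) /andP[P1 P2].
have e2 : s ^+ 2 / m = s * (m^-1 * s) by rewrite expr2 mulrAC -mulrA mulrC.
rewrite e2 in P2.
have Ls : L * s = K * s + m^-1 * s by rewrite mulrDl.
set T := (m + s) * _ - _ in P1 P2 *; move=> P3.
have : s * D <= s * (D / 3 + K * s + m^-1 * s).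
  have <- : `|s * (G + rho - (1 + ln m))| = s * D by rewrite normrM gtr0_norm.
  have -> : s * (G + rho - (1 + ln m)) = (T - s * (1 + ln m)) - (T - s * (G + rho)) by ring.
  apply: le_trans (ler_normB _ _) _; rewrite (ger0_norm P1); lra.
rewrite ler_pM2l //; lra.
Qed.

End Gradient.

Section Divergence.
Context {R : realType} {X A : finType} (N : nat).
Implicit Types (mu g h z : saseq R X A) (q : trans_kernel R X A) (pi : policy R X A) (nu : savec R X A).

Local Notation phi x := (x * ln x).

Lemma shiftE mu h s n xa : shift mu h s n xa = mu n xa + s * h n xa.
Proof. by rewrite /shift !ffunE. Qed.

Lemma psi_KL_delta mu n0 xa0 s : (n0 <= N)%N ->
  psi N KL (shift mu (delta_dir n0 xa0) s) - psi N KL mu =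
  phi (mu n0 xa0 + s) - phi (mu n0 xa0).
Proof.
move=> nN; rewrite /psi -sumrB (bigD1 (Ordinal (nN : (n0 < N.+1)%N))) //= [X in _ + X]big1 ?addr0; last first.
  move=> n; rewrite -val_eqE /= => /negPf ne; rewrite -sumrB; apply: big1 => xa _.
  by rewrite shiftE ffunE ne mulr0 addr0 subrr.
rewrite -sumrB (bigD1 xa0) //= big1 ?addr0 => [|xa /negPf ne].
  by rewrite shiftE ffunE !eqxx mulr1.
by rewrite shiftE ffunE ne andbF mulr0 addr0 subrr.
Qed.

Lemma KL_gradient mu g n xa : (n <= N)%N -> 0 <= mu n xa ->
  is_gradient N (psi N KL) mu g -> 0 < mu n xa /\ g n xa = 1 + ln (mu n xa).
Proof.
move=> nN m0 /gradient_dir G; rewrite -[g n xa]addr0.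
apply: (@phi_slope _ _ _ _ 0 (fun=> 0)) => // [s _|e e0].
  by rewrite mulr0 subrr normr0 mul0r.
have [d d0 Hd] := G (delta_dir n xa) e e0; exists d => // s /Hd.
by rewrite inner_delta // psi_KL_delta // subr0.
Qed.

(** The negative entropy of the normalised [u], times its mass, written without quotients. It is
    positively homogeneous of degree one, hence not differentiable at 0 unless linear. *)
Definition ent (u : A -> R) : R := \sum_a phi (u a) - phi (\sum_a u a).

Lemma entE (u : A -> R) : (forall a, 0 <= u a) ->
  \sum_a u a * ln (u a / \sum_a' u a') = ent u.
Proof.
move=> u0; set M := \sum_a' u a'.
have : 0 <= M by exact: sumr_ge0.
rewrite le_eqVlt => /predU1P[M0|M0].
  have z a : u a = 0.
    by apply/eqP; move/esym/eqP: M0; rewrite psumr_eq0 // => /allP/(_ a); rewrite mem_index_enum => /(_ isT).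
  by rewrite /ent -/M -M0 mul0r subr0; apply: eq_bigr => a _; rewrite z !mul0r.
rewrite /ent -/M {1}/M mulr_suml -sumrB; apply: eq_bigr => a _.
move: (u0 a); rewrite le_eqVlt => /predU1P[<-|a0]; first by rewrite !mul0r subrr.
by rewrite ln_diff // mulrBr.
Qed.

Lemma psi_GamE mu : (forall n xa, (1 <= n <= N)%N -> 0 <= mu n xa) ->
  psi N Gam mu = \sum_(1 <= n < N.+1) \sum_x ent (fun a => mu n (x, a))
    + \sum_xa phi (mu 0%N xa).
Proof.
move=> m0; congr (_ + _); apply: eq_big_nat => n nN; apply: eq_bigr => x _.
by rewrite -entE // => a; exact: m0.
Qed.

Definition action_dir (n0 : nat) (x0 : X) (v : A -> R) : saseq R X A :=
  fun n => [ffun xa => ((n == n0) && (xa.1 == x0))%:R * v xa.2].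

Lemma inner_action_dir g n0 x0 v : (n0 <= N)%N ->
  inner N g (action_dir n0 x0 v) = \sum_a g n0 (x0, a) * v a.
Proof.
move=> nN; rewrite /inner (bigD1 (Ordinal (nN : (n0 < N.+1)%N))) //= [X in _ + X]big1 ?addr0; last first.
  move=> n; rewrite -val_eqE /= => /negPf ne; apply: big1 => xa _.
  by rewrite ffunE ne mul0r mulr0.
rewrite sum_pair (bigD1 x0) //= [X in _ + X]big1 ?addr0 => [|x /negPf ne].
  by apply: eq_bigr => a _; rewrite ffunE !eqxx mul1r.
by apply: big1 => a _; rewrite ffunE ne andbF mul0r mulr0.
Qed.

Lemma psi_Gam_action mu n0 x0 v s : (1 <= n0 <= N)%N -> 0 <= s -> (forall a, 0 <= v a) ->
  (forall n xa, (1 <= n <= N)%N -> 0 <= mu n xa) ->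
  psi N Gam (shift mu (action_dir n0 x0 v) s) - psi N Gam mu =
  ent (fun a => mu n0 (x0, a) + s * v a) - ent (fun a => mu n0 (x0, a)).
Proof.
move=> /andP[n1 nN] s0 v0 m0; rewrite !psi_GamE //; last first.
  by move=> n xa nn; rewrite shiftE ffunE addr_ge0 ?m0 // mulr_ge0 // mulr_ge0.
have -> : \sum_xa phi (shift mu (action_dir n0 x0 v) s 0%N xa) = \sum_xa phi (mu 0%N xa).
  apply: eq_bigr => xa _; rewrite shiftE ffunE; case: n0 n1 {nN} => // n0 _.
  by rewrite mul0r mulr0 addr0.
rewrite opprD addrACA subrr addr0 -sumrB.
rewrite (bigD1_seq n0) ?iota_uniq ?mem_index_iota ?n1 ?ltnS //= [X in _ + X]big1 ?addr0; last first.
  move=> n /negPf ne; rewrite -sumrB big1 // => x _; apply/eqP; rewrite subr_eq0; apply/eqP.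
  by congr ent; apply/funext => a; rewrite shiftE ffunE ne mul0r mulr0 addr0.
rewrite -sumrB (bigD1 x0) //= [X in _ + X]big1 ?addr0 => [|x /negPf ne].
  by congr (ent _ - _); apply/funext => a; rewrite shiftE ffunE !eqxx mul1r.
apply/eqP; rewrite subr_eq0; apply/eqP.
by congr ent; apply/funext => a; rewrite shiftE ffunE ne andbF mul0r mulr0 addr0.
Qed.

Lemma psi_Gam_delta0 mu xa0 s :
  (forall n xa, (1 <= n <= N)%N -> 0 <= mu n xa) ->
  psi N Gam (shift mu (delta_dir 0 xa0) s) - psi N Gam mu =
  phi (mu 0%N xa0 + s) - phi (mu 0%N xa0).
Proof.
move=> m0; have E n xa : (1 <= n <= N)%N -> shift mu (delta_dir 0 xa0) s n xa = mu n xa.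
  by case: n => // n _; rewrite shiftE ffunE mulr0 addr0.
rewrite !psi_GamE //; last by move=> n xa nn; rewrite E // m0.
have -> : \sum_(1 <= n < N.+1) \sum_x ent (fun a => shift mu (delta_dir 0 xa0) s n (x, a)) =
   \sum_(1 <= n < N.+1) \sum_x ent (fun a => mu n (x, a)).
  apply: eq_big_nat => n nN; apply: eq_bigr => x _; congr ent; apply/funext => a.
  by rewrite E.
rewrite opprD addrACA subrr add0r -sumrB (bigD1 xa0) //= big1 ?addr0 => [|xa /negPf ne].
  by rewrite shiftE ffunE !eqxx mulr1.
by rewrite shiftE ffunE ne andbF mulr0 addr0 subrr.
Qed.

Lemma Gam_gradient0 mu g xa : (forall n xa, (n <= N)%N -> 0 <= mu n xa) ->
  is_gradient N (psi N Gam) mu g -> 0 < mu 0%N xa /\ g 0%N xa = 1 + ln (mu 0%N xa).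
Proof.
move=> m0 /gradient_dir G; rewrite -[g 0%N xa]addr0.
apply: (@phi_slope _ _ _ _ 0 (fun=> 0)) => // [|s _|e e0]; first exact: m0.
  by rewrite mulr0 subrr normr0 mul0r.
have [d d0 Hd] := G (delta_dir 0 xa) e e0; exists d => // s /Hd.
by rewrite inner_delta // psi_Gam_delta0 ?subr0 // => n ya /andP[_]; exact: m0.
Qed.

Lemma ent_delta (u : A -> R) a0 s : ent (fun a => u a + s * (a == a0)%:R) - ent u =
  (phi (u a0 + s) - phi (u a0)) - (phi (\sum_a u a + s) - phi (\sum_a u a)).
Proof.
have -> : \sum_a u a + s = \sum_a (u a + s * (a == a0)%:R).
  rewrite big_split /=; congr (_ + _); rewrite (bigD1 a0) //= eqxx mulr1 big1 ?addr0 //.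
  by move=> a /negPf ->; rewrite mulr0.
have <- : \sum_a phi (u a + s * (a == a0)%:R) - \sum_a phi (u a) =
    phi (u a0 + s) - phi (u a0).
  rewrite -sumrB (bigD1 a0) //= eqxx mulr1 big1 ?addr0 // => a /negPf ->.
  by rewrite mulr0 addr0 subrr.
by rewrite /ent; ring.
Qed.

End Divergence.

(** * Gradient of the conditional entropy *)

Section Gam.
Context {R : realType} {X A : finType} (N : nat).
Implicit Types (mu g h z : saseq R X A) (q : trans_kernel R X A) (pi : policy R X A) (nu : savec R X A).
Local Notation phi x := (x * ln x).

(** At a state of mass M > 0, [phi_slope] applies with slope 1 + ln M for the total mass, and 1 + ln
    u - (1 + ln M) = ln pi. At a state without mass, [ent] vanishes on single actions, so the
    gradient is 0 there; on the sum of two distinct actions it equals - 2 ln 2 per unit length,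
    which contradicts differentiability. Hence there is only one action, pi = 1 and ln pi = 0. *)
Lemma Gam_gradient q pi nu g n x a : is_kernel N q -> is_policy N pi -> is_dist nu ->
  (1 <= n <= N)%N -> is_gradient N (psi N Gam) (occ q pi nu) g ->
  0 < pi n x a /\ g n (x, a) = ln (pi n x a).
Proof.
move=> qk pip nud nN /gradient_dir G; set mu := occ q pi nu.
have mu0 k xa : (k <= N)%N -> 0 <= mu k xa by move=> kN; case: (occ_dist qk pip nud kN).
have mu0' k xa : (1 <= k <= N)%N -> 0 <= mu k xa by move=> /andP[_]; exact: mu0.
have [n1 nN'] := andP nN; have [pi0 pi1] := pip n nN x.
pose u a' := mu n (x, a'); pose M := \sum_a' u a'.
have u0 a' : 0 <= u a' by exact: mu0.
have muE a' : u a' = M * pi n x a'.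
  rewrite /M /u /mu; case: (n) n1 nN pi0 pi1 => // m _ mN _ _.
  by rewrite sum_occS ?occS //; exact: pip.
have Gv v : (forall a, 0 <= v a) -> forall e : R, 0 < e -> exists2 d : R, 0 < d &
    forall s, 0 < s <= d -> `|ent (fun a => u a + s * v a) - ent u - s * \sum_a g n (x, a) * v a| <= e * s.
  move=> v0 e e0; have [d d0 Hd] := G (action_dir n x v) e e0; exists d => // s sd.
  have := Hd s sd; rewrite inner_action_dir // psi_Gam_action //.
  by case/andP: sd => /ltW.
pose da (b : A) (a' : A) : R := (a' == b)%:R.
have sum_da b (f : A -> R) : \sum_a' f a' * da b a' = f b.
  rewrite (bigD1 b) //= big1 ?addr0 /da ?eqxx ?mulr1 // => a' /negPf ->.
  by rewrite mulr0.
have [M0|M0] : 0 = M \/ 0 < M.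
- have : 0 <= M by exact: sumr_ge0.
  by rewrite le_eqVlt => /predU1P[]; [left|right].
- have uz a' : u a' = 0 by rewrite muE -M0 mul0r.
  have g0 b : g n (x, b) = 0.
    apply/eqP/negP => /negP gn; have e0 : 0 < `|g n (x, b)| / 2 by rewrite divr_gt0 ?normr_gt0.
    have [|d d0 Hd] := Gv (da b) _ _ e0; first by move=> a'; rewrite /da.
    have := Hd d; rewrite d0 lexx => /(_ isT); rewrite sum_da.
    rewrite /da (ent_delta u b d) -/M -M0 uz !subrr sub0r normrN normrM gtr0_norm //.
    by have := normr_gt0 (g n (x, b)); rewrite gn => ?; nra.
  have [[b ba]|noB] := pselect (exists b, b != a).
    exfalso; have l2 : 0 < ln 2 :> R by rewrite ln_gt0 // ltr1n.
    have [|d d0 Hd] := Gv (fun a' => da a a' + da b a') _ _ l2.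
      by move=> a'; rewrite addr_ge0 // /da.
    have := Hd d; rewrite d0 lexx => /(_ isT).
    have -> : \sum_a0 g n (x, a0) * (da a a0 + da b a0) = 0.
      by rewrite big1 // => a' _; rewrite g0 mul0r.
    have -> : ent u = 0.
      by rewrite /ent -/M -M0 mul0r subr0 big1 // => a' _; rewrite uz mul0r.
    have -> : ent (fun a0 => u a0 + d * (da a a0 + da b a0)) = - (2 * d * ln 2).
      rewrite /ent.
      have -> : \sum_a0 (u a0 + d * (da a a0 + da b a0)) = 2 * d.
        under eq_bigr do rewrite uz add0r mulrDr.
        rewrite big_split /= !sum_da; ring.
      rewrite (bigD1 a) //= (bigD1 b) //= /da !eqxx uz (uz b) (negPf ba) eq_sym (negPf ba).
      rewrite [X in _ + (_ + X)]big1 => [|a' /andP[/negPf -> /negPf ->]]; last first.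
        by rewrite uz addr0 mulr0 addr0 mul0r.
      rewrite !add0r !addr0 mulr1 lnM ?posrE //; ring.
    rewrite mulr0 !subr0 normrN gtr0_norm ?mulr_gt0 //.
    by have := mulr_gt0 l2 d0; lra.
  have pi1a : pi n x a = 1.
    rewrite -pi1 (bigD1 a) //= big1 ?addr0 // => b ba; exfalso; apply: noB.
    by exists b.
  by rewrite g0 pi1a ln1.
have [| | |um ge] := @phi_slope R (u a) (g n (x, a)) (1 + ln M) M^-1 (fun s => phi (M + s) - phi M) (u0 a).
- by rewrite invr_ge0 ltW.
- move=> s s0; have := @xlnx_deriv _ M s M0; have -> : - M < s by lra.
  by move=> /(_ isT) /andP[h1 h2]; rewrite ger0_norm // [leRHS]mulrC.
- move=> e e0; have [|d d0 Hd] := Gv (da a) _ e e0; first by move=> a'; rewrite /da.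
  exists d => // s sd; have := Hd s sd; rewrite sum_da.
  by rewrite /da ent_delta -/M.
have pa : 0 < pi n x a.
  by move: um; rewrite muE pmulr_rgt0.
split=> //; move: ge; rewrite muE lnM ?posrE //; lra.
Qed.

End Gam.

(** * Bregman divergences at an iterate, and their strong convexity *)

Section Bregman.
Context {R : realType} {X A : finType} (N : nat).
Implicit Types (mu m g h z : saseq R X A) (q : trans_kernel R X A) (pi : policy R X A) (nu : savec R X A).
Local Notation phi x := (x * ln x).

Lemma sum_split0 (F : nat -> R) :
  \sum_(n < N.+1) F n = F 0%N + \sum_(1 <= n < N.+1) F n.
Proof. by rewrite -(big_mkord xpredT F) big_ltn. Qed.

Lemma xlogE (x y y' : R) : y' != 0 -> xlog x y y' = (x * ln (y / y'))%:E.
Proof.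
move=> y0; rewrite /xlog (negPf y0); case: eqP => // ->.
by rewrite mul0r.
Qed.

(** [bregman] without its infinite value; by [bregmanE] the two agree at an iterate where [psi] has
    a gradient. *)
Definition bregman_real (K : divergence) mu m pi : R :=
  match K with
  | KL => \sum_(n < N.+1) \sum_xa mu n xa * ln (mu n xa / m n xa)
  | Gam => \sum_(1 <= n < N.+1) \sum_x \sum_a
             mu n (x, a) * ln (cond_policy mu n x a / pi n x a)
           + \sum_xa mu 0%N xa * ln (mu 0%N xa / m 0%N xa)
  end.

Lemma mul_ln_div (y x : R) : 0 <= y -> 0 < x -> y * ln (y / x) = phi y - y * ln x.
Proof.
rewrite le_eqVlt => /predU1P[<-|y0] x0; first by rewrite !mul0r subrr.
by rewrite ln_diff // mulrBr.
Qed.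

Lemma mul_ln_cond mu n x a (c : R) : (forall xa, 0 <= mu n xa) -> 0 < c ->
  mu n (x, a) * ln (cond_policy mu n x a / c) =
  mu n (x, a) * ln (cond_policy mu n x a) - mu n (x, a) * ln c.
Proof.
move=> m0 c0; move: (m0 (x, a)); rewrite le_eqVlt => /predU1P[<-|y0]; first by rewrite !mul0r subrr.
rewrite ln_diff ?mulrBr // /cond_policy divr_gt0 // (bigD1 a) //= ltr_pwDl //.
by apply: sumr_ge0.
Qed.

Lemma occ_cond q pi nu n x a : is_policy N pi -> (1 <= n <= N)%N ->
  \sum_a' occ q pi nu n (x, a') != 0 -> cond_policy (occ q pi nu) n x a = pi n x a.
Proof.
case: n => // n pip nN; rewrite /cond_policy sum_occS; last exact: pip.
by rewrite occS /= mulrC => nz; rewrite mulKf.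
Qed.

Lemma occ_mul_ln q pi nu n x a : is_policy N pi -> (1 <= n <= N)%N ->
  let m := occ q pi nu in
  m n (x, a) * ln (cond_policy m n x a) = m n (x, a) * ln (pi n x a).
Proof.
move=> pip nN m; have [z|nz] := eqVneq (\sum_a' m n (x, a')) 0; last by rewrite occ_cond.
suff -> : m n (x, a) = 0 by rewrite !mul0r.
case: n nN z => // n nN; rewrite sum_occS; last exact: pip.
by rewrite /m occS /= => ->; rewrite mul0r.
Qed.

Section AtIterate.
Context (q : trans_kernel R X A) (pi : policy R X A) (nu : savec R X A) (K : divergence)
  (g : saseq R X A).
Context (qk : is_kernel N q) (pip : is_policy N pi) (nud : is_dist nu)
  (gr : is_gradient N (psi N K) (occ q pi nu) g).
Let m := occ q pi nu.

Let md n : (n <= N)%N -> is_dist (m n).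
Proof. exact: occ_dist. Qed.

Let m0 n xa : (n <= N)%N -> 0 <= m n xa.
Proof. by move=> /md[]. Qed.

Lemma bregmanE mu : (forall n, (n <= N)%N -> is_dist (mu n)) ->
  bregman N K mu m pi = (bregman_real K mu m pi)%:E.
Proof.
move=> mud; case: (K) gr => G /=.
  rewrite -sumEFin; apply: eq_bigr => n _; rewrite -sumEFin; apply: eq_bigr => xa _.
  rewrite xlogE // gt_eqF //; have nN : (n <= N)%N by rewrite -ltnS.
  by case: (KL_gradient nN (m0 xa nN) G).
rewrite EFinD -!sumEFin; congr (_ + _)%E; last first.
  apply: eq_bigr => xa _; rewrite xlogE // gt_eqF //.
  by case: (Gam_gradient0 xa m0 G).
apply: eq_big_nat => n nN; rewrite -sumEFin; apply: eq_bigr => x _.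
rewrite -sumEFin; apply: eq_bigr => a _; rewrite xlogE // gt_eqF //.
by case: (Gam_gradient x a qk pip nud nN G).
Qed.

(** The constant 1 in the derivative of x ln x cancels because both arguments have mass one. In the
    [Gam] case [occ_mul_ln] exchanges the conditional policy of [m] for [pi], also at states without
    mass. *)
Lemma bregman_realE mu : (forall n, (n <= N)%N -> is_dist (mu n)) ->
  bregman_real K mu m pi = psi N K mu - psi N K m - inner N g (fun n => mu n - m n).
Proof.
move=> mud; case: (K) gr => G /=.
  rewrite /inner -!sumrB; apply: eq_bigr => n _; have nN : (n <= N)%N by rewrite -ltnS.
  have [mu0 mu1] := mud n nN; have [_ m1] := md nN.
  apply/eqP; rewrite -subr_eq0 -!sumrB.
  rewrite (eq_bigr (fun xa => mu n xa - m n xa)) ?sumrB ?mu1 ?m1 ?subrr // => xa _.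
  have [mp ->] := KL_gradient nN (m0 xa nN) G.
  by rewrite !ffunE -/m mul_ln_div //; ring.
rewrite /inner (sum_split0 (fun n => \sum_xa g n xa * (mu n - m n) xa)).
have E0 : \sum_xa mu 0%N xa * ln (mu 0%N xa / m 0%N xa) =
    \sum_xa phi (mu 0%N xa) - \sum_xa phi (m 0%N xa) - \sum_xa g 0%N xa * (mu 0%N - m 0%N) xa.
  have [mu0 mu1] := mud 0%N (leq0n _); have [_ m1] := md (leq0n N).
  apply/eqP; rewrite -subr_eq0 -!sumrB.
  rewrite (eq_bigr (fun xa => mu 0%N xa - m 0%N xa)) ?sumrB ?mu1 ?m1 ?subrr // => xa _.
  have [mp ->] := Gam_gradient0 xa m0 G.
  by rewrite !ffunE -/m mul_ln_div //; ring.
rewrite E0.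
have -> : \sum_(1 <= n < N.+1) \sum_x \sum_a mu n (x, a) * ln (cond_policy mu n x a / pi n x a) =
    \sum_(1 <= n < N.+1) \sum_x \sum_a mu n (x, a) * ln (cond_policy mu n x a)
  - \sum_(1 <= n < N.+1) \sum_x \sum_a m n (x, a) * ln (cond_policy m n x a)
  - \sum_(1 <= n < N.+1) \sum_xa g n xa * (mu n - m n) xa; last by ring.
rewrite -!sumrB; apply: eq_big_nat => n nN; rewrite sum_pair -!sumrB; apply: eq_bigr => x _.
rewrite -!sumrB; apply: eq_bigr => a _.
have [pp ->] := Gam_gradient x a qk pip nud nN G.
rewrite mul_ln_cond //; last by case/andP: nN => _ /mud[].
by rewrite (occ_mul_ln q nu x a pip nN) !ffunE -/m; ring.
Qed.

(** Each term is x ln x at some x in [0, 1], or that value at a conditional probability times the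
    mass of its state; its absolute value is at most 1. *)
Lemma psi_bound mu : (forall n, (n <= N)%N -> is_dist (mu n)) ->
  `|psi N K mu| <= (N.+1 * #|{: X * A}|)%:R.
Proof.
move=> mud.
have B0 y : 0 <= y <= 1 -> `|phi y| <= 1 :> R.
  by move=> /andP[y0 y1]; rewrite ler_norml xlnx_ge //= (le_trans (xlnx_le0 _)) ?y0.
have B1 n xa : (n <= N)%N -> `|phi (mu n xa)| <= 1.
  by move=> nN; apply: B0; rewrite (dist_le1 _ (mud n nN)); case: (mud n nN) => ->.
have -> : (N.+1 * #|{: X * A}|)%:R = \sum_(n < N.+1) \sum_(xa : X * A) 1 :> R.
  by rewrite !sumr_const card_ord -mulrnA mulnC.
case: (K) => /=.
  apply: le_trans (ler_norm_sum _ _ _) _; apply: ler_sum => n _.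
  apply: le_trans (ler_norm_sum _ _ _) _; apply: ler_sum => xa _.
  by apply: B1; rewrite -ltnS.
rewrite (sum_split0 (fun=> \sum_(xa : X * A) 1)) addrC; apply: le_trans (ler_normD _ _) _.
apply: lerD.
  by apply: le_trans (ler_norm_sum _ _ _) _; apply: ler_sum => xa _; exact: B1.
apply: le_trans (ler_norm_sum _ _ _) _; apply: ler_sum_nat => n /andP[_ nN].
have [u0 u1] := mud n nN.
rewrite sum_pair; apply: le_trans (ler_norm_sum _ _ _) _; apply: ler_sum => x _.
apply: le_trans (ler_norm_sum _ _ _) _; apply: ler_sum => a _.
rewrite /cond_policy; set M := \sum_a' _.
have uM : mu n (x, a) <= M by rewrite /M (bigD1 a) //= lerDl sumr_ge0.
have M1 : M <= 1.
  rewrite -u1 sum_pair (bigD1 x) //= lerDl sumr_ge0 // => *; exact: sumr_ge0.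
have [z|nz] := eqVneq M 0.
  have -> : mu n (x, a) = 0 by apply/eqP; rewrite eq_le u0 -z uM.
  by rewrite mul0r normr0.
have M0 : 0 < M by rewrite lt_neqAle eq_sym nz (le_trans (u0 _) uM).
have -> : mu n (x, a) * ln (mu n (x, a) / M) = M * phi (mu n (x, a) / M).
  by field.
rewrite normrM gtr0_norm // mulr_ile1 ?normr_ge0 ?(ltW M0) // B0 //.
by rewrite divr_ge0 ?u0 ?(ltW M0) //= ler_pdivrMr // mul1r.
Qed.

Lemma young4 (e c y : R) : e * c * y <= y ^+ 2 / 4 + e ^+ 2 * c ^+ 2.
Proof. by have := sqr_ge0 (y / 2 - e * c); nra. Qed.

Lemma kl_term_ge0 (u v : savec R X A) : is_dist u -> (forall xa, 0 < v xa) -> is_dist v ->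
  0 <= \sum_xa u xa * ln (u xa / v xa).
Proof.
move=> ud v0 vd; have [u0 u1] := ud; have [_ v1] := vd.
apply: (@le_trans _ _ (\sum_xa (u xa - v xa))); first by rewrite sumrB u1 v1 subrr.
apply: ler_sum => xa _.
have := @rel_entropy_term R (u xa) (v xa); rewrite u0 (dist_le1 _ ud) v0 (dist_le1 _ vd).
move=> /(_ isT isT); have := sqr_ge0 (u xa - v xa); lra.
Qed.

(** The stability estimate of mirror descent. For [KL] the divergence dominates squared differences
    coordinatewise, and Young's inequality absorbs the linear term. For [Gam] it only sees policies:
    occupancies are compared through [occ_gap], which adds the difference of the two models. The
    power 3 of [N.+1] comes from [Y ^+ 2] summed over the steps. *)
Lemma bregman_strong q' pi' nu' (z : saseq R X A) (e Z : R) :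
  is_kernel N q' -> is_policy N pi' -> is_dist nu' -> 0 <= e ->
  (forall n xa, (n <= N)%N -> `|z n xa| <= Z) ->
  e * inner N z (fun n => m n - occ q' pi' nu' n) <= bregman_real K (occ q' pi' nu') m pi
    + e ^+ 2 * Z ^+ 2 * (N.+1 ^ 3 * #|{: X * A}|)%:R
    + e * Z * N.+1%:R * (norm1 (nu' - nu) + \sum_(k < N) \sum_ya kernel_gap q' q k.+1 ya).
Proof.
move=> qk' pip' nud' e0 zZ; set mu := occ q' pi' nu'.
have mud n : (n <= N)%N -> is_dist (mu n) by exact: occ_dist.
have [xa0 _] : exists xa : X * A, True.
  case: (pickP (fun xa : X * A => true)) => [xa _|none]; first by exists xa.
  by case: nud => _; rewrite big_pred0 // => /eqP; rewrite eq_sym oner_eq0.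
have Z0 : 0 <= Z := le_trans (normr_ge0 _) (zZ 0%N xa0 (leq0n _)).
set S := norm1 _ + _; have S0 : 0 <= S.
  rewrite addr_ge0 ?norm1_ge0 // sumr_ge0 // => k _; rewrite sumr_ge0 // => ya _.
  exact: kernel_gap_ge0.
have C0 : (0 < #|{: X * A}|)%N by apply/card_gt0P; exists xa0.
case: (K) gr => G.
  apply: (@le_trans _ _ (bregman_real KL mu m pi + e ^+ 2 * Z ^+ 2 * (N.+1 * #|{: X * A}|)%:R)); last first.
    rewrite -addrA lerD2l -[leLHS]addr0; apply: lerD; last by rewrite !mulr_ge0.
    rewrite ler_wpM2l ?mulr_ge0 ?sqr_ge0 // ler_nat leq_mul2r; apply/orP; right.
    by rewrite expnS leq_pmulr // expn_gt0.
  have -> : (N.+1 * #|{: X * A}|)%:R = \sum_(n < N.+1) \sum_(xa : X * A) 1 :> R.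
    by rewrite !sumr_const card_ord -mulrnA mulnC.
  rewrite /inner !mulr_sumr -big_split /=; apply: ler_sum => n _.
  have nN : (n <= N)%N by rewrite -ltnS.
  have [mu0 mu1] := mud n nN; have [_ m1] := md nN.
  rewrite !mulr_sumr.
  have -> : \sum_xa mu n xa * ln (mu n xa / m n xa) =
     \sum_xa (mu n xa * ln (mu n xa / m n xa) - mu n xa + m n xa).
    by rewrite big_split sumrB /= mu1 m1 subrK.
  rewrite -big_split /=; apply: ler_sum => xa _; rewrite !ffunE -/m -/mu mulr1.
  have [mp _] := KL_gradient nN (m0 xa nN) G.
  have := @rel_entropy_term R (mu n xa) (m n xa).
  rewrite mu0 mp (dist_le1 _ (mud n nN)) (dist_le1 _ (md nN)) => /(_ isT isT).
  have := young4 e `|z n xa| `|mu n xa - m n xa|.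
  rewrite [in X in _ <= X / 4 + _]real_normK ?num_real //.
  have : `|z n xa| ^+ 2 <= Z ^+ 2 by rewrite ler_pXn2r ?nnegrE ?zZ.
  have : e * (z n xa * (m n xa - mu n xa)) <= e * `|z n xa| * `|mu n xa - m n xa|.
    by rewrite distrC -mulrA -normrM ler_wpM2l // ler_norm.
  by have := sqr_ge0 e; nra.
(* At each of the [N.+1] steps the occupancies differ by at most [S] plus all policy gaps, so this
   is the coefficient of a policy gap. *)
pose Y := e * (Z * N.+1%:R).
pose D (k : nat) := \sum_x (\sum_a mu k.+1 (x, a)) * \sum_a `|pi' k.+1 x a - pi k.+1 x a|.
have D0 k : (k < N)%N -> 0 <= D k.
  move=> kN; apply: sumr_ge0 => x _; rewrite mulr_ge0 // sumr_ge0 // => a _.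
  by case: (mud k.+1 kN).
have H1 : inner N z (fun n => m n - mu n) <= Z * N.+1%:R * (S + \sum_(k < N) D k).
  have -> : Z * N.+1%:R * (S + \sum_(k < N) D k) = \sum_(n < N.+1) Z * (S + \sum_(k < N) D k).
    by rewrite sumr_const card_ord -mulr_natr; ring.
  apply: ler_sum => n _; have nN : (n <= N)%N by rewrite -ltnS.
  apply: (@le_trans _ _ (Z * norm1 (mu n - m n))).
    rewrite norm1E mulr_sumr; apply: ler_sum => xa _; rewrite !ffunE.
    apply: le_trans (ler_norm _) _; rewrite normrM distrC.
    by rewrite ler_wpM2r // zZ.
  rewrite ler_wpM2l //; apply: le_trans (occ_gap nu qk' qk pip' pip nud' nN) _.
  rewrite /S -addrA lerD2l.
  pose F (k : nat) := \sum_ya mu k ya * kernel_gap q' q k.+1 ya + D k.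
  have F0 k : (k < N)%N -> 0 <= F k.
    move=> kN; rewrite addr_ge0 ?D0 // sumr_ge0 // => ya _.
    by rewrite mulr_ge0 ?kernel_gap_ge0 //; case: (mud k (ltnW kN)).
  have FnN : \sum_(0 <= k < n) F k <= \sum_(0 <= k < N) F k.
    rewrite [leRHS](@big_cat_nat _ _ _ n) //= lerDl big_nat_cond.
    by apply: sumr_ge0 => k /andP[/andP[_ kN] _]; exact: F0.
  rewrite !big_mkord in FnN; apply: le_trans FnN _.
  rewrite big_split /= lerD2r; apply: ler_sum => k _; apply: ler_sum => ya _.
  by rewrite ler_piMl ?kernel_gap_ge0 // (dist_le1 _ (mud k (ltnW (ltn_ord k)))).
have H2 k : (k < N)%N -> Y * D k <=
    \sum_x \sum_a mu k.+1 (x, a) * ln (cond_policy mu k.+1 x a / pi k.+1 x a) + Y ^+ 2 * #|A|%:R.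
  move=> kN; have [mu0 mu1] := mud k.+1 kN.
  have -> : Y ^+ 2 * #|A|%:R = \sum_x (\sum_a mu k.+1 (x, a)) * (Y ^+ 2 * #|A|%:R).
    by rewrite -mulr_suml -sum_pair mu1 mul1r.
  rewrite /D mulr_sumr -big_split /=; apply: ler_sum => x _.
  set M := \sum_a mu k.+1 (x, a); have [M0|M0] := eqVneq M 0.
    rewrite M0 !mul0r mulr0 addr0 sumr_ge0 // => a _.
    suff -> : mu k.+1 (x, a) = 0 by rewrite mul0r.
    by apply/eqP; move/eqP: M0; rewrite psumr_eq0 // => /allP/(_ a); rewrite mem_index_enum => /(_ isT).
  have Mp : 0 <= M by apply: sumr_ge0.
  have [p'0 p'1] := pip' k.+1 kN x; have [_ p1] := @pip k.+1 kN x.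
  have -> : \sum_a mu k.+1 (x, a) * ln (cond_policy mu k.+1 x a / pi k.+1 x a) =
     M * \sum_a (pi' k.+1 x a * ln (pi' k.+1 x a / pi k.+1 x a) - pi' k.+1 x a + pi k.+1 x a).
    rewrite big_split sumrB /= p'1 p1 subrK mulr_sumr; apply: eq_bigr => a _.
    rewrite occ_cond // mulrA; congr (_ * _).
    by rewrite /M sum_occS ?occS //; exact: pip'.
  rewrite mulrCA -mulrDr ler_wpM2l //.
  have -> : Y ^+ 2 * #|A|%:R = \sum_(a : A) Y ^+ 2 by rewrite sumr_const mulr_natr.
  rewrite mulr_sumr -big_split /=; apply: ler_sum => a _.
  have [pp _] := @Gam_gradient _ _ _ _ _ _ _ _ k.+1 x a qk pip nud kN G.
  have := @rel_entropy_term R (pi' k.+1 x a) (pi k.+1 x a).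
  rewrite p'0 pp (dist_le1 _ (pip' k.+1 kN x)) (dist_le1 _ (@pip k.+1 kN x)) => /(_ isT isT).
  have := young4 Y 1 `|pi' k.+1 x a - pi k.+1 x a|.
  by rewrite real_normK ?num_real //; lra.
have H3 : Y * \sum_(k < N) D k <= bregman_real Gam mu m pi + N%:R * (Y ^+ 2 * #|A|%:R).
  have kl0 : 0 <= \sum_xa mu 0%N xa * ln (mu 0%N xa / m 0%N xa).
    apply: kl_term_ge0 (mud 0%N (leq0n _)) _ (md (leq0n _)) => xa.
    by case: (Gam_gradient0 xa m0 G).
  rewrite /bregman_real big_add1 /= big_mkord mulr_sumr.
  have -> : N%:R * (Y ^+ 2 * #|A|%:R) = \sum_(k < N) (Y ^+ 2 * #|A|%:R).
    by rewrite sumr_const card_ord mulr_natl.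
  rewrite addrAC -big_split /= -[leLHS]addr0 lerD // ler_sum // => k _; exact: H2.
have H4 : N%:R * (Y ^+ 2 * #|A|%:R) <= e ^+ 2 * Z ^+ 2 * (N.+1 ^ 3 * #|{: X * A}|)%:R.
  have -> : N%:R * (Y ^+ 2 * #|A|%:R) = e ^+ 2 * Z ^+ 2 * (N * N.+1 ^ 2 * #|A|)%:R.
    by rewrite !natrM /Y; ring.
  rewrite ler_wpM2l ?mulr_ge0 ?sqr_ge0 // ler_nat leq_mul //.
    by rewrite expnS leq_mul // leqnSn.
  by rewrite card_prod leq_pmull //; apply/card_gt0P; exists xa0.1.
have := ler_wpM2l e0 H1.
have -> : e * (Z * N.+1%:R * (S + \sum_(k < N) D k)) = e * Z * N.+1%:R * S + Y * \sum_(k < N) D k.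
  by rewrite /Y; ring.
lra.
Qed.

(** The instance of [bregman_strong] with zero loss and zero step. *)
Lemma bregman_real_ge0 q' pi' nu' :
  is_kernel N q' -> is_policy N pi' -> is_dist nu' ->
  0 <= bregman_real K (occ q' pi' nu') m pi.
Proof.
move=> qk' pip' nud'.
have := @bregman_strong q' pi' nu' (fun=> 0) 0 0 qk' pip' nud' (lexx _).
rewrite !mul0r expr0n /= !mul0r !addr0; apply=> n xa _.
by rewrite ffunE normr0.
Qed.

End AtIterate.
End Bregman.

(** * Estimated state distributions *)

(* [c] stands for the number of state-action pairs. *)
Section TrackingConstants.
Context {R : realType} (N c : nat) (alpha : R).

(** These become the factors of [B ^+ 2 * Q] in the summed errors: [pairs_const] counts pairs over
    all steps, each with budget [Q]; [iterate_const] is for the bonus along the iterates and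
    [target_const] for the distance of the estimates to [rho]. *)
Definition pairs_const : R := (N * c)%:R.

Definition iterate_const : R :=
  pairs_const + N%:R * ((1 - alpha)^-1 * pairs_const) + N%:R * pairs_const.

Definition target_const : R :=
  (1 - alpha)^-1 * (pairs_const + 2 * iterate_const + 2).

End TrackingConstants.

Section Tracking.
Context {R : realType} {X A : finType} (N T : nat).
Context (p : trans_kernel R X A) (rho : savec R X A) (alpha B Q : R).
Context (w w' : nat -> traj X A N) (pi : nat -> policy R X A).
Context (X0 : (0 < #|X|)%N) (pk : is_kernel N p) (rhod : is_dist rho).
Context (a01 : 0 <= alpha < 1) (contr : contracting N p alpha).
Context (B1 : 1 <= B) (Q1 : 1 <= Q) (N0 : (0 < N)%N).
Context (pip : forall t, (1 <= t <= T)%N -> is_policy N (pi t)).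

Local Notation rt t := (state_dist N (fun=> p) pi rho t).
Local Notation et t := (rho_est rho w' pi t).
Local Notation m t := (iterate rho w w' pi t).
Local Notation qq t := (occ p (pi t) (rt t)).

Definition weight_sum (u : saseq R X A) (v : nat -> traj X A N) (t : nat) : R :=
  \sum_(k < N) \sum_ya u k ya * visit_weight v t k ya.

Context (G1 : forall t n xa, (1 <= t <= T)%N -> (n < N)%N ->
  kernel_gap p (est_kernel w t) n.+1 xa <= B * visit_weight w t n xa).
Context (G1' : forall t n xa, (1 <= t <= T)%N -> (n < N)%N ->
  kernel_gap p (est_kernel w' t) n.+1 xa <= B * visit_weight w' t n xa).
Context (G2 : forall n xa, (n < N)%N ->
  \sum_(1 <= t < T.+1) qq t n xa * visit_weight w t n xa <= Q).
Context (G2' : forall n xa, (n < N)%N ->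
  \sum_(1 <= t < T.+1) occ p (pi t) (et t) n xa * visit_weight w' t n xa <= Q).
Context (G3 : forall n xa, (n < N)%N ->
  \sum_(1 <= t < T.+1) (scored_visit w t n xa : R) <= Q).
Context (feas : forall t, (1 < t <= T)%N ->
  norm1 (m t N - rho) <= B * weight_sum (m t) w t + alpha * norm1 (et t - rho)).

Let B0 : 0 <= B. Proof. exact: le_trans B1. Qed.

Let ek t : is_kernel N (est_kernel w t : trans_kernel R X A).
Proof. exact: est_kernel_is_kernel. Qed.

Let ek' t : is_kernel N (est_kernel w' t : trans_kernel R X A).
Proof. exact: est_kernel_is_kernel. Qed.

Lemma true_state_dist t : (t <= T.+1)%N -> is_dist (rt t).
Proof.
move=> tT; apply: state_dist_dist => // s /andP[s1 st]; split=> //; apply: pip.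
by rewrite s1 -ltnS (leq_trans st).
Qed.

Lemma est_state_dist t : (t <= T.+1)%N -> is_dist (et t).
Proof.
move=> tT; apply: state_dist_dist => // s /andP[s1 st]; split; first exact: ek'.
by apply: pip; rewrite s1 -ltnS (leq_trans st).
Qed.

Lemma norm1_0 (u : savec R X A) : norm1 (u - u) = 0.
Proof. by rewrite norm1E big1 // => xa _; rewrite subrr normr0. Qed.

Lemma gap_weight_sum (u : saseq R X A) v t n : (n <= N)%N -> (1 <= t <= T)%N ->
  (forall k ya, (k < N)%N -> 0 <= u k ya) ->
  (forall n xa, (n < N)%N -> kernel_gap p (est_kernel v t) n.+1 xa <= B * visit_weight v t n xa) ->
  \sum_(k < n) \sum_ya u k ya * kernel_gap p (est_kernel v t) k.+1 ya <= B * weight_sum u v t.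
Proof.
move=> nN tT u0 Gv; pose F (k : nat) := B * \sum_ya u k ya * visit_weight v t k ya.
have F0 k : (k < N)%N -> 0 <= F k.
  move=> kN; rewrite /F mulr_ge0 ?B0 // sumr_ge0 // => ya _.
  by rewrite mulr_ge0 ?u0 //; case/andP: (@visit_weight_01 R _ _ _ v t k ya).
apply: (@le_trans _ _ (\sum_(k < n) F k)).
  apply: ler_sum => k _; have kN : (k < N)%N := leq_trans (ltn_ord k) nN.
  rewrite /F mulr_sumr; apply: ler_sum => ya _.
  by rewrite mulrCA ler_wpM2l ?u0 // Gv.
rewrite /weight_sum mulr_sumr.
have : \sum_(0 <= k < n) F k <= \sum_(0 <= k < N) F k.
  rewrite [leRHS](@big_cat_nat _ _ _ n) //= lerDl big_nat_cond.
  by apply: sumr_ge0 => k /andP[/andP[_ kN] _]; exact: F0.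
by rewrite !big_mkord.
Qed.

Local Notation D := (@pairs_const R N #|{: X * A}|).
Local Notation beta := ((1 - alpha)^-1).
Local Notation av := (iterate_const N #|{: X * A}| alpha).
Local Notation atgt := (target_const N #|{: X * A}| alpha).
Local Notation W := (B ^+ 2 * Q).

Let beta0 : 0 < beta. Proof. by rewrite invr_gt0; case/andP: a01; lra. Qed.

Let D0 : 0 <= D. Proof. exact: ler0n. Qed.

Lemma weight_sum_le (u : nat -> saseq R X A) v :
  (forall n xa, (n < N)%N -> \sum_(1 <= t < T.+1) u t n xa * visit_weight v t n xa <= Q) ->
  \sum_(1 <= t < T.+1) weight_sum (u t) v t <= D * Q.
Proof.
move=> H; rewrite exchange_big /=.
have -> : D * Q = \sum_(k < N) \sum_(ya : X * A) Q.
  by rewrite /pairs_const !sumr_const card_ord -mulrnA mulr_natl mulnC.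
apply: ler_sum => k _; rewrite exchange_big /=; apply: ler_sum => ya _; exact: H.
Qed.

Lemma weight_sum_ge0 (u : saseq R X A) v t : (forall k ya, (k < N)%N -> 0 <= u k ya) ->
  0 <= weight_sum u v t.
Proof.
move=> u0; apply: sumr_ge0 => k _; apply: sumr_ge0 => ya _; rewrite mulr_ge0 ?u0 //.
by case/andP: (@visit_weight_01 R _ _ _ v t k ya).
Qed.

Lemma true_occ_ge0 t k ya : (1 <= t <= T)%N -> (k <= N)%N -> 0 <= qq t k ya.
Proof.
move=> tT kN; have tT' : (t <= T.+1)%N by rewrite leqW //; case/andP: tT.
by case: (occ_dist pk (pip tT) (true_state_dist tT') kN).
Qed.

Lemma restart_occ_dist t k : (1 <= t <= T)%N -> (k <= N)%N -> is_dist (occ p (pi t) (et t) k).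
Proof.
move=> tT kN; have tT' : (t <= T.+1)%N by rewrite leqW //; case/andP: tT.
exact: occ_dist pk (pip tT) (est_state_dist tT') kN.
Qed.

Lemma iterate_dist t k : (1 <= t <= T)%N -> (k <= N)%N -> is_dist (m t k).
Proof.
move=> tT kN; have tT' : (t <= T.+1)%N by rewrite leqW //; case/andP: tT.
exact: occ_dist (ek t) (pip tT) (est_state_dist tT') kN.
Qed.

(** Contraction compares the two starting points under the true kernel. The kernel error is then
    made from the estimate, hence weighted by the law of the restarted agent, which [G2']
    controls. *)
Lemma state_gap_step t : (1 <= t <= T)%N ->
  norm1 (rt t.+1 - et t.+1) <=
  alpha * norm1 (rt t - et t) + B * weight_sum (occ p (pi t) (et t)) w' t.
Proof.
move=> tT; have [t1 tT'] := andP tT.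
have td : is_dist (rt t) by apply: true_state_dist; rewrite leqW.
have ed : is_dist (et t) by apply: est_state_dist; rewrite leqW.
rewrite /rho_est !state_distS // -/(et t).
apply: le_trans (norm1_triangle _ _ (push N p (pi t) (et t))) _.
apply: lerD; first by apply: contr => //; exact: pip.
apply: le_trans (occ_gap_kernel _ pk (ek' t) (pip tT) ed (leqnn _)) _.
rewrite norm1_0 add0r.
apply: gap_weight_sum => // [k ya kN|n xa]; last exact: G1'.
by case: (restart_occ_dist tT (ltnW kN)).
Qed.


Lemma sum_state_gap :
  \sum_(1 <= t < T.+1) norm1 (rt t - et t) <= beta * D * (B * Q).
Proof.
pose e t := B * weight_sum (occ p (pi t) (et t)) w' t.
have e0 t : (1 <= t <= T)%N -> 0 <= e t.
  move=> tT; rewrite /e mulr_ge0 // weight_sum_ge0 // => k ya kN.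
  by case: (restart_occ_dist tT (ltnW kN)).
have := @contraction_sum _ alpha (fun t => norm1 (rt t - et t)) e T a01.
move=> /(_ (fun=> norm1_ge0 _)) H.
have {H} := H _ e0.
rewrite {1}/state_dist /= norm1_0 add0r => H.
rewrite -mulrA mulrC ler_pdivlMr; last by case/andP: a01; lra.
rewrite mulrC; apply: le_trans (H _) _.
  by move=> t /andP[t1 tT]; apply: state_gap_step; rewrite t1 ltnW.
by rewrite -mulr_sumr mulrCA ler_wpM2l // weight_sum_le.
Qed.

Lemma iterate_gap t n : (1 <= t <= T)%N -> (n <= N)%N ->
  norm1 (qq t n - m t n) <= norm1 (rt t - et t) + B * weight_sum (qq t) w t.
Proof.
move=> tT nN; have [t1 tT'] := andP tT.
have td : is_dist (rt t) by apply: true_state_dist; rewrite leqW.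
apply: le_trans (occ_gap_kernel _ pk (ek t) (pip tT) td nN) _.
rewrite lerD2l gap_weight_sum // => [k ya kN|k xa]; last exact: G1.
by apply: true_occ_ge0 => //; exact: ltnW.
Qed.

(** The visits of the sampled agent control weights under its true occupancy only. As weights are at
    most 1, passing to the iterate costs an l1 distance at each of the [N] steps. *)
Lemma iterate_weight t : (1 <= t <= T)%N ->
  weight_sum (m t) w t <= weight_sum (qq t) w t
    + N%:R * (norm1 (rt t - et t) + B * weight_sum (qq t) w t).
Proof.
move=> tT; set d := _ + B * _.
have -> : N%:R * d = \sum_(k < N) d by rewrite sumr_const card_ord mulr_natl.
rewrite -big_split /=; apply: ler_sum => k _; rewrite -lerBlDl -sumrB.
apply: le_trans (iterate_gap tT (ltnW (ltn_ord k))); rewrite norm1E.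
apply: ler_sum => ya _; rewrite -mulrBl; apply: le_trans (ler_norm _) _.
have /andP[v0 v1] := @visit_weight_01 R _ _ _ w t k ya.
by rewrite normrM (ger0_norm v0) distrC ler_piMr.
Qed.

Lemma iterate_weight_ge0 t : (1 <= t <= T)%N -> 0 <= weight_sum (m t) w t.
Proof.
move=> tT; apply: weight_sum_ge0 => k ya kN; by case: (iterate_dist tT (ltnW kN)).
Qed.

(** Passes through the true image of the estimate and the last component of the iterate. The first
    leg is an error of the restarted stream; the second is a kernel error under the iterate, and the
    constraint adds the same weight again, hence [2 * B]. The first policy obeys no constraint, so
    the diameter 2 is paid once. *)
Lemma target_step t : (1 <= t <= T)%N ->
  norm1 (et t.+1 - rho) <= alpha * norm1 (et t - rho) +
    (B * weight_sum (occ p (pi t) (et t)) w' t + 2 * B * weight_sum (m t) w t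
     + 2 * (t == 1%N)%:R).
Proof.
move=> tT; have [t1 tT'] := andP tT.
have ed : is_dist (et t) by apply: est_state_dist; rewrite leqW.
have H1 : norm1 (et t.+1 - occ p (pi t) (et t) N) <= B * weight_sum (occ p (pi t) (et t)) w' t.
  rewrite /rho_est state_distS // -/(et t) norm1C.
  apply: le_trans (occ_gap_kernel _ pk (ek' t) (pip tT) ed (leqnn _)) _.
  rewrite norm1_0 add0r gap_weight_sum // => [k ya kN|n xa]; last exact: G1'.
  by case: (restart_occ_dist tT (ltnW kN)).
have H2 : norm1 (occ p (pi t) (et t) N - m t N) <= B * weight_sum (m t) w t.
  rewrite norm1C.
  apply: le_trans (occ_gap_kernel _ (ek t) pk (pip tT) ed (leqnn _)) _.
  rewrite norm1_0 add0r; apply: le_trans (gap_weight_sum (leqnn _) tT _ (fun n xa => G1 xa tT)).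
    by rewrite ler_sum // => k _; rewrite ler_sum // => ya _; rewrite kernel_gapC.
  by move=> k ya kN; case: (iterate_dist tT (ltnW kN)).
have H3 : norm1 (m t N - rho) <= B * weight_sum (m t) w t + alpha * norm1 (et t - rho)
     + 2 * (t == 1%N)%:R.
  have [->|ne] := eqVneq t 1%N.
    have := norm1_dist_le2 (iterate_dist (t := 1) (k := N) _ (leqnn _)) rhod.
    rewrite leqnn (leq_trans t1) // => /(_ isT) h; apply: le_trans h _.
    rewrite mulr1 lerDr addr_ge0 ?mulr_ge0 ?norm1_ge0 //; last by case/andP: a01.
    by apply: iterate_weight_ge0; rewrite leqnn (leq_trans t1).
  by rewrite mulr0 addr0; apply: feas; rewrite tT' andbT ltn_neqAle eq_sym ne.
have := norm1_triangle (et t.+1) rho (occ p (pi t) (et t) N).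
have := norm1_triangle (occ p (pi t) (et t) N) rho (m t N).
lra.
Qed.

Let BQW : B * Q <= W.
Proof. by rewrite expr2 -mulrA ler_peMl // mulr_ge0 // (le_trans ler01). Qed.

Let W1 : 1 <= W.
Proof. by apply: le_trans BQW; rewrite mulr_ege1. Qed.

Let QW : Q <= W.
Proof. by apply: le_trans BQW; rewrite ler_peMl // (le_trans ler01). Qed.

Lemma sum_true_weight : B * \sum_(1 <= t < T.+1) weight_sum (qq t) w t <= D * (B * Q).
Proof. by rewrite mulrCA ler_wpM2l // weight_sum_le. Qed.

(** The second factor [B] enters here: the weight of the iterate contains state gaps that are
    already of order [B * Q]. *)
Lemma sum_iterate_weight : B * \sum_(1 <= t < T.+1) weight_sum (m t) w t <= av * W.
Proof.
have H : \sum_(1 <= t < T.+1) weight_sum (m t) w t <=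
    \sum_(1 <= t < T.+1) weight_sum (qq t) w t
    + N%:R * (\sum_(1 <= t < T.+1) norm1 (rt t - et t) +
              B * \sum_(1 <= t < T.+1) weight_sum (qq t) w t).
  rewrite mulr_sumr -big_split mulr_sumr -big_split /=; apply: ler_sum_nat => t tT.
  by apply: iterate_weight; rewrite -ltnS.
have := sum_true_weight; have := sum_state_gap.
move: H; set a := \sum_(1 <= t < T.+1) weight_sum (m t) w t.
set b := \sum_(1 <= t < T.+1) weight_sum (qq t) w t.
set c := \sum_(1 <= t < T.+1) norm1 _ => H Hc Hb.
have n0 : 0 <= N%:R :> R by exact: ler0n.
have bD : 0 <= beta * D by rewrite mulr_ge0 // ltW.
have : B * a <= B * (b + N%:R * (c + B * b)) by rewrite ler_wpM2l.
have e1 : B * (N%:R * (c + B * b)) <= B * (N%:R * (beta * D * (B * Q) + D * (B * Q))).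
  by rewrite ler_wpM2l // ler_wpM2l // lerD.
have e2 : B * (N%:R * (beta * D * (B * Q) + D * (B * Q))) = (N%:R * (beta * D) + N%:R * D) * W.
  by ring.
have e3 : D * (B * Q) <= D * W by rewrite ler_wpM2l.
rewrite mulrDr /iterate_const 2!mulrDl; rewrite e2 mulrDl in e1; lra.
Qed.

Lemma sum_target : \sum_(1 <= t < T.+1) norm1 (et t - rho) <= atgt * W.
Proof.
pose e t := B * weight_sum (occ p (pi t) (et t)) w' t + 2 * B * weight_sum (m t) w t
     + 2 * (t == 1%N)%:R.
have e0 t : (1 <= t <= T)%N -> 0 <= e t.
  move=> tT; rewrite /e !addr_ge0 ?mulr_ge0 ?iterate_weight_ge0 // weight_sum_ge0 // => k ya kN.
  by case: (restart_occ_dist tT (ltnW kN)).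
have := @contraction_sum _ alpha (fun t => norm1 (et t - rho)) e T a01.
move=> /(_ (fun=> norm1_ge0 _)) H.
have {H} := H _ e0.
rewrite {1}/rho_est {1}/state_dist /= norm1_0 add0r => H.
rewrite /target_const -mulrA mulrC ler_pdivlMr; last by case/andP: a01; lra.
rewrite mulrC; apply: le_trans (H _) _.
  by move=> t /andP[t1 tT]; apply: target_step; rewrite t1 ltnW.
rewrite /e !big_split /= -!mulr_sumr.
have h1 : B * \sum_(1 <= t < T.+1) weight_sum (occ p (pi t) (et t)) w' t <= D * (B * Q).
  by rewrite mulrCA ler_wpM2l // weight_sum_le.
have h2 := sum_iterate_weight.
have h3 : \sum_(1 <= t < T.+1) (t == 1%N)%:R <= 1 :> R.
  case: (T) => [|T']; first by rewrite big_geq.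
  rewrite big_ltn //= big_nat_cond big1 ?addr0 // => t /andP[/andP[t1 _] _].
  by rewrite gtn_eqF.
have : D * (B * Q) <= D * W by rewrite ler_wpM2l.
have := W1; lra.
Qed.

End Tracking.

(** * Mirror descent *)

Section Objective.
Context {R : realType} {X A : finType} (N : nat).
Implicit Types (mu g u h : saseq R X A).

Lemma inner_shift g mu h s : inner N g (shift mu h s) = inner N g mu + s * inner N g h.
Proof.
rewrite /inner mulr_sumr -big_split /=; apply: eq_bigr => n _.
rewrite mulr_sumr -big_split /=; apply: eq_bigr => xa _.
by rewrite shiftE mulrDr mulrCA.
Qed.

Lemma norm1oo_ge0 g : 0 <= norm1oo N g.
Proof. by apply: sumr_ge0 => n _; exact: bigmax_ge_id. Qed.

Lemma le_norm1oo g n xa : (n <= N)%N -> `|g n xa| <= norm1oo N g.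
Proof.
move=> nN; rewrite /norm1oo (bigD1 (Ordinal (nN : (n < N.+1)%N))) //= -[leLHS]addr0 lerD //.
  exact: le_bigmax.
by apply: sumr_ge0 => k _; exact: bigmax_ge_id.
Qed.

Lemma inner_le_norm1oo g u (e : R) : (forall n, (n <= N)%N -> norm1 (u n) <= e) ->
  inner N g u <= norm1oo N g * e.
Proof.
move=> ue; rewrite /norm1oo mulr_suml; apply: ler_sum => n _.
have nN : (n <= N)%N by rewrite -ltnS.
have m0 : 0 <= \big[Num.max/0]_xa `|g n xa| by exact: bigmax_ge_id.
apply: le_trans (ler_wpM2l m0 (ue n nN)); rewrite /norm1 mulr_sumr; apply: ler_sum => xa _.
apply: le_trans (ler_norm _) _; rewrite normrM ler_wpM2r //; exact: le_bigmax.
Qed.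

Lemma inner_le_sup g u (Z e : R) : 0 <= Z -> (forall n xa, (n <= N)%N -> `|g n xa| <= Z) ->
  (forall n, (n <= N)%N -> norm1 (u n) <= e) -> inner N g u <= Z * N.+1%:R * e.
Proof.
move=> Z0 gZ ue; have -> : Z * N.+1%:R * e = \sum_(n < N.+1) Z * e.
  by rewrite sumr_const card_ord -mulr_natr; ring.
apply: ler_sum => n _; have nN : (n <= N)%N by rewrite -ltnS.
apply: le_trans (ler_wpM2l Z0 (ue n nN)); rewrite /norm1 mulr_sumr; apply: ler_sum => xa _.
by apply: le_trans (ler_norm _) _; rewrite normrM ler_wpM2r ?gZ.
Qed.

Lemma objective_lipschitz (f : nat -> savec R X A -> R) (l : R) mu mu' :
  (forall n, (1 <= n <= N)%N -> lipschitz_fun l (f n)) ->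
  `|objective N f mu - objective N f mu'| <= l * \sum_(1 <= n < N.+1) norm1 (mu n - mu' n).
Proof.
move=> fl; rewrite /objective -sumrB mulr_sumr; apply: le_trans (ler_norm_sum _ _ _) _.
by apply: ler_sum_nat => n nN; exact: fl.
Qed.

(** Test the subgradient inequality on a single coordinate moved by 1 and by -1. *)
Lemma subgradient_bound (f : nat -> savec R X A -> R) (l : R) mu g n xa :
  0 <= l -> (forall n, (1 <= n <= N)%N -> lipschitz_fun l (f n)) ->
  is_subgradient N (objective N f) mu g -> (n <= N)%N -> `|g n xa| <= l.
Proof.
move=> l0 fl sg nN.
have H s : `|s| = 1 -> s * g n xa <= l.
  move=> s1; pose mu' := shift mu (delta_dir n xa) s.
  have e k : mu' k - mu k = [ffun ya => s * delta_dir n xa k ya].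
    by rewrite /mu' /shift addrC addKr.
  have := sg mu'; have -> : inner N g (fun k => mu' k - mu k) = s * g n xa.
    by rewrite innerBr inner_shift inner_delta // addrC addKr.
  have := objective_lipschitz mu' mu fl.
  have : \sum_(1 <= k < N.+1) norm1 (mu' k - mu k) <= 1.
    have nk k : norm1 (mu' k - mu k) = (k == n)%:R.
      rewrite e /norm1; have [->|ne] := eqVneq k n; last first.
        by rewrite big1 // => ya _; rewrite !ffunE (negPf ne) mulr0 normr0.
      rewrite (bigD1 xa) //= big1 ?addr0 => [|ya /negPf ne].
        by rewrite !ffunE !eqxx mulr1.
      by rewrite !ffunE eqxx ne mulr0 normr0.
    rewrite (eq_bigr _ (fun k _ => nk k)); have [n0|n0] := posnP n.
      rewrite n0 big_nat_cond big1 // => -[|k] // /andP[/andP[]] //.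
    rewrite (bigD1_seq n) ?iota_uniq ?mem_index_iota ?n0 ?ltnS //= eqxx big1 ?addr0 //.
    by move=> k /negPf ->.
  move=> /(ler_wpM2l l0); rewrite mulr1 => h1 /le_trans /(_ h1); rewrite ler_norml; lra.
rewrite ler_norml; apply/andP; split.
  by have := H (-1); rewrite normrN normr1 mulN1r => /(_ erefl); lra.
by have := H 1; rewrite normr1 mul1r => /(_ erefl).
Qed.

End Objective.

(** * Mirror descent with moving feasible sets *)

Section MirrorDescent.
Context {R : realType} {X A : finType} (N T : nat) (K : divergence).
Context (q : nat -> trans_kernel R X A) (pi : nat -> policy R X A) (nu : nat -> savec R X A).
Context (pi0 : policy R X A) (G z : nat -> saseq R X A) (eta Z Psi : R).
Context (qk : forall t, is_kernel N (q t)) (pi0p : is_policy N pi0).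
Context (pip : forall t, (1 <= t <= T)%N -> is_policy N (pi t)).
Context (nud : forall t, (1 <= t <= T)%N -> is_dist (nu t)).
Context (eta0 : 0 < eta) (Z0 : 0 <= Z) (T0 : (0 < T)%N).

Local Notation m t := (occ (q t) (pi t) (nu t)).
Local Notation cc t := (occ (q t) pi0 (nu t)).

Context (grad : forall t, (1 <= t <= T)%N -> is_gradient N (psi N K) (m t) (G t)).
Context (gradb : forall t, (1 <= t <= T)%N -> norm1oo N (G t) <= Psi).
Context (zZ : forall t n xa, (1 <= t <= T)%N -> (n <= N)%N -> `|z t n xa| <= Z).
Context (opt : forall t, (1 <= t < T)%N -> forall s : R, 0 < s <= 1 ->
  let mu := shift (m t.+1) (fun n => cc t.+1 n - m t.+1 n) s in
  eta * inner N (z t) (m t.+1) + bregman_real N K (m t.+1) (m t) (pi t) <=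
  eta * inner N (z t) mu + bregman_real N K mu (m t) (pi t) :> R).

Let md t n : (1 <= t <= T)%N -> (n <= N)%N -> is_dist (m t n).
Proof. by move=> tT; apply: occ_dist => //; [exact: pip|exact: nud]. Qed.

Let cd t n : (1 <= t <= T)%N -> (n <= N)%N -> is_dist (cc t n).
Proof. by move=> tT; apply: occ_dist => //; exact: nud. Qed.

Lemma segment_dist t s n : (1 <= t <= T)%N -> (n <= N)%N -> 0 < s <= 1 ->
  is_dist (shift (m t) (fun n => cc t n - m t n) s n).
Proof.
move=> tT nN /andP[s0 s1]; have [m0 m1] := md tT nN; have [c0 c1] := cd tT nN.
split=> [xa|].
  rewrite shiftE !ffunE; have := m0 xa; have := c0 xa; nra.
under eq_bigr do rewrite shiftE !ffunE.
by rewrite big_split /= -mulr_sumr sumrB m1 c1 subrr mulr0 addr0.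
Qed.

(** Optimality on the segment from the new iterate to the new comparator, divided by its parameter
    [s] as [s] tends to 0. The gradient of [psi] at the new iterate gives the slope of the
    divergence. *)
Lemma first_order t : (1 <= t < T)%N ->
  eta * inner N (z t) (fun n => m t.+1 n - cc t.+1 n) <=
  inner N (G t.+1) (fun n => cc t.+1 n - m t.+1 n) - inner N (G t) (fun n => cc t.+1 n - m t.+1 n).
Proof.
move=> /andP[t1 tT]; have tT1 : (1 <= t <= T)%N by rewrite t1 ltnW.
have tT2 : (1 <= t.+1 <= T)%N by [].
set h := (fun n : nat => cc t.+1 n - m t.+1 n).
have -> : inner N (z t) (fun n => m t.+1 n - cc t.+1 n) = - inner N (z t) h.
  by rewrite !innerBr opprB.
rewrite -subr_ge0; apply/ler_addgt0Pl => e e0.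
have [d d0 Hd] := gradient_dir h (grad tT2) e0.
pose s := Num.min d 1; have s0 : 0 < s by rewrite lt_min d0 ltr01.
have sd : s <= d by rewrite ge_min lexx.
have s1 : s <= 1 by rewrite ge_min lexx orbT.
have := Hd s; rewrite s0 sd => /(_ isT) /ler_normlW Hs.
have s01 : 0 < s <= 1 by rewrite s0.
have := opt (t := t) _ s01; rewrite t1 tT => /(_ isT) /=.
rewrite (bregman_realE (qk t) (pip tT1) (nud tT1) (grad tT1)); last by move=> n; exact: md.
rewrite (bregman_realE (qk t) (pip tT1) (nud tT1) (grad tT1)); last first.
  by move=> n nN; exact: segment_dist.
rewrite -/h !innerBr !inner_shift => Ho.
have : 0 <= s * (e + (inner N (G t.+1) h - inner N (G t) h - eta * - inner N (z t) h)) by nra.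
rewrite pmulr_rge0 //; rewrite /h !innerBr; lra.
Qed.

(** Change, between two episodes, of the model in which the comparator lives; the comparator itself
    moves by no more. *)
Definition drift t : R := norm1 (nu t.+1 - nu t) +
  \sum_(k < N) \sum_ya kernel_gap (q t.+1) (q t) k.+1 ya.

Lemma drift_ge0 t : 0 <= drift t.
Proof.
rewrite addr_ge0 ?norm1_ge0 // sumr_ge0 // => k _; rewrite sumr_ge0 // => ya _.
exact: kernel_gap_ge0.
Qed.

Lemma comparator_drift t n : (1 <= t < T)%N -> (n <= N)%N ->
  norm1 (cc t.+1 n - cc t n) <= drift t.
Proof.
move=> /andP[t1 tT] nN; have tT2 : (1 <= t.+1 <= T)%N by [].
apply: le_trans (occ_gap_kernel _ (qk _) (qk _) pi0p (nud tT2) nN) _.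
rewrite lerD2l.
pose F (k : nat) : R := \sum_ya kernel_gap (q t.+1) (q t) k.+1 ya.
apply: (@le_trans _ _ (\sum_(k < n) F k)).
  apply: ler_sum => k _; apply: ler_sum => ya _.
  by rewrite ler_piMl ?kernel_gap_ge0 // (dist_le1 _ (cd tT2 (ltnW (leq_trans (ltn_ord k) nN)))).
have : \sum_(0 <= k < n) F k <= \sum_(0 <= k < N) F k.
  rewrite [leRHS](@big_cat_nat _ _ _ n) //= lerDl; apply: sumr_ge0 => k _.
  by apply: sumr_ge0 => ya _; exact: kernel_gap_ge0.
by rewrite !big_mkord.
Qed.

Let Bg t (mu : saseq R X A) : R :=
  psi N K mu - psi N K (m t) - inner N (G t) (fun n => mu n - m t n).

Let C1 : R := (N.+1 ^ 3 * #|{: X * A}|)%:R.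

(** The three-point identity leaves [Bg t (cc t.+1) - Bg t.+1 (cc t.+1)], which does not telescope.
    Replacing [cc t.+1] by [cc t] in the first term costs a difference of [psi], which telescopes,
    and [Psi] times the drift. The other two drift terms come from [bregman_strong] and from moving
    the comparator in the loss. *)
Lemma descent_step t : (1 <= t < T)%N ->
  eta * inner N (z t) (fun n => m t n - cc t n) <=
    (Bg t (cc t) - Bg t.+1 (cc t.+1)) + (psi N K (cc t.+1) - psi N K (cc t))
    + (Psi + 2 * (eta * (Z * N.+1%:R))) * drift t + eta ^+ 2 * Z ^+ 2 * C1.
Proof.
move=> tT; have [t1 tT'] := andP tT; have tT1 : (1 <= t <= T)%N by rewrite t1 ltnW.
have tT2 : (1 <= t.+1 <= T)%N by [].
have H1 := first_order tT.
have H2 := bregman_strong (qk t) (pip tT1) (nud tT1) (grad tT1) (qk t.+1) (pip tT2) (nud tT2)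
  (ltW eta0) (fun n xa => @zZ t n xa tT1).
rewrite (bregman_realE (qk t) (pip tT1) (nud tT1) (grad tT1)) in H2; last by move=> n; exact: md.
rewrite -/(drift t) in H2.
have H3 : inner N (G t) (fun n => cc t n - cc t.+1 n) <= Psi * drift t.
  apply: le_trans (inner_le_norm1oo (e := drift t) _ _) _ => [n nN|].
    by rewrite norm1C; exact: comparator_drift.
  by rewrite ler_wpM2r ?drift_ge0 ?gradb.
have H4 : inner N (z t) (fun n => cc t.+1 n - cc t n) <= Z * N.+1%:R * drift t.
  by apply: inner_le_sup => // [n xa|n nN]; [exact: zZ|exact: comparator_drift].
have {}H4 := ler_wpM2l (ltW eta0) H4.
rewrite /Bg; rewrite !innerBr in H1 H2 H3 H4 *.
lra.
Qed.

Lemma mirror_descent_regret :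
  eta * (\sum_(1 <= t < T.+1) inner N (z t) (fun n => m t n - cc t n)) <=
    2 * (N.+1 * #|{: X * A}|)%:R + 2 * Psi
    + (Psi + 2 * (eta * (Z * N.+1%:R))) * (\sum_(1 <= t < T) drift t)
    + T%:R * (eta ^+ 2 * Z ^+ 2 * C1) + 2 * (eta * (Z * N.+1%:R)).
Proof.
have TT : (1 <= T <= T)%N by rewrite T0 leqnn.
have T1 : (1 <= 1 <= T)%N by rewrite leqnn.
(* This is psi(m t) + <G t, cc t - m t>, so its first value is bounded through [Psi]; at the last
   one the divergence is dropped by its sign. *)
pose a t := psi N K (cc t) - Bg t (cc t).
(* No update follows episode [T]; its loss is bounded through the diameter 2. *)
have HT : eta * inner N (z T) (fun n => m T n - cc T n) <= 2 * (eta * (Z * N.+1%:R)).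
  have := @inner_le_sup _ _ _ N (z T) (fun n => m T n - cc T n) Z 2 Z0 (fun n xa => @zZ T n xa TT).
  move=> /(_ (fun n nN => norm1_dist_le2 (md TT nN) (cd TT nN))) h.
  by have := ler_wpM2l (ltW eta0) h; lra.
have Hs : eta * (\sum_(1 <= t < T) inner N (z t) (fun n => m t n - cc t n)) <=
    (a T - a 1%N) + (Psi + 2 * (eta * (Z * N.+1%:R))) * (\sum_(1 <= t < T) drift t)
    + T%:R * (eta ^+ 2 * Z ^+ 2 * C1).
  apply: (@le_trans _ _ (\sum_(1 <= t < T) ((a t.+1 - a t)
    + (Psi + 2 * (eta * (Z * N.+1%:R))) * drift t + eta ^+ 2 * Z ^+ 2 * C1))).
    rewrite mulr_sumr; apply: ler_sum_nat => t tT.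
    by have := descent_step tT; rewrite /a; lra.
  rewrite big_split /= big_split /= (telescope_sumr a) // -mulr_sumr lerD2l.
  have C10 : 0 <= eta ^+ 2 * Z ^+ 2 * C1.
    by apply: mulr_ge0; [exact: mulr_ge0 (sqr_ge0 _) (sqr_ge0 _)|exact: ler0n].
  by rewrite sumr_const_nat -[leLHS]mulr_natl ler_wpM2r // ler_nat leq_subr.
have Ha : a T - a 1%N <= 2 * (N.+1 * #|{: X * A}|)%:R + 2 * Psi.
  have BT : 0 <= Bg T (cc T).
    have := bregman_real_ge0 (qk T) (pip TT) (nud TT) (grad TT) (qk T) pi0p (nud TT).
    by rewrite (bregman_realE (qk T) (pip TT) (nud TT) (grad TT)) // => n; exact: cd.
  have HG : inner N (G 1%N) (fun n => m 1%N n - cc 1%N n) <= Psi * 2.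
    apply: le_trans (inner_le_norm1oo (e := 2) _ _) _ => [n nN|].
      by apply: norm1_dist_le2; [exact: md|exact: cd].
    by rewrite ler_wpM2r ?gradb.
  have p1 := psi_bound K (fun n => @cd T n TT).
  have p2 := psi_bound K (fun n => @md 1%N n T1).
  move: p1 p2 BT HG; rewrite /a /Bg !innerBr !ler_norml => /andP[_ p1] /andP[p2 _]; lra.
have -> : \sum_(1 <= t < T.+1) inner N (z t) (fun n => m t n - cc t n) =
    \sum_(1 <= t < T) inner N (z t) (fun n => m t n - cc t n) + inner N (z T) (fun n => m T n - cc T n).
  by rewrite big_nat_recr.
rewrite mulrDr; lra.
Qed.

End MirrorDescent.

(** * Regret along a sample path *)

Section Feasible.
Context {R : realType} {X A : finType} (N T : nat) (delta alpha : R) (rho : savec R X A).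
Context (w w' : nat -> traj X A N) (pi : nat -> policy R X A).
Implicit Types (mu m u g : saseq R X A).

Lemma bonusE t n xa : bonus T delta w t n xa =
  if (n < N)%N then @Cdelta R X A N T delta * visit_weight w t n xa else 0.
Proof. by rewrite ffunE. Qed.

Lemma inner_bonus u t : inner N u (bonus T delta w t) = @Cdelta R X A N T delta * weight_sum u w t.
Proof.
rewrite /inner big_ord_recr /= [X in _ + X]big1 ?addr0 => [|xa _]; last first.
  by rewrite bonusE ltnn mulr0.
rewrite /weight_sum mulr_sumr; apply: eq_bigr => n _; rewrite mulr_sumr; apply: eq_bigr => xa _.
by rewrite bonusE ltn_ord mulrCA.
Qed.

Lemma eq_inner g u u' : (forall n, (n <= N)%N -> u n = u' n) -> inner N g u = inner N g u'.
Proof. by move=> uu; apply: eq_bigr => n _; rewrite uu // -ltnS. Qed.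

Lemma innerC g u : inner N g u = inner N u g.
Proof. by apply: eq_bigr => n _; apply: eq_bigr => xa _; rewrite mulrC. Qed.

Lemma innerBl (u v : saseq R X A) g :
  inner N (fun n => (u n : savec R X A) - v n) g = inner N u g - inner N v g.
Proof. by rewrite innerC innerBr !(innerC g). Qed.

Lemma eq_bregman_real K mu mu' m (pi' : policy R X A) : (forall n, (n <= N)%N -> mu n = mu' n) ->
  bregman_real N K mu m pi' = bregman_real N K mu' m pi'.
Proof.
move=> e; case: K => /=.
  by apply: eq_bigr => n _; rewrite e // -ltnS.
rewrite e //; congr (_ + _); apply: eq_big_nat => n /andP[_ nN].
by apply: eq_bigr => x _; apply: eq_bigr => a _; rewrite /cond_policy e.
Qed.

Lemma eq_feasible t mu mu' : (forall n, (n <= N)%N -> mu n = mu' n) ->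
  feasible T delta alpha rho w w' pi t mu -> feasible T delta alpha rho w w' pi t mu'.
Proof.
move=> e [[mud mu0 muS] mun]; split; first split.
- by move=> n nN; rewrite -e //; exact: mud.
- by rewrite -e.
- by move=> n nN x; rewrite -e // -[mu' n]e ?muS // ltnW.
by rewrite -e // innerC -(eq_inner _ e) innerC.
Qed.

Lemma feasible_segment t mu mu' s : 0 < s <= 1 ->
  feasible T delta alpha rho w w' pi t mu -> feasible T delta alpha rho w w' pi t mu' ->
  feasible T delta alpha rho w w' pi t (shift mu (fun n => mu' n - mu n) s).
Proof.
move=> /andP[s0 s1] [[mud mu0 muS] mun] [[mud' mu0' muS'] mun'].
have sE n xa : shift mu (fun n => mu' n - mu n) s n xa = (1 - s) * mu n xa + s * mu' n xa.
  by rewrite shiftE !ffunE; ring.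
split; first split.
- move=> n nN; have [p0 p1] := mud n nN; have [p0' p1'] := mud' n nN; split=> [xa|].
    by rewrite sE; have := p0 xa; have := p0' xa; nra.
  under eq_bigr do rewrite sE.
  by rewrite big_split /= -!mulr_sumr p1 p1' !mulr1 subrK.
- by apply/ffunP => xa; rewrite sE mu0 mu0'; ring.
- move=> n nN x; under eq_bigr do rewrite sE.
  under [RHS]eq_bigr do rewrite sE mulrDl -!mulrA.
  by rewrite !big_split /= -!mulr_sumr muS // muS'.
rewrite innerC inner_shift innerBr !(innerC _ mu) !(innerC _ mu').
have s1' : 0 <= 1 - s by lra.
have : norm1 (shift mu (fun n => mu' n - mu n) s N - rho) <=
    (1 - s) * norm1 (mu N - rho) + s * norm1 (mu' N - rho).
  rewrite !norm1E !mulr_sumr -big_split /=; apply: ler_sum => xa _.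
  have -> : shift mu (fun n => mu' n - mu n) s N xa - rho xa =
     (1 - s) * (mu N xa - rho xa) + s * (mu' N xa - rho xa) by rewrite sE; ring.
  apply: le_trans (ler_normD _ _) _; by rewrite !normrM (ger0_norm s1') (ger0_norm (ltW s0)).
have := ler_wpM2l s1' mun; have := ler_wpM2l (ltW s0) mun'.
lra.
Qed.

(** The origin of the factor N - n in [bonus_bar]: a kernel error at step k is felt at every later
    step up to N. *)
Lemma abel_sum (n : nat) (x : nat -> R) :
  \sum_(1 <= i < n.+1) \sum_(k < i) x k = \sum_(k < n) (n - k)%:R * x k.
Proof.
elim: n => [|n IH]; first by rewrite big_geq // big_ord0.
rewrite big_nat_recr //= IH big_ord_recr [RHS]big_ord_recr /= addrA -big_split /=.
rewrite subSnn mul1r; congr (_ + _); apply: eq_bigr => k _.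
by rewrite subSn 1?ltnW // -natr1 mulrDl mul1r.
Qed.

End Feasible.

(** * The regret bound on the good event *)

Section Run.
Context {R : realType} {X A : finType} (N T : nat).
Context (p : trans_kernel R X A) (rho : savec R X A) (alpha delta Q eta l Psi gamma : R).
Context (K : divergence) (f : nat -> nat -> savec R X A -> R).
Context (w w' : nat -> traj X A N) (pi : nat -> policy R X A) (g : nat -> saseq R X A).
Context (pi0 : policy R X A).
Context (X0 : (0 < #|X|)%N) (pk : is_kernel N p) (rhod : is_dist rho).
Context (a01 : 0 <= alpha < 1) (contr : contracting N p alpha).
Local Notation B := (@Cdelta R X A N T delta).
Context (B1 : 1 <= B) (Q1 : 1 <= Q) (T0 : (0 < T)%N).
Context (l0 : 0 <= l) (eta0 : 0 < eta) (gamma0 : 0 <= gamma).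
Context (flip : forall t n, (1 <= t <= T)%N -> (1 <= n <= N)%N -> lipschitz_fun l (f t n)).
Context (run : mdpp_u K eta l T delta alpha rho w w' f pi g).
Context (per : periodic_policy N p rho pi0).
Context (grad : forall t, (1 <= t <= T)%N -> exists G : saseq R X A,
  is_gradient N (psi N K) (iterate rho w w' pi t) G /\ norm1oo N G <= Psi).

Local Notation rt t := (state_dist N (fun=> p) pi rho t).
Local Notation et t := (rho_est rho w' pi t).
Local Notation m t := (iterate rho w w' pi t).
Local Notation qq t := (occ p (pi t) (rt t)).
Local Notation cc t := (occ (est_kernel w t) pi0 (et t)).
Local Notation q0 := (occ p pi0 rho).
Local Notation bbar t := (@bonus_bar R X A N l T delta w t).

Context (G1 : forall t n xa, (1 <= t <= T)%N -> (n < N)%N ->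
  kernel_gap p (est_kernel w t) n.+1 xa <= B * visit_weight w t n xa).
Context (G1' : forall t n xa, (1 <= t <= T)%N -> (n < N)%N ->
  kernel_gap p (est_kernel w' t) n.+1 xa <= B * visit_weight w' t n xa).
Context (G2 : forall n xa, (n < N)%N ->
  \sum_(1 <= t < T.+1) qq t n xa * visit_weight w t n xa <= Q).
Context (G2' : forall n xa, (n < N)%N ->
  \sum_(1 <= t < T.+1) occ p (pi t) (et t) n xa * visit_weight w' t n xa <= Q).
Context (G3 : forall n xa, (n < N)%N ->
  \sum_(1 <= t < T.+1) (scored_visit w t n xa : R) <= Q).

Let pip t : (1 <= t <= T)%N -> is_policy N (pi t).
Proof. by case: run => h _ _; exact: h. Qed.

Let ek t : is_kernel N (est_kernel w t : trans_kernel R X A).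
Proof. exact: est_kernel_is_kernel. Qed.

Let pi0p : is_policy N pi0. Proof. by case: per. Qed.

Let ed t : (1 <= t <= T)%N -> is_dist (et t).
Proof. by move=> /andP[_ tT]; apply: (est_state_dist w' X0 rhod pip); rewrite leqW. Qed.

Let cd t n : (1 <= t <= T)%N -> (n <= N)%N -> is_dist (cc t n).
Proof. by move=> tT; apply: occ_dist => //; exact: ed. Qed.

Let md t n : (1 <= t <= T)%N -> (n <= N)%N -> is_dist (m t n).
Proof. by move=> tT; apply: occ_dist => //; [exact: pip|exact: ed]. Qed.

(** From the same start, [pi0] is run in the empirical and in the true model, the empirical
    occupancy carrying the weight: this gives the bonus term. In the true model [rho] is its own
    image, so contraction gives the other term. *)
Lemma comparator_feasible t : (1 <= t <= T)%N ->
  feasible T delta alpha rho w w' pi t (cc t).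
Proof.
move=> tT; split; first by apply: occ_consistent => //; exact: ed.
rewrite innerC innerC inner_bonus.
apply: le_trans (norm1_triangle _ _ (occ p pi0 (et t) N)) _; apply: lerD.
  apply: le_trans (occ_gap_kernel _ (ek t) pk pi0p (ed tT) (leqnn _)) _.
  rewrite norm1_0 add0r.
  have := gap_weight_sum B1 (leqnn N) tT (fun k ya kN => (cd tT (ltnW kN)).1 ya) (fun n xa => @G1 t n xa tT).
  apply: le_trans; rewrite ler_sum // => k _; rewrite ler_sum // => ya _.
  by rewrite kernel_gapC.
have e : rho = push N p pi0 rho by case: per.
rewrite [X in norm1 (_ - X) <= _]e.
by apply: contr => //; exact: ed.
Qed.

(** The comparator makes the feasible set nonempty. The minimiser agrees with the iterate up to step
    [N], since [pi t.+1] generates both from the same data, and the gradient at the old iterate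
    makes the divergences finite. *)
Lemma update_iterate t : (1 <= t < T)%N ->
  feasible T delta alpha rho w w' pi t.+1 (m t.+1) /\
  forall mu, feasible T delta alpha rho w w' pi t.+1 mu ->
    eta * inner N (fun n => g t n - bbar t n) (m t.+1)
      + bregman_real N K (m t.+1) (m t) (pi t) <=
    eta * inner N (fun n => g t n - bbar t n) mu
      + bregman_real N K mu (m t) (pi t).
Proof.
move=> tT; have [t1 tT'] := andP tT; have tT1 : (1 <= t <= T)%N by rewrite t1 ltnW.
have [_ _ upd] := run.
have [mu [mf mmin ind]] := upd t tT (ex_intro _ _ (comparator_feasible (t := t.+1) tT')).
have e n : (n <= N)%N -> mu n = m t.+1 n.
  by move=> nN; apply: consistent_induces ind nN; case: mf.
split=> [|mu' mf']; first exact: eq_feasible e mf.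
have [G [Gg _]] := grad tT1.
have mud : forall n, (n <= N)%N -> is_dist (mu n) by case: mf => -[].
have mud' : forall n, (n <= N)%N -> is_dist (mu' n) by case: mf' => -[].
have := mmin mu' mf'; rewrite /step_objective.
rewrite (bregmanE (ek t) (pip tT1) (ed tT1) Gg mud).
rewrite (bregmanE (ek t) (pip tT1) (ed tT1) Gg mud').
by rewrite -!EFinD lee_fin (eq_inner _ e) (eq_bregman_real _ _ _ e).
Qed.

Lemma iterate_feasible t : (1 < t <= T)%N ->
  norm1 (m t N - rho) <= B * weight_sum (m t) w t + alpha * norm1 (et t - rho).
Proof.
case: t => [|[|t]] // tT; have [[_ H] _] := update_iterate (t := t.+1) tT.
by move: H; rewrite innerC innerC inner_bonus.
Qed.

Lemma inner_bonus_bar t u : inner N (bbar t) u =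
  l * \sum_(k < N) (N - k)%:R * (B * \sum_ya u k ya * visit_weight w t k ya).
Proof.
rewrite /inner big_ord_recr /= [X in _ + X]big1 ?addr0 => [|xa _]; last first.
  by rewrite ffunE subnn mulr0 !mul0r.
rewrite mulr_sumr; apply: eq_bigr => n _; rewrite !mulr_sumr; apply: eq_bigr => xa _.
by rewrite ffunE bonusE ltn_ord; ring.
Qed.

(** The kernel error is weighted by the comparator in the empirical model, where no visits control
    it. It is left as an inner product with [bbar t], which the bonus in the loss vector cancels in
    [pathwise_regret]. *)
Lemma comparator_loss t : (1 <= t <= T)%N ->
  objective N (f t) (cc t) - objective N (f t) q0 <=
  l * N%:R * norm1 (et t - rho) + inner N (bbar t) (cc t).
Proof.
move=> tT; pose x (k : nat) := B * \sum_ya cc t k ya * visit_weight w t k ya.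
have H n : (1 <= n <= N)%N -> norm1 (cc t n - q0 n) <= norm1 (et t - rho) + \sum_(k < n) x k.
  move=> /andP[_ nN].
  apply: le_trans (occ_gap_kernel _ (ek t) pk pi0p (ed tT) nN) _.
  rewrite lerD2l; apply: ler_sum => k _; have kN : (k < N)%N := leq_trans (ltn_ord k) nN.
  rewrite /x mulr_sumr; apply: ler_sum => ya _; rewrite mulrCA ler_wpM2l //.
    by case: (cd tT (ltnW kN)).
  by rewrite kernel_gapC G1.
have := objective_lipschitz (cc t) q0 (fun n => @flip t n tT).
move=> /ler_normlW /le_trans; apply; rewrite inner_bonus_bar -mulrA -mulrDr ler_wpM2l //.
rewrite -(abel_sum _ x).
have -> : N%:R * norm1 (et t - rho) = \sum_(1 <= n < N.+1) norm1 (et t - rho).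
  by rewrite sumr_const_nat subn1 /= mulr_natl.
by rewrite -big_split /=; apply: ler_sum_nat => n nN; exact: H.
Qed.

Lemma inner_bonus_bar_iterate t : (1 <= t <= T)%N ->
  inner N (bbar t) (m t) <= l * N%:R * (B * weight_sum (m t) w t).
Proof.
move=> tT; rewrite inner_bonus_bar -mulrA ler_wpM2l //.
rewrite /weight_sum !mulr_sumr; apply: ler_sum => k _; rewrite mulrCA.
have : 0 <= \sum_ya m t k ya * visit_weight w t k ya.
  apply: sumr_ge0 => ya _; rewrite mulr_ge0 //.
    by case: (md tT (ltnW (ltn_ord k))).
  by case/andP: (@visit_weight_01 R _ _ _ w t k ya).
have B0 : 0 <= B by exact: le_trans B1.
move=> s0; rewrite [leRHS]mulrCA ler_wpM2l // ler_wpM2r // ler_nat; exact: leq_subr.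
Qed.

(** [l] for the subgradient and [l * N%:R * B] for the bonus, merged by [1 <= B]. *)
Let Z : R := l * N.+1%:R * B.

Lemma loss_vector_bound t n xa : (1 <= t <= T)%N -> (n <= N)%N ->
  `|(g t n - bbar t n) xa| <= Z.
Proof.
move=> tT nN; have [_ sg _] := run.
have := subgradient_bound xa l0 (fun n => @flip t n tT) (sg t tT) nN.
have B0 : 0 <= B by exact: le_trans B1.
have : `|bbar t n xa| <= l * N%:R * B.
  rewrite ffunE bonusE; case: ifP => [lt|_]; last first.
    by rewrite mulr0 normr0 !mulr_ge0.
  have /andP[v0 v1] := @visit_weight_01 R _ _ _ w t n xa.
  rewrite ger0_norm; last by rewrite !mulr_ge0.
  rewrite -!mulrA ler_wpM2l //.
  have : (N - n)%:R <= N%:R :> R by rewrite ler_nat leq_subr.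
  have : B * visit_weight w t n xa <= B by rewrite ler_piMr.
  have := mulr_ge0 B0 v0; set y := B * _ => *.
  by apply: ler_pM.
move=> h1 h2; have -> : (g t n - bbar t n) xa = g t n xa - bbar t n xa by rewrite !ffunE.
apply: le_trans (ler_normB _ _) _.
have : l <= l * B by rewrite ler_peMr.
rewrite /Z -natr1; lra.
Qed.


Local Notation W := (B ^+ 2 * Q).
Local Notation D := (@pairs_const R N #|{: X * A}|).
Local Notation beta := ((1 - alpha)^-1).
Local Notation av := (iterate_const N #|{: X * A}| alpha).
Local Notation atgt := (target_const N #|{: X * A}| alpha).

Let tgt : \sum_(1 <= t < T.+1) norm1 (et t - rho) <= atgt * W.
Proof. exact: (sum_target X0 pk rhod a01 contr B1 Q1 pip G1 G1' G2 G2' iterate_feasible). Qed.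

(** Consecutive estimates are compared through [rho], and the empirical kernel moves only at visits:
    hence both factors 2. *)
Lemma sum_drift : \sum_(1 <= t < T) drift N (est_kernel w) (fun t => et t) t <=
  (2 * atgt + 2 * D) * W.
Proof.
have H1 : \sum_(1 <= t < T) norm1 (et t.+1 - et t) <= 2 * (atgt * W).
  apply: (@le_trans _ _ (\sum_(1 <= t < T) norm1 (et t.+1 - rho) + \sum_(1 <= t < T) norm1 (et t - rho))).
    rewrite -big_split /=; apply: ler_sum => t _.
    by apply: le_trans (norm1_triangle _ _ rho) _; rewrite [norm1 (rho - _)]norm1C.
  have e1 : \sum_(1 <= t < T) norm1 (et t.+1 - rho) <= \sum_(1 <= t < T.+1) norm1 (et t - rho).
    by rewrite [leRHS]big_ltn // [in leRHS]big_add1 /= lerDr norm1_ge0.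
  have e2 : \sum_(1 <= t < T) norm1 (et t - rho) <= \sum_(1 <= t < T.+1) norm1 (et t - rho).
    by rewrite [leRHS]big_nat_recr //= lerDl norm1_ge0.
  have := tgt; lra.
have H2 : \sum_(1 <= t < T) \sum_(k < N) \sum_ya kernel_gap (est_kernel w t.+1) (est_kernel w t) k.+1 ya
    <= 2 * (D * Q).
  have -> : 2 * (D * Q) = \sum_(k < N) \sum_(ya : X * A) 2 * Q.
    by rewrite !sumr_const card_ord -mulrnA /pairs_const -[RHS]mulr_natl mulnC; ring.
  rewrite exchange_big /=; apply: ler_sum => k _; rewrite exchange_big /=; apply: ler_sum => ya _.
  apply: (@le_trans _ _ (\sum_(1 <= t < T) 2 * scored_visit w t k ya)).
    by apply: ler_sum_nat => t /andP[t1 _]; exact: est_kernel_step.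
  rewrite -mulr_sumr ler_wpM2l //; apply: le_trans (G3 ya (ltn_ord k)).
  by rewrite [leRHS]big_nat_recr //= lerDl scored_visit_ge0.
rewrite /drift big_split /=.
have QW : Q <= W by rewrite ler_peMl ?exprn_ege1 // (le_trans ler01).
have : D * Q <= D * W by rewrite ler_wpM2l // ler0n.
lra.
Qed.

Lemma run_mirror_descent :
  eta * (\sum_(1 <= t < T.+1) inner N (fun n => g t n - bbar t n) (fun n => m t n - cc t n)) <=
    2 * (N.+1 * #|{: X * A}|)%:R + 2 * Psi
    + (Psi + 2 * (eta * (Z * N.+1%:R))) * ((2 * atgt + 2 * D) * W)
    + T%:R * (eta ^+ 2 * Z ^+ 2 * (N.+1 ^ 3 * #|{: X * A}|)%:R) + 2 * (eta * (Z * N.+1%:R)).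
Proof.
have B0 : 0 <= B by exact: le_trans B1.
have Z0 : 0 <= Z by rewrite !mulr_ge0.
have exG t : exists G : saseq R X A, (1 <= t <= T)%N ->
    is_gradient N (psi N K) (m t) G /\ norm1oo N G <= Psi.
  case tT : (1 <= t <= T)%N; last by exists (fun=> 0).
  by have [G GG] := grad tT; exists G.
have [G HG] := choice exG.
have Psi0 : 0 <= Psi.
  have [_ h] := HG 1%N (introT andP (conj (leqnn 1) T0)).
  by apply: le_trans h; exact: norm1oo_ge0.
have opt t : (1 <= t < T)%N -> forall s : R, 0 < s <= 1 ->
    let mu := shift (m t.+1) (fun n => cc t.+1 n - m t.+1 n) s in
    eta * inner N (fun n => g t n - bbar t n) (m t.+1) + bregman_real N K (m t.+1) (m t) (pi t) <=
    eta * inner N (fun n => g t n - bbar t n) mu + bregman_real N K mu (m t) (pi t) :> R.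
  move=> tT s s01; have [mf mmin] := update_iterate tT; apply: mmin.
  by apply: feasible_segment => //; apply: comparator_feasible; case/andP: tT.
have := @mirror_descent_regret R X A N T K (est_kernel w) pi (fun t => et t) pi0 G
  (fun t n => g t n - bbar t n) eta Z Psi ek pi0p pip ed eta0 Z0 T0
  (fun t tT => (HG t tT).1) (fun t tT => (HG t tT).2) (fun t n xa tT nN => loss_vector_bound xa tT nN) opt.
move/le_trans; apply; rewrite lerD2r lerD2r lerD2l ler_wpM2l ?sum_drift //.
by rewrite addr_ge0 // !mulr_ge0 // ltW.
Qed.

Lemma pathwise_regret :
  periodic_regret N p rho gamma f pi T pi0 <=
    (l * N%:R * (beta * D + D) + l * N%:R * (av + atgt) + gamma * (beta * D + atgt)) * W
    + (2 * (N.+1 * #|{: X * A}|)%:R + 2 * Psi + Psi * ((2 * atgt + 2 * D) * W)) / eta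
    + 2 * (Z * N.+1%:R) * ((2 * atgt + 2 * D) * W + 1)
    + T%:R * eta * Z ^+ 2 * (N.+1 ^ 3 * #|{: X * A}|)%:R.
Proof.
have B0 : 0 <= B by exact: le_trans B1.
set S := \sum_(1 <= t < T.+1) inner N (fun n => g t n - bbar t n) (fun n => m t n - cc t n).
have HS : S <= (2 * (N.+1 * #|{: X * A}|)%:R + 2 * Psi + Psi * ((2 * atgt + 2 * D) * W)) / eta
    + 2 * (Z * N.+1%:R) * ((2 * atgt + 2 * D) * W + 1)
    + T%:R * eta * Z ^+ 2 * (N.+1 ^ 3 * #|{: X * A}|)%:R.
  have := run_mirror_descent; rewrite -/S mulrC -ler_pdivlMr // => /le_trans; apply.
  by rewrite le_eqVlt; apply/orP; left; apply/eqP; field; rewrite gt_eqF.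
have Hr := sum_state_gap X0 pk rhod a01 contr B1 pip G1' G2'.
have Hq := sum_true_weight B1 G2.
have Hm := sum_iterate_weight X0 pk rhod a01 contr B1 Q1 pip G1 G1' G2 G2'.
have BQW : B * Q <= W by rewrite expr2 -mulrA ler_peMl // mulr_ge0 // (le_trans ler01).
have D0 : 0 <= D by exact: ler0n.
have b0 : 0 <= beta by rewrite invr_ge0; case/andP: a01; lra.
have DW : D * (B * Q) <= D * W by rewrite ler_wpM2l.
have bDW : beta * D * (B * Q) <= beta * D * W by rewrite ler_wpM2l // mulr_ge0.
have lN : 0 <= l * N%:R by rewrite mulr_ge0.
have step t : (1 <= t < T.+1)%N ->
    objective N (f t) (qq t) - objective N (f t) q0 <=
    l * N%:R * (norm1 (rt t - et t) + B * weight_sum (qq t) w t)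
    + inner N (fun n => g t n - bbar t n) (fun n => m t n - cc t n)
    + l * N%:R * (B * weight_sum (m t) w t) + l * N%:R * norm1 (et t - rho).
  rewrite ltnS => tT.
  have h1 : objective N (f t) (qq t) - objective N (f t) (m t) <=
      l * N%:R * (norm1 (rt t - et t) + B * weight_sum (qq t) w t).
    apply: le_trans (ler_norm _) _.
    apply: le_trans (objective_lipschitz _ _ (fun n => @flip t n tT)) _.
    rewrite -mulrA ler_wpM2l //; set d := _ + _.
    have -> : N%:R * d = \sum_(1 <= n < N.+1) d by rewrite sumr_const_nat subn1 /= mulr_natl.
    apply: ler_sum_nat => n /andP[_ nN].
    exact: (iterate_gap w' X0 pk rhod B1 pip G1 tT nN).
  have h2 : objective N (f t) (m t) - objective N (f t) (cc t) <=
      inner N (g t) (fun n => m t n - cc t n).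
    have [_ sg _] := run; have := sg t tT (cc t); rewrite !innerBr; lra.
  have h3 := comparator_loss tT.
  have h4 := inner_bonus_bar_iterate tT.
  (* Inserting the bonus cancels the comparator's bonus of [h3] and leaves the bonus under the
     iterate, which is summable. *)
  have h5 : inner N (fun n => g t n - bbar t n) (fun n => m t n - cc t n) =
     inner N (g t) (fun n => m t n - cc t n) - inner N (bbar t) (m t) + inner N (bbar t) (cc t).
    by rewrite (innerBl N (g t) (bbar t)) (innerBr N (bbar t)); ring.
  by rewrite h5; lra.
have Hobj : \sum_(1 <= t < T.+1) (objective N (f t) (qq t) - objective N (f t) q0) <=
    l * N%:R * (\sum_(1 <= t < T.+1) norm1 (rt t - et t)
                + B * \sum_(1 <= t < T.+1) weight_sum (qq t) w t)
    + S + l * N%:R * (B * \sum_(1 <= t < T.+1) weight_sum (m t) w t)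
    + l * N%:R * \sum_(1 <= t < T.+1) norm1 (et t - rho).
  by rewrite !mulr_sumr -!big_split !mulr_sumr -!big_split /=; exact: ler_sum_nat.
have Hg : \sum_(1 <= t < T.+1) norm1 (rt t - rho) <=
    \sum_(1 <= t < T.+1) norm1 (rt t - et t) + \sum_(1 <= t < T.+1) norm1 (et t - rho).
  by rewrite -big_split /=; apply: ler_sum => t _; exact: norm1_triangle.
rewrite /periodic_regret; have Ht := tgt.
set r := \sum_(1 <= t < T.+1) norm1 (rt t - et t) in Hr Hobj Hg *.
set s := \sum_(1 <= t < T.+1) norm1 (et t - rho) in Ht Hobj Hg *.
set u := B * \sum_(1 <= t < T.+1) weight_sum (qq t) w t in Hq Hobj *.
set v := B * \sum_(1 <= t < T.+1) weight_sum (m t) w t in Hm Hobj *.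
have E1 : l * N%:R * (r + u) <= l * N%:R * ((beta * D + D) * W).
  by rewrite ler_wpM2l // mulrDl; lra.
have E2 : l * N%:R * v + l * N%:R * s <= l * N%:R * ((av + atgt) * W).
  by rewrite -mulrDr ler_wpM2l // mulrDl; lra.
have E3 : gamma * (\sum_(1 <= t < T.+1) norm1 (rt t - rho)) <= gamma * ((beta * D + atgt) * W).
  by rewrite ler_wpM2l // mulrDl; lra.
have -> : (l * N%:R * (beta * D + D) + l * N%:R * (av + atgt) + gamma * (beta * D + atgt)) * W =
    l * N%:R * ((beta * D + D) * W) + l * N%:R * ((av + atgt) * W) + gamma * ((beta * D + atgt) * W).
  by ring.
apply: le_trans (lerD Hobj E3) _.
move: E1 E2 HS; set e1 := l * N%:R * ((beta * D + D) * W).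
set e2 := l * N%:R * ((av + atgt) * W); set e3 := gamma * ((beta * D + atgt) * W).
set e4 := l * N%:R * (r + u); set e5 := l * N%:R * v; set e6 := l * N%:R * s.
set I1 := _ / eta; set I2 := 2 * (Z * _) * _; set I3 := T%:R * eta * _ * _.
lra.
Qed.

End Run.

(** * Exponential supermartingales on a finite history *)

Section Supermartingale.
Context {R : realType} {d : measure_display} {Omega : measurableType d} (P : probability Omega R).
Implicit Types A B : set Omega.

Definition pr A : R := fine (P A).

Lemma prE A : measurable A -> P A = (pr A)%:E.
Proof. by move=> mA; rewrite /pr fineK // fin_num_measure. Qed.

Lemma pr_ge0 A : 0 <= pr A.
Proof. exact: fine_ge0. Qed.

Lemma pr0 : pr set0 = 0.
Proof. by rewrite /pr measure0. Qed.

Lemma prU A B : measurable A -> measurable B -> pr (A `|` B) <= pr A + pr B.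
Proof.
move=> mA mB; rewrite -lee_fin EFinD -!prE //; last exact: measurableU.
exact: measureU2.
Qed.

Lemma pr_bigcup (I : finType) (F : I -> set Omega) (e : R) :
  (forall i, measurable (F i)) -> (forall i, pr (F i) <= e) ->
  measurable (\bigcup_i F i) /\ pr (\bigcup_i F i) <= #|I|%:R * e.
Proof.
move=> mF Fe.
have H (s : seq I) : measurable (\big[setU/set0]_(i <- s) F i) /\
    pr (\big[setU/set0]_(i <- s) F i) <= (size s)%:R * e.
  elim: s => [|i s [mI IH]]; first by rewrite big_nil pr0 mul0r.
  rewrite big_cons; split; first exact: measurableU.
  apply: le_trans (prU (mF i) mI) _; rewrite /= -natr1 mulrDl mul1r addrC.
  by apply: lerD.
have -> : \bigcup_i F i = \big[setU/set0]_(i <- enum I) F i.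
  rewrite -bigcup_seq; congr bigcup; apply/seteqP; split => // i _ /=.
  by rewrite mem_enum.
by have := H (enum I); rewrite -cardE.
Qed.

Lemma pr_split (D : finType) (z : Omega -> D) A :
  (forall x, measurable [set v | z v = x]) -> measurable A ->
  pr A = \sum_x pr (A `&` [set v | z v = x]).
Proof.
move=> mz mA; apply: EFin_inj; rewrite -prE // -sumEFin.
rewrite (eq_bigr (fun x => P (A `&` [set v | z v = x]))); last first.
  by move=> x _; rewrite prE //; exact: measurableI.
rewrite fsbig_seq; last exact: index_enum_uniq.
rewrite -measure_fin_bigcup.
- congr (P _); apply/seteqP; split => [v Ao|v [x _ []] //].
  by exists (z v) => //=; rewrite mem_index_enum.
- exact: finite_seq.
- by move=> x y _ _ [v [[_ /= <-] [_ /= <-]]].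
- by move=> x _; apply: measurableI.
Qed.

Context {D : finType} (z : nat -> Omega -> D) (T : nat).
Context (mz : forall t x, (1 <= t <= T)%N -> measurable [set v | z t v = x]).

Definition hist (t : nat) (om : Omega) : seq D := [seq z s om | s <- iota 1 t.-1].

Lemma histP t v v' : hist t v = hist t v' <-> forall s, (1 <= s < t)%N -> z s v = z s v'.
Proof.
have I s : (s \in iota 1 t.-1) = (1 <= s < t)%N.
  by rewrite mem_iota add1n; case: t => [|t] //=; rewrite ltnS; case: s.
split=> [/eq_in_map h s sT|h]; first by apply: h; rewrite I.
by apply/eq_in_map => s; rewrite I; exact: h.
Qed.

Lemma hist_le t t' v v' : (t' <= t)%N -> hist t v = hist t v' -> hist t' v = hist t' v'.
Proof.
move=> tt /histP h; apply/histP => s /andP[s1 st]; apply: h.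
by rewrite s1 (leq_trans st).
Qed.

Lemma histS t v v' : (0 < t)%N ->
  hist t.+1 v = hist t.+1 v' <-> hist t v = hist t v' /\ z t v = z t v'.
Proof.
move=> t0; split=> [h|[/histP h e]].
  by split; [exact: hist_le h|move/histP: h; apply; rewrite t0 ltnSn].
apply/histP => s /andP[s1]; rewrite ltnS leq_eqVlt => /predU1P[->//|st].
by apply: h; rewrite s1.
Qed.

(** The atom containing [om] of the sigma-algebra generated by the episodes before [t]; each atom
    splits into finitely many atoms at [t.+1]. *)
Definition atom t om : set Omega := [set v | hist t v = hist t om].

Definition determined t A := forall v v', hist t v = hist t v' -> A v -> A v'.

Lemma atom_next t om x v : (0 < t)%N -> atom t om v -> z t v = x ->
  atom t om `&` [set v | z t v = x] = atom t.+1 v.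
Proof.
move=> t0 ao zo; apply/seteqP; split => [v' [/= av' zv']|v' /= /(histS _ _ t0)[h1 h2]].
  by apply/histS => //; rewrite av' ao zo zv'.
by split; rewrite /atom /= ?h1 // h2.
Qed.

Lemma atom_measurable t om : (t <= T.+1)%N -> measurable (atom t om).
Proof.
elim: t om => [|t IH] om tT.
  by rewrite (_ : atom 0 om = setT) //; apply/seteqP; split.
have [->|t0] := posnP t; first by rewrite (_ : atom 1 om = setT) //; apply/seteqP; split.
rewrite -(@atom_next t om (z t om) om) //; apply: measurableI; first exact: IH (ltnW tT).
by apply: mz; rewrite t0.
Qed.

Lemma atom_split t om x A : (1 <= t <= T)%N ->
  (atom t om `&` A) `&` [set v | z t v = x] = set0 \/
  exists v, [/\ atom t om v, z t v = x,
     atom t om `&` [set v | z t v = x] = atom t.+1 v &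
     (atom t om `&` A) `&` [set v | z t v = x] = atom t.+1 v `&` A].
Proof.
move=> /andP[t1 tT]; have [[v [av zv]]|no] := pselect (exists v, atom t om v /\ z t v = x).
  right; exists v; have e := atom_next t1 av zv.
  by split => //; rewrite setIAC e.
by left; apply/seteqP; split => // v [[av _] zv]; apply: no; exists v.
Qed.

(** Downward induction: on an atom of the full history [A] is all or nothing, and an earlier atom is
    a finite union of later ones. *)
Lemma determined_measurable A : determined T.+1 A -> measurable A.
Proof.
move=> dA; suff H k t om : (1 <= t)%N -> (t + k = T.+1)%N -> measurable (atom t om `&` A).
  have [[v Av]|noA] := pselect (exists v, A v); last first.
    by rewrite (_ : A = set0) //; apply/seteqP; split => // v Av; apply: noA; exists v.
  have := H T 1%N v (leqnn _) (add1n _).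
  by rewrite (_ : atom 1 v = setT) ?setTI //; apply/seteqP; split.
elim: k t om => [|k IH] t om t1 tk.
  rewrite addn0 in tk; rewrite tk.
  have [Aom|nA] := pselect (A om).
    rewrite (_ : _ `&` _ = atom T.+1 om); first exact: atom_measurable.
    by apply/seteqP; split => [v []//|v av]; split => //; apply: dA Aom.
  rewrite (_ : _ `&` _ = set0) //; apply/seteqP; split => // v [av Av]; apply: nA.
  by apply: dA Av.
have tT : (1 <= t <= T)%N by rewrite t1 -ltnS -tk addnS ltnS leq_addr.
have -> : atom t om `&` A = \bigcup_x ((atom t om `&` A) `&` [set v | z t v = x]).
  by apply/seteqP; split => [v h|v [x _ []] //]; exists (z t v).
apply: fin_bigcup_measurable => [|x _]; first exact: finite_finset.
have [->|[v [_ _ _ ->]]] := atom_split om x A tT; first exact: measurable0.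
by apply: IH => //; rewrite addSn -addnS.
Qed.

Context (U : nat -> Omega -> D -> R).
Context (U0 : forall t om x, 0 <= U t om x).
Context (Udet : forall t v v', (1 <= t <= T)%N -> hist t v = hist t v' -> U t v = U t v').
Context (Umean : forall t om, (1 <= t <= T)%N ->
  \sum_x pr (atom t om `&` [set v | z t v = x]) * U t om x <= pr (atom t om)).

(** A nonnegative supermartingale. [Umean] bounds the conditional mean of a factor by 1, multiplied
    by the probability of the atom so that null atoms need no division. *)
Definition wealth t om : R := \prod_(1 <= s < t) U s om (z s om).

Lemma wealth_ge0 t om : 0 <= wealth t om.
Proof. exact: prodr_ge0. Qed.

Lemma wealth_det t v v' : (t <= T.+1)%N -> hist t v = hist t v' -> wealth t v = wealth t v'.
Proof.
move=> tT h; apply: eq_big_nat => s /andP[s1 st].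
rewrite (@Udet s v v') ?s1 ?(leq_trans st) //; last exact: hist_le (ltnW st) h.
  by move/histP: h => ->; rewrite ?s1.
by rewrite -ltnS (leq_trans st).
Qed.

(* Ville's inequality at a fixed horizon, by downward induction over the atoms
   of the history. *)
Lemma ville (c : R) : 0 < c ->
  measurable [set om | c <= wealth T.+1 om] /\ pr [set om | c <= wealth T.+1 om] <= c^-1.
Proof.
move=> c0; set A := [set om | _].
have dA : determined T.+1 A.
  by move=> v v' h; rewrite /A /= (wealth_det _ h).
split; first exact: determined_measurable.
suff H k t om : (1 <= t)%N -> (t + k = T.+1)%N ->
    pr (atom t om `&` A) <= pr (atom t om) * wealth t om / c.
  have [[v Av]|noA] := pselect (exists v, A v); last first.
    rewrite (_ : A = set0) ?pr0 ?invr_ge0 1?ltW //.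
    by apply/seteqP; split => // v Av; apply: noA; exists v.
  have := H T 1%N v (leqnn _) (add1n _).
  have -> : atom 1 v = setT by apply/seteqP; split.
  by rewrite setTI /wealth big_geq // mulr1 {2}/pr probability_setT mul1r.
elim: k t om => [|k IH] t om t1 tk.
  rewrite addn0 in tk; rewrite {t t1}tk.
  have [Aom|nA] := pselect (A om).
    rewrite (_ : _ `&` _ = atom T.+1 om).
      by rewrite -mulrA ler_peMr ?pr_ge0 // ler_pdivlMr // mul1r.
    by apply/seteqP; split => [v []//|v av]; split => //; apply: dA Aom.
  rewrite (_ : _ `&` _ = set0) ?pr0.
    by rewrite divr_ge0 ?mulr_ge0 ?pr_ge0 ?wealth_ge0 // ltW.
  by apply/seteqP; split => // v [av Av]; apply: nA; apply: dA Av.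
have tT : (1 <= t <= T)%N by rewrite t1 -ltnS -tk addnS ltnS leq_addr.
have tT' : (t <= T.+1)%N by rewrite -tk leq_addr.
have mA : measurable (atom t om `&` A).
  by apply: measurableI; [exact: atom_measurable|exact: determined_measurable].
rewrite (pr_split (z := z t) _ mA); last by move=> x; exact: mz.
apply: (@le_trans _ _ (\sum_x pr (atom t om `&` [set v | z t v = x]) * U t om x * (wealth t om / c))).
  apply: ler_sum => x _.
  have [->|[v [av zv e1 ->]]] := atom_split om x A tT.
    rewrite pr0 mulr_ge0 ?divr_ge0 ?wealth_ge0 ?(ltW c0) //.
    by rewrite mulr_ge0 ?pr_ge0.
  have := IH t.+1 v isT; rewrite addSn -addnS => /(_ tk) /le_trans; apply.
  rewrite e1 {1}/wealth big_nat_recr //= -/(wealth t v) zv.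
  rewrite (wealth_det tT' av) (Udet tT av) le_eqVlt; apply/orP; left; apply/eqP; ring.
rewrite -mulr_suml -mulrA ler_wpM2r ?Umean //.
by rewrite divr_ge0 ?wealth_ge0 // ltW.
Qed.

End Supermartingale.

(** * The law of a trajectory *)

Section PathSum.
Context {R : realType} {S : finType} (nu : S -> R) (kappa : nat -> S -> S -> R).

Fixpoint forward (n : nat) (s : S) : R :=
  if n is k.+1 then \sum_y forward k y * kappa k y s else nu s.

Definition path_weight n (tau : {ffun 'I_n.+1 -> S}) : R :=
  nu (tau ord0) * \prod_(k < n) kappa k (tau (inord k)) (tau (inord k.+1)).

Definition extend_path n (ts : {ffun 'I_n.+1 -> S} * S) : {ffun 'I_n.+2 -> S} :=
  [ffun i => if unlift ord_max i is Some j then ts.1 j else ts.2].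

Definition unextend_path n (tau : {ffun 'I_n.+2 -> S}) : {ffun 'I_n.+1 -> S} * S :=
  ([ffun j => tau (lift ord_max j)], tau ord_max).

Lemma extend_path_bij n : bijective (@extend_path n).
Proof.
exists (@unextend_path n) => [[t s]|t].
  rewrite /unextend_path /extend_path ffunE unlift_none; congr pair.
  by apply/ffunP => j; rewrite !ffunE liftK.
apply/ffunP => i; rewrite ffunE; case: unliftP => [j ->|->] //=.
by rewrite ffunE.
Qed.

Lemma extend_path_inord n ts k : (k <= n)%N -> extend_path ts (inord k) = ts.1 (inord k : 'I_n.+1).
Proof.
move=> kn; rewrite ffunE (_ : inord k = lift ord_max (inord k : 'I_n.+1)) ?liftK //.
by apply/ord_inj; rewrite lift_max !inordK ?ltnS // leqW.
Qed.

Lemma extend_path_max n ts : @extend_path n ts (inord n.+1) = ts.2.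
Proof.
by rewrite ffunE (_ : inord n.+1 = ord_max) ?unlift_none //; apply/ord_inj; rewrite inordK.
Qed.

(** Induction on the length: summing out the last point folds the last kernel into [F]. *)
Lemma path_sum n (F : S -> R) :
  \sum_(tau : {ffun 'I_n.+1 -> S}) path_weight tau * F (tau (inord n)) =
  \sum_s forward n s * F s.
Proof.
elim: n F => [|n IH] F.
  rewrite (reindex (fun s : S => [ffun _ : 'I_1 => s])) /=; last first.
    exists (fun tau : {ffun 'I_1 -> S} => tau ord0) => [s _|tau _]; first by rewrite ffunE.
    by apply/ffunP => i; rewrite ffunE (ord1 i).
  by apply: eq_bigr => s _; rewrite /path_weight big_ord0 !ffunE mulr1.
rewrite (reindex (@extend_path n)) /=; last exact: onW_bij (extend_path_bij n).
have E (ts : {ffun 'I_n.+1 -> S} * S) : path_weight (extend_path ts) * F (extend_path ts (inord n.+1)) =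
    path_weight ts.1 * (kappa n (ts.1 (inord n)) ts.2 * F ts.2).
  rewrite /path_weight big_ord_recr /= extend_path_max extend_path_inord //.
  have -> : extend_path ts ord0 = ts.1 ord0.
    rewrite (_ : ord0 = inord 0) ?extend_path_inord //; last by apply/ord_inj; rewrite inordK.
    by congr (ts.1 _); apply/ord_inj; rewrite inordK.
  rewrite [X in _ * (X * _)](eq_bigr (fun k : 'I_n => kappa k (ts.1 (inord k)) (ts.1 (inord k.+1)))).
    by rewrite !mulrA.
  by move=> k _; rewrite !extend_path_inord // ltnW.
rewrite (eq_bigr _ (fun ts _ => E ts)).
rewrite -(pair_bigA _ (fun t s => path_weight t * (kappa n (t (inord n)) s * F s))) /=.
under eq_bigr do rewrite -mulr_sumr.
rewrite (IH (fun y => \sum_s kappa n y s * F s)) /=.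
under eq_bigr do rewrite mulr_sumr.
rewrite exchange_big /=; apply: eq_bigr => s _; rewrite mulr_suml.
by apply: eq_bigr => y _; rewrite mulrA.
Qed.

End PathSum.

Section TrajLaw.
Context {R : realType} {X A : finType} (N : nat).
Context (p : trans_kernel R X A) (pi : policy R X A) (nu : savec R X A).
Context (pk : is_kernel N p) (pip : is_policy N pi).

Lemma traj_mean (n : nat) (u : X * A -> X -> R) : (n < N)%N ->
  \sum_(tau : traj X A N) traj_prob p pi nu tau * u (tau (inord n)) (tau (inord n.+1)).1 =
  \sum_y occ p pi nu n y * \sum_x p n.+1 y x * u y x.
Proof.
move=> nN.
(* The tested function becomes a factor of transition [n], so its mean is the total mass of a
   weighted path: [forward] is the occupancy up to [n], and from [n.+1] on the mass is preserved. *)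
pose kap (k : nat) (y s : X * A) : R :=
  p k.+1 y s.1 * pi k.+1 s.1 s.2 * (if k == n then u y s.1 else 1).
have E (tau : traj X A N) : traj_prob p pi nu tau * u (tau (inord n)) (tau (inord n.+1)).1 =
    path_weight nu kap tau * 1.
  rewrite mulr1 /path_weight /kap big_split /= mulrA; congr (_ * _).
  rewrite (bigD1 (Ordinal nN)) //= eqxx big1 ?mulr1 // => k; rewrite -val_eqE /= => /negPf.
  by move=> ->.
rewrite (eq_bigr _ (fun tau _ => E tau)) (path_sum nu kap N (fun=> 1)).
under eq_bigr do rewrite mulr1.
have F1 k : (k <= n)%N -> forall s, forward nu kap k s = occ p pi nu k s.
  elim: k => [//|k IH] kn s; rewrite [LHS]/= occS mulr_suml; apply: eq_bigr => y _.
  by rewrite (IH (ltnW kn)) /kap (ltn_eqF kn) mulr1 mulrA.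
have F2 k : (n < k <= N)%N -> \sum_s forward nu kap k s = \sum_s forward nu kap n.+1 s.
  elim: k => [//|k IH] /andP[nk kN]; move: nk; rewrite ltnS leq_eqVlt => /predU1P[->//|nk].
  rewrite -IH ?nk ?(ltnW kN) //= exchange_big /=; apply: eq_bigr => y _.
  rewrite -mulr_sumr sum_pair /kap (gtn_eqF nk).
  rewrite (eq_bigr (fun x => p k.+1 y x)); last first.
    move=> x _; under eq_bigr do rewrite /= mulr1.
    by rewrite -mulr_sumr; case: (@pip k.+1 kN x) => _ ->; rewrite mulr1.
  by case: (@pk k.+1 kN y) => _ ->; rewrite mulr1.
rewrite F2 ?nN ?leqnn //= exchange_big /=; apply: eq_bigr => y _.
rewrite -mulr_sumr F1 // sum_pair; congr (_ * _); apply: eq_bigr => x _.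
rewrite /kap eqxx /= -mulr_suml -mulr_sumr.
by case: (@pip n.+1 nN x) => _ ->; rewrite mulr1.
Qed.

End TrajLaw.

(** * Concentration *)

Section TrajVille.
Context {R : realType} {X A : finType} (N T : nat).
Context {d : measure_display} {Omega : measurableType d} (P : probability Omega R).
Context (w w' : nat -> Omega -> traj X A N) (p : trans_kernel R X A).
Local Notation D := (traj X A N * traj X A N)%type.
Local Notation z := (fun t om => (w t om, w' t om)).
Context (mw : forall t tau, (1 <= t <= T)%N ->
  measurable [set om | w t om = tau] /\ measurable [set om | w' t om = tau]).
Context (sel : D -> traj X A N).
Context (nu : nat -> Omega -> savec R X A) (pi : nat -> Omega -> policy R X A).
Local Notation v t om := (sel (w t om, w' t om)).
Context (pk : is_kernel N p).
Context (pip : forall t om, (1 <= t <= T)%N -> is_policy N (pi t om)).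
Context (fol : forall t, (1 <= t <= T)%N ->
  follows P (past w w' t) (fun om => v t om) p (nu t) (pi t)).

Lemma measurable_pair t x : (1 <= t <= T)%N -> measurable [set om | z t om = x].
Proof.
move=> tT; case: x => x x'.
have -> : [set om | z t om = (x, x')] = [set om | w t om = x] `&` [set om | w' t om = x'].
  by apply/seteqP; split => [om /= [-> ->] //|om /= [-> ->]].
by apply: measurableI; [case: (mw x tT)|case: (mw x' tT)].
Qed.

Context (n : nat) (nN : (n < N)%N) (u : nat -> Omega -> X * A -> X -> R).
Context (u0 : forall t om y x, 0 <= u t om y x).
Context (udet : forall t om om', (1 <= t <= T)%N ->
  past w w' t om = past w w' t om' -> u t om = u t om').
Context (umean : forall t om, (1 <= t <= T)%N ->
  \sum_y occ p (pi t om) (nu t om) n y * \sum_x p n.+1 y x * u t om y x <= 1).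

(** [sel] picks one of the two streams, while the history records both. The joint law of a pair
    being unspecified, the sum over pairs is regrouped by the value of the selected trajectory,
    whose law [fol] gives. *)
Lemma traj_ville (c : R) : 0 < c ->
  let bad := [set om | c <= \prod_(1 <= t < T.+1)
     u t om (v t om (inord n)) (v t om (inord n.+1)).1] in
  measurable bad /\ pr P bad <= c^-1.
Proof.
move=> c0.
pose U t om (x : D) := u t om (sel x (inord n)) (sel x (inord n.+1)).1.
apply: (@ville R d Omega P D z T measurable_pair U _ _ _ c c0) => //.
- by move=> t om x; exact: u0.
- by move=> t om om' tT h; apply/funext => x; rewrite /U (udet tT h).
- move=> t om tT.
  have mA : measurable (atom z t om).
    by apply: (@atom_measurable d Omega D z T measurable_pair); rewrite leqW //; case/andP: tT.
  have mv tau : measurable [set om | v t om = tau].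
    rewrite (_ : [set _ | _] = \bigcup_(x in [set x : D | sel x = tau]) [set om | z t om = x]).
      by apply: fin_bigcup_measurable => [|x _]; [exact: finite_finset|exact: measurable_pair].
    by apply/seteqP; split => [a /= h|a [x /= <- /= <-] //]; exists (w t a, w' t a).
  have E : \sum_x pr P (atom z t om `&` [set a | z t a = x]) * U t om x =
      \sum_tau pr P (atom z t om `&` [set om | v t om = tau]) *
         u t om (tau (inord n)) (tau (inord n.+1)).1.
    have S tau := pr_split P (z := z t) (fun x => measurable_pair x tT) (measurableI _ _ mA (mv tau)).
    under [RHS]eq_bigr do rewrite S mulr_suml.
    rewrite exchange_big /=; apply: eq_bigr => x _.
    rewrite (bigD1 (sel x)) //= big1 ?addr0 => [|tau ne].
      congr (pr P _ * _); apply/seteqP; split => [om' [h1 h2]|om' [[h1 h2] h3]]; split => //.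
      by split=> //; rewrite /= h2.
    rewrite (_ : _ `&` _ = set0) ?pr0 ?mul0r //; apply/seteqP; split => // om' [[_ /= h2] h3].
    by move/eqP: ne; apply; rewrite -h2 -h3.
  rewrite E.
  have F tau : pr P (atom z t om `&` [set om | v t om = tau]) =
      pr P (atom z t om) * traj_prob p (pi t om) (nu t om) tau.
    have := fol tT om tau.
    rewrite -[[set o | past w w' t o = past w w' t om]]/(atom z t om).
    rewrite (prE P mA) prE; last exact: measurableI.
    by rewrite -EFinM => -[].
  rewrite (eq_bigr (fun tau => pr P (atom z t om) *
    (traj_prob p (pi t om) (nu t om) tau * u t om (tau (inord n)) (tau (inord n.+1)).1))).
    rewrite -mulr_sumr (traj_mean _ pk (pip om tT)) // -[leRHS]mulr1 ler_wpM2l ?pr_ge0 //.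
    exact: umean.
  by move=> tau _; rewrite F mulrA.
Qed.

End TrajVille.

Section Concentration.
Context {R : realType} {X A : finType} (N T : nat).
Context {d : measure_display} {Omega : measurableType d} (P : probability Omega R).
Context (w w' : nat -> Omega -> traj X A N) (p : trans_kernel R X A).
Local Notation D := (traj X A N * traj X A N)%type.
Context (mw : forall t tau, (1 <= t <= T)%N ->
  measurable [set om | w t om = tau] /\ measurable [set om | w' t om = tau]).
Context (sel : D -> traj X A N).
Context (nu : nat -> Omega -> savec R X A) (pi : nat -> Omega -> policy R X A).
Local Notation v t om := (sel (w t om, w' t om)).
Local Notation vp om := (fun t => v t om).
Context (pk : is_kernel N p).
Context (pip : forall t om, (1 <= t <= T)%N -> is_policy N (pi t om)).
Context (nud : forall t om, (1 <= t <= T)%N -> is_dist (nu t om)).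
Context (fol : forall t, (1 <= t <= T)%N ->
  follows P (past w w' t) (fun om => v t om) p (nu t) (pi t)).
Context (pdet : forall t om om', (1 <= t <= T)%N ->
  past w w' t om = past w w' t om' -> pi t om = pi t om').
Context (ndet : forall t om om', (1 <= t <= T)%N ->
  past w w' t om = past w w' t om' -> nu t om = nu t om').

Lemma past_visits t om om' n xa : past w w' t om = past w w' t om' ->
  visits (vp om) t n xa = visits (vp om') t n xa.
Proof.
move=> h; apply: eq_visits => s sT.
by have /histP/(_ s sT) [-> ->] : hist (fun t om => (w t om, w' t om)) t om = hist (fun t om => (w t om, w' t om)) t om' := h.
Qed.

(** The factor exp(q b / 2 - b 1{visit}) has conditional mean at most 1 by [expRN_le_half]. Expected
    and realised weights are thus comparable up to a factor 2 and an additive logarithm, with no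
    square-root deviation. *)
Lemma occupancy_event n xa (c : R) : (n < N)%N -> 0 < c -> exists bad : set Omega,
  [/\ measurable bad, pr P bad <= c^-1 & forall om, ~ bad om ->
    \sum_(1 <= t < T.+1) occ p (pi t om) (nu t om) n xa * visit_weight (vp om) t n xa
    <= 2 * (\sum_(1 <= t < T.+1) scored_visit (vp om) t n xa) + 2 * ln c].
Proof.
move=> nN c0.
pose b t om : R := visit_weight (vp om) t n xa.
pose q t om := occ p (pi t om) (nu t om) n xa.
pose u t om (y : X * A) (x : X) := expR (q t om * b t om / 2 - b t om * (y == xa)%:R).
have := @traj_ville R X A N T d Omega P w w' p mw sel nu pi pk pip fol n nN u.
move=> H; have {H} := H _ _ _ c c0; case.
- by move=> t om y x; exact: expR_ge0.
- move=> t om om' tT h; apply/funext => y; apply/funext => x.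
  by rewrite /u /q /b /visit_weight (past_visits n xa h) (pdet tT h) (ndet tT h).
- move=> t om tT; have [q0 q1] := occ_dist pk (pip om tT) (nud om tT) (ltnW nN).
  have /andP[b0 b1] := @visit_weight_01 R _ _ _ (vp om) t n xa.
  rewrite (eq_bigr (fun y => occ p (pi t om) (nu t om) n y *
     (expR (q t om * b t om / 2) * expR (- (b t om * (y == xa)%:R))))); last first.
    move=> y _; rewrite -mulr_suml; case: (@pk n.+1 nN y) => _ ->.
    by rewrite mul1r /u expRD.
  rewrite (bigD1 xa) //= eqxx mulr1.
  rewrite (eq_bigr (fun y => expR (q t om * b t om / 2) * occ p (pi t om) (nu t om) n y)); last first.
    by move=> y /negPf ->; rewrite mulr0 oppr0 expR0 mulr1 mulrC.
  rewrite -mulr_sumr mulrCA -mulrDr.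
  have -> : \sum_(y | y != xa) occ p (pi t om) (nu t om) n y = 1 - q t om.
    by rewrite -q1 [X in _ = X - _](bigD1 xa) //= /q addrAC subrr add0r.
  rewrite -/(q t om) -/(b t om).
  apply: (@le_trans _ _ (expR (q t om * b t om / 2) * expR (- (q t om * b t om / 2)))); last first.
    by rewrite expRxMexpNx_1.
  rewrite ler_wpM2l ?expR_ge0 //; apply: le_trans (expR_ge1Dx _).
  have := @expRN_le_half R (b t om); rewrite b0 b1 => /(_ isT) /(ler_wpM2l (q0 xa)).
  rewrite -/(q t om); lra.
move=> mb pb; exists [set om | c <= \prod_(1 <= t < T.+1) u t om (v t om (inord n)) (v t om (inord n.+1)).1].
split=> // om /negP; rewrite -ltNge /u -expR_sum => hlt.
have : \sum_(1 <= t < T.+1) (q t om * b t om / 2 - b t om * (v t om (inord n) == xa)%:R) < ln c.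
  by rewrite -[ltLHS]expRK ltr_ln ?posrE ?expR_gt0.
rewrite sumrB -mulr_suml /scored_visit.
under [X in _ - X]eq_bigr do rewrite mulrC.
rewrite -/(q _ _); set s1 := \sum_(1 <= t < _) _; set s2 := \sum_(1 <= t < _) _.
rewrite /q /b; lra.
Qed.


Definition sign (h : {ffun X -> bool}) (x : X) : R := if h x then 1 else -1.

Lemma visits_mono (y : nat -> traj X A N) s t n xa : (s <= t)%N ->
  (visits y s n xa <= visits y t n xa)%N.
Proof.
move=> /subnK <-; elim: (t - s)%N => [//|k IH]; apply: leq_trans IH _.
rewrite addSn; case: (posnP (k + s)%N) => [->|ks]; last by rewrite visitsS // leq_addr.
by rewrite /visits !big_geq.
Qed.

(* Deviation of the empirical kernel at the [k]-th visit: the exponential weights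
   are frozen from that visit on, so that no union over episodes is needed. *)
Lemma kernel_event n xa k (h : {ffun X -> bool}) (C : R) : (n < N)%N -> (0 < k)%N -> 0 < C ->
  exists bad : set Omega,
  [/\ measurable bad, pr P bad <= expR (- (C ^+ 2 / 4)) & forall om, ~ bad om ->
    forall t, (1 <= t <= T)%N -> visits (vp om) t n xa = k ->
    \sum_x sign h x * (est_kernel (vp om) t n.+1 xa x - p n.+1 xa x) <= C / Num.sqrt k%:R].
Proof.
move=> nN k0 C0; have sk0 : 0 < Num.sqrt k%:R :> R by rewrite sqrtr_gt0 ltr0n.
(* Maximises la C sqrt k - k la^2; the maximum C^2 / 4 is the exponent of the failure
   probability. *)
pose la := C / (2 * Num.sqrt k%:R).
have la0 : 0 < la by rewrite divr_gt0 // mulr_gt0.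
pose mn := \sum_x p n.+1 xa x * sign h x.
pose u t om (y : X * A) (x : X) : R :=
  if (y == xa) && (visits (vp om) t n xa < k)%N then expR (la * (sign h x - mn) - la ^+ 2) else 1.
have := @traj_ville R X A N T d Omega P w w' p mw sel nu pi pk pip fol n nN u.
move=> H; have {H} := H _ _ _ (expR (C ^+ 2 / 4)) (expR_gt0 _); case.
- by move=> t om y x; rewrite /u; case: ifP => _ //; exact: expR_ge0.
- move=> t om om' tT hh; apply/funext => y; apply/funext => x.
  by rewrite /u (past_visits n xa hh).
- move=> t om tT; have [q0 q1] := occ_dist pk (pip om tT) (nud om tT) (ltnW nN).
  rewrite -q1; apply: ler_sum => y _; rewrite ler_piMr // /u.
  have [pp0 pp1] := @pk n.+1 nN y.
  case cnd : ((y == xa) && _); last by under eq_bigr do rewrite mulr1; rewrite pp1.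
  have /andP[/eqP e _] := cnd.
  under [X in X <= _]eq_bigr do rewrite expRD mulrA.
  rewrite -mulr_suml expRN ler_pdivrMr ?expR_gt0 // mul1r e.
  apply: hoeffding_sign; first by rewrite -e.
  by move=> x; rewrite /sign; case: ifP => _; rewrite ?normrN normr1.
rewrite -expRN => mb pb.
exists [set om | expR (C ^+ 2 / 4) <=
   \prod_(1 <= t < T.+1) u t om (v t om (inord n)) (v t om (inord n.+1)).1].
split=> // om /negP; rewrite -ltNge => hlt t /andP[t1 tT] vk.
pose dev s := \sum_x (transitions (vp om) s n xa x)%:R * sign h x - (visits (vp om) s n xa)%:R * mn.
have W s : (0 < s)%N -> (visits (vp om) s n xa <= k)%N ->
    \prod_(1 <= t < s) u t om (v t om (inord n)) (v t om (inord n.+1)).1 =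
    expR (la * dev s - (visits (vp om) s n xa)%:R * la ^+ 2).
  case: s => // s _; elim: s => [|s IH] vs.
    rewrite /dev big_geq // big1 => [|x _]; last by rewrite /transitions big_geq // mul0r.
    by rewrite /visits big_geq // !mul0r !subr0 mulr0 expR0.
  have vs' : (visits (vp om) s.+1 n xa <= k)%N by apply: leq_trans vs; exact: visits_mono.
  rewrite big_nat_recr //= (IH vs') /u.
  move: vs; rewrite /dev visitsS //; under [in RHS]eq_bigr do rewrite transitionsS //.
  have [e|ne] := eqVneq (v s.+1 om (inord n)) xa => vs /=; last first.
    rewrite [LHS]mulr1.
    rewrite !addn0.
    under [in RHS]eq_bigr do rewrite addn0.
    by [].
  rewrite addn1 in vs *; rewrite vs -expRD -natr1; congr expR.
  have -> : \sum_x (transitions (vp om) s.+1 n xa x + ((v s.+1 om (inord n.+1)).1 == x))%:R * sign h x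
     = \sum_x (transitions (vp om) s.+1 n xa x)%:R * sign h x + sign h (v s.+1 om (inord n.+1)).1.
    under eq_bigr do rewrite natrD mulrDl.
    rewrite big_split /=; congr (_ + _).
    rewrite (bigD1 (v s.+1 om (inord n.+1)).1) //= eqxx mul1r big1 ?addr0 // => x /negPf.
    by rewrite eq_sym => ->; rewrite mul0r.
  ring.
have tail : \prod_(t <= s < T.+1) u s om (v s om (inord n)) (v s om (inord n.+1)).1 = 1.
  rewrite big_nat_cond big1 // => s /andP[/andP[ts _] _]; rewrite /u.
  by rewrite ltnNge -vk visits_mono // andbF.
move: hlt; rewrite (@big_cat_nat _ _ _ t) //=; last by rewrite leqW.
rewrite tail mulr1 W //; last by rewrite vk.
rewrite ltr_expR vk => hlt.
have kR : k%:R = Num.sqrt k%:R ^+ 2 :> R by rewrite sqr_sqrtr.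
have e2 : k%:R * la ^+ 2 = C ^+ 2 / 4.
  by rewrite kR /la; field; rewrite gt_eqF.
have hd : dev t < C * Num.sqrt k%:R.
  have : la * dev t < la * (C * Num.sqrt k%:R).
    have -> : la * (C * Num.sqrt k%:R) = C ^+ 2 / 2 by rewrite /la; field; rewrite gt_eqF.
    by rewrite e2 in hlt; lra.
  by rewrite ltr_pM2l.
have -> : \sum_x sign h x * (est_kernel (vp om) t n.+1 xa x - p n.+1 xa x) = dev t / k%:R.
  rewrite /dev vk mulrBl [k%:R * mn]mulrC mulfK ?pnatr_eq0 -?lt0n //.
  rewrite mulr_suml -sumrB; apply: eq_bigr => x _.
  rewrite /est_kernel /= vk (negPf (lt0n_neq0 k0)) (maxn_idPr k0); ring.
rewrite ler_pdivrMr ?ltr0n //; apply: le_trans (ltW hd) _.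
suff -> : C / Num.sqrt k%:R * k%:R = C * Num.sqrt k%:R by [].
by rewrite [X in _ / _ * X = _]kR; field; rewrite gt_eqF.
Qed.

End Concentration.

(** * Union bounds for one stream of trajectories *)

Section Streams.
Context {R : realType} {X A : finType} (N T : nat).
Context {d : measure_display} {Omega : measurableType d} (P : probability Omega R).
Context (w w' : nat -> Omega -> traj X A N) (p : trans_kernel R X A).
Local Notation D := (traj X A N * traj X A N)%type.
Context (mw : forall t tau, (1 <= t <= T)%N ->
  measurable [set om | w t om = tau] /\ measurable [set om | w' t om = tau]).
Context (sel : D -> traj X A N).
Context (nu : nat -> Omega -> savec R X A) (pi : nat -> Omega -> policy R X A).
Local Notation vp om := (fun t => sel (w t om, w' t om)).
Context (pk : is_kernel N p).
Context (pip : forall t om, (1 <= t <= T)%N -> is_policy N (pi t om)).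
Context (nud : forall t om, (1 <= t <= T)%N -> is_dist (nu t om)).
Context (fol : forall t, (1 <= t <= T)%N ->
  follows P (past w w' t) (fun om => sel (w t om, w' t om)) p (nu t) (pi t)).
Context (pdet : forall t om om', (1 <= t <= T)%N ->
  past w w' t om = past w w' t om' -> pi t om = pi t om').
Context (ndet : forall t om om', (1 <= t <= T)%N ->
  past w w' t om = past w w' t om' -> nu t om = nu t om').

(** The l1 norm is attained at the sign vector of the difference; the union over sign vectors brings
    the factor 2^|X|. *)
Lemma kernel_gap_sign (q q' : trans_kernel R X A) n xa (c : R) :
  (forall h : {ffun X -> bool}, \sum_x sign h x * (q' n xa x - q n xa x) <= c) ->
  kernel_gap q q' n xa <= c.
Proof.
move=> H; apply: le_trans (H [ffun x => q n xa x <= q' n xa x]).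
apply: ler_sum => x _; rewrite /sign ffunE; case: (lerP (q n xa x) (q' n xa x)) => h.
  by rewrite mul1r.
by rewrite mulN1r opprB.
Qed.

Lemma occupancy_stream (delta : R) : 0 < delta -> (0 < N)%N -> (0 < #|{: X * A}|)%N ->
  exists bad : set Omega, [/\ measurable bad, pr P bad <= delta &
    forall om, ~ bad om -> forall n xa, (n < N)%N ->
    \sum_(1 <= t < T.+1) occ p (pi t om) (nu t om) n xa * visit_weight (vp om) t n xa
    <= 6 * Num.sqrt T%:R + 2 * ln ((N * #|{: X * A}|)%:R / delta)].
Proof.
move=> de0 N0 XA0; set M := (N * #|{: X * A}|)%:R : R.
have M0 : 0 < M by rewrite ltr0n muln_gt0 N0.
have c0 : 0 < M / delta by rewrite divr_gt0.
have H (i : 'I_N * (X * A)) := occupancy_event mw pk pip nud fol pdet ndet i.2 (ltn_ord i.1) c0.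
have [B HB] := choice H.
have [mB pB] := pr_bigcup (fun i => let: And3 h _ _ := HB i in h) (fun i => let: And3 _ h _ := HB i in h).
exists (\bigcup_i B i); split=> //.
  apply: le_trans pB _; rewrite card_prod card_ord -/M invf_div mulrC divfK //.
  by rewrite gt_eqF.
move=> om nb n xa nN; have nBi : ~ B (Ordinal nN, xa) om by move=> h; apply: nb; exists (Ordinal nN, xa).
have [_ _ /(_ om nBi) /=] := HB (Ordinal nN, xa).
have := @sum_scored_visit R _ _ _ (vp om) T n xa.
lra.
Qed.

(** [2 <= C] covers unvisited pairs, where the weight is 1 and the gap at most 2. Otherwise the
    union runs over the visit count, from 1 to [T], stored minus one in ['I_T]. *)
Lemma kernel_stream (C : R) : 2 <= C ->
  exists bad : set Omega, [/\ measurable bad,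
    pr P bad <= (N * #|{: X * A}| * T * 2 ^ #|X|)%:R * expR (- (C ^+ 2 / 4)) &
    forall om, ~ bad om -> forall t n xa, (1 <= t <= T)%N -> (n < N)%N ->
      kernel_gap p (est_kernel (vp om) t) n.+1 xa <= C * visit_weight (vp om) t n xa].
Proof.
move=> C2; have C0 : 0 < C by lra.
have H (i : 'I_N * (X * A) * 'I_T * {ffun X -> bool}) :=
  kernel_event mw pk pip nud fol i.1.1.2 i.2 (ltn_ord i.1.1.1) (ltn0Sn i.1.2) C0.
have [B HB] := choice H.
have [mB pB] := pr_bigcup (fun i => let: And3 h _ _ := HB i in h) (fun i => let: And3 _ h _ := HB i in h).
exists (\bigcup_i B i); split=> //.
  by apply: le_trans pB _; rewrite !card_prod !card_ord card_ffun card_bool.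
move=> om nb t n xa tT nN; rewrite /visit_weight.
have [v0|v0] := posnP (visits (vp om) t n xa).
  rewrite v0 maxn0 sqrtr1 invr1 mulr1; apply: le_trans C2; apply: kernel_gap_le2.
    exact: pk.
  by apply: est_kernel_dist; apply/card_gt0P; exists xa.1.
have kT : ((visits (vp om) t n xa).-1 < T)%N.
  have := @visits_le _ _ _ (vp om) t n xa; case/andP: tT => t1 tT /(_ t1) h.
  by rewrite prednK // (leq_trans h) // (leq_trans (leq_pred _)).
rewrite (maxn_idPr v0); apply: kernel_gap_sign => h.
pose i := (Ordinal nN, xa, Ordinal kT, h).
have nBi : ~ B i om by move=> b; apply: nb; exists i.
have [_ _ /(_ om nBi t tT)] := HB i.
by rewrite /i /= prednK //; apply.
Qed.

Lemma kernel_stream_delta (delta : R) : 0 < delta -> (0 < N)%N -> (0 < T)%N ->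
  (0 < #|X|)%N -> (0 < #|A|)%N -> 2 <= logfactor X A N T delta ->
  exists bad : set Omega, [/\ measurable bad, pr P bad <= 4 * delta &
    forall om, ~ bad om -> forall t n xa, (1 <= t <= T)%N -> (n < N)%N ->
      kernel_gap p (est_kernel (vp om) t) n.+1 xa
      <= @Cdelta R X A N T delta * visit_weight (vp om) t n xa].
Proof.
move=> de0 N0 T0 X0 A0 L2; set L := logfactor X A N T delta in L2.
have C2 : @Cdelta R X A N T delta ^+ 2 = 2 * #|X|%:R * L.
  by rewrite /Cdelta -/L sqr_sqrtr //; apply: mulr_ge0; [exact: mulr_ge0|lra].
have X1 : 1 <= #|X|%:R :> R by rewrite ler1n.
have C0 : 0 <= @Cdelta R X A N T delta by apply: sqrtr_ge0.
(* On a single state all distributions agree, so no bad event is required; the computation below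
   needs |X| >= 2. *)
have [X2|X1'] := ltnP 1 #|X|; last first.
  exists set0; split=> [|| om _ t n xa tT nN]; first exact: measurable0.
    by rewrite pr0 mulr_ge0 // ltW.
  have u q : is_dist q -> forall x : X, q x = 1 :> R.
    move=> [_ q1] x; rewrite -q1 (bigD1 x) //= big1 ?addr0 // => y /eqP ne; case: ne.
    by have /fintype_le1P := X1'; apply.
  rewrite /kernel_gap big1 ?mulr_ge0 //.
    by case/andP: (@visit_weight_01 R _ _ _ (vp om) t n xa).
  move=> x _; rewrite (u (p n.+1 xa)); last exact: pk.
  by rewrite (u (est_kernel _ _ _ _)) ?subrr ?normr0 //; exact: est_kernel_dist.
have C2' : 2 <= @Cdelta R X A N T delta.
  rewrite -(@ler_pXn2r _ 2) ?nnegrE // C2.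
  have : 0 <= (#|X|%:R - 1) * L by rewrite mulr_ge0 ?subr_ge0 //; lra.
  lra.
have [B [mB pB HB]] := kernel_stream C2'; exists B; split=> //.
apply: le_trans pB _; rewrite C2.
have Y0 : 0 < #|X|%:R * #|A|%:R * N%:R * T%:R / delta :> R.
  by rewrite divr_gt0 // !mulr_gt0 ?ltr0n.
have -> : (N * #|{: X * A}| * T * 2 ^ #|X|)%:R = delta * (expR L * expR (#|X|%:R * ln 2)).
  rewrite expRM_natl lnK ?posrE // /L /logfactor lnK ?posrE //.
  by rewrite card_prod !natrM natrX; field; rewrite gt_eqF.
rewrite -mulrA -!expRD [leRHS]mulrC ler_wpM2l ?(ltW de0) //.
have e4 : 4 = expR (2 * ln 2) :> R by rewrite expRM_natl lnK ?posrE //; ring.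
rewrite [leRHS]e4 ler_expR.
have l2 : ln 2 <= 1 :> R by have := @ln_le_subr1 R 2; lra.
have X2R : 2 <= #|X|%:R :> R by rewrite ler_nat.
(* With C^2 / 4 = |X| L / 2, the claim L + |X| ln 2 - |X| L / 2 <= 2 ln 2 is this inequality
   expanded. It is an equality at |X| = 2, whence the 4. *)
have : 0 <= (#|X|%:R - 2) * (L / 2 - ln 2) by rewrite mulr_ge0 //; lra.
lra.
Qed.

End Streams.

(** * The good event for both streams *)

Section Interaction.
Context {R : realType} {X A : finType} (N T : nat).
Context {d : measure_display} {Omega : measurableType d} (P : probability Omega R).
Context (w w' : nat -> Omega -> traj X A N) (p : trans_kernel R X A) (rho : savec R X A).
Context (pi : nat -> Omega -> policy R X A) (delta : R).
Context (pk : is_kernel N p) (rhod : is_dist rho).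
Context (pip : forall t om, (1 <= t <= T)%N -> is_policy N (pi t om)).
Context (inter : interaction P T p rho w w' pi).
Local Notation rt t om := (state_dist N (fun=> p) (pi ^~ om) rho t).
Local Notation et t om := (rho_est rho (w' ^~ om) (pi ^~ om) t).

Let mw t tau : (1 <= t <= T)%N ->
  measurable [set om | w t om = tau] /\ measurable [set om | w' t om = tau].
Proof. by move=> tT; have [h _ _ _] := inter tT; exact: h. Qed.

Let pdet t om om' : (1 <= t <= T)%N -> past w w' t om = past w w' t om' -> pi t om = pi t om'.
Proof. by move=> tT; have [_ h _ _] := inter tT; exact: h. Qed.

Let pdet_lt t om om' s : (t <= T)%N -> past w w' t om = past w w' t om' ->
  (1 <= s < t)%N -> pi s om = pi s om'.
Proof.
move=> tT h /andP[s1 st]; apply: pdet; first by rewrite s1 (leq_trans (ltnW st)).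
exact: (hist_le (z := fun t om => (w t om, w' t om)) (ltnW st) h).
Qed.

Let pastP t om om' s : past w w' t om = past w w' t om' -> (1 <= s < t)%N ->
  w s om = w s om' /\ w' s om = w' s om'.
Proof.
move=> h st.
by have /histP/(_ s st) [-> ->] : hist (fun t om => (w t om, w' t om)) t om =
  hist (fun t om => (w t om, w' t om)) t om' := h.
Qed.

(** The 10 is 4 + 4 for the kernels of the two streams and 1 + 1 for their occupancies. Both
    starting distributions are functions of the past, as the supermartingales require. *)
Lemma interaction_event : 0 < delta -> (0 < N)%N -> (0 < T)%N ->
  (0 < #|X|)%N -> (0 < #|A|)%N -> 2 <= logfactor X A N T delta ->
  let C := @Cdelta R X A N T delta in
  let Q := 6 * Num.sqrt T%:R + 2 * ln ((N * #|{: X * A}|)%:R / delta) in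
  exists bad : set Omega, [/\ measurable bad, pr P bad <= 10 * delta &
    forall om, ~ bad om ->
    [/\ forall t n xa, (1 <= t <= T)%N -> (n < N)%N ->
          kernel_gap p (est_kernel (w ^~ om) t) n.+1 xa <= C * visit_weight (w ^~ om) t n xa,
        forall t n xa, (1 <= t <= T)%N -> (n < N)%N ->
          kernel_gap p (est_kernel (w' ^~ om) t) n.+1 xa <= C * visit_weight (w' ^~ om) t n xa,
        forall n xa, (n < N)%N ->
          \sum_(1 <= t < T.+1) occ p (pi t om) (rt t om) n xa * visit_weight (w ^~ om) t n xa <= Q
      & forall n xa, (n < N)%N ->
          \sum_(1 <= t < T.+1) occ p (pi t om) (et t om) n xa * visit_weight (w' ^~ om) t n xa <= Q]].
Proof.
move=> de0 N0 T0 X0 A0 L2 C Q.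
have XA0 : (0 < #|{: X * A}|)%N by rewrite card_prod muln_gt0 X0.
have rd t om : (1 <= t <= T)%N -> is_dist (rt t om).
  move=> /andP[_ tT]; apply: (true_state_dist pk rhod (fun t tT => pip om tT)).
  by rewrite leqW.
have ed t om : (1 <= t <= T)%N -> is_dist (et t om).
  move=> /andP[_ tT]; apply: (est_state_dist _ X0 rhod (fun t tT => pip om tT)).
  by rewrite leqW.
have rdet t om om' : (1 <= t <= T)%N -> past w w' t om = past w w' t om' -> rt t om = rt t om'.
  move=> /andP[_ tT] h; apply: eq_state_dist => s st; split=> //.
  exact: pdet_lt h st.
have edet t om om' : (1 <= t <= T)%N -> past w w' t om = past w w' t om' -> et t om = et t om'.
  move=> /andP[_ tT] h; apply: eq_state_dist => s st; split; last exact: pdet_lt h st.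
  apply: eq_est_kernel => r /andP[r1 rs]; have := pastP (s := r) h.
  by rewrite r1 (ltn_trans rs) ?(andP st).2 // => /(_ isT)[].
have fol t : (1 <= t <= T)%N -> follows P (past w w' t) (w t) p (fun om => rt t om) (pi t).
  by move=> tT; have [_ _ h _] := inter tT.
have fol' t : (1 <= t <= T)%N -> follows P (past w w' t) (w' t) p (fun om => et t om) (pi t).
  by move=> tT; have [_ _ _ h] := inter tT.
have [b1 [m1 p1 H1]] := kernel_stream_delta (sel := fst) mw pk pip rd fol de0 N0 T0 X0 A0 L2.
have [b2 [m2 p2 H2]] := kernel_stream_delta (sel := snd) mw pk pip ed fol' de0 N0 T0 X0 A0 L2.
have [b3 [m3 p3 H3]] := occupancy_stream (sel := fst) mw pk pip rd fol pdet rdet de0 N0 XA0.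
have [b4 [m4 p4 H4]] := occupancy_stream (sel := snd) mw pk pip ed fol' pdet edet de0 N0 XA0.
have m12 := measurableU _ _ m1 m2; have m34 := measurableU _ _ m3 m4.
exists ((b1 `|` b2) `|` (b3 `|` b4)); split; first exact: measurableU.
  have := prU P m12 m34; have := prU P m1 m2; have := prU P m3 m4; lra.
move=> om nb; split.
- by apply: H1 => h; apply: nb; left; left.
- by apply: H2 => h; apply: nb; left; right.
- by apply: H3 => h; apply: nb; right; left.
- by apply: H4 => h; apply: nb; right; right.
Qed.

End Interaction.

(** * Conclusion *)

Section Final.
Context {R : realType}.

(** Since 2 < e < 3: the upper bound is exp(- 1/6) >= 5/6 raised to the sixth power, as (6/5)^6 <
    3. *)
Lemma expR1_neq_nat (n : nat) : expR 1 != n%:R :> R.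
Proof.
have lo : 2 < expR 1 :> R by have := @expR_gt1Dx R 1 (oner_neq0 _); lra.
have hi : expR 1 < 3 :> R.
  pose e : R := expR (- (6^-1)).
  have e56 : 5 / 6 <= e by have := @expR_ge1Dx R (- (6^-1)); rewrite /e; lra.
  have E : expR 1 * e ^+ 6 = 1.
    by rewrite /e -expRM_natl -expRD (_ : 1 + _ = 0) ?expR0 //; field.
  have : (5 / 6) ^+ 6 <= e ^+ 6 by rewrite ler_pXn2r ?nnegrE ?expR_ge0 //; lra.
  have := expR_gt0 (1 : R); nra.
apply/eqP => e; rewrite e in lo hi.
by move: lo hi; rewrite !ltr_nat ltnS => h1 h2; have := leq_ltn_trans h2 h1; rewrite ltnn.
Qed.

(** If [Psi <= 0], the gradient 1 + ln nu at step 0 vanishes, so [nu] is constantly 1/e and e would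
    be the number of pairs. *)
Lemma psi_gradient_gt0 (X A : finType) (N : nat) (K : divergence) (q : trans_kernel R X A)
    (pi : policy R X A) (nu : savec R X A) (G : saseq R X A) (Psi : R) :
  is_kernel N q -> is_policy N pi -> is_dist nu ->
  is_gradient N (psi N K) (occ q pi nu) G -> norm1oo N G <= Psi -> 0 < Psi.
Proof.
move=> qk pip nud gr GP; rewrite ltNge; apply/negP => P0.
have m0 n xa : (n <= N)%N -> 0 <= occ q pi nu n xa.
  by move=> nN; case: (occ_dist qk pip nud nN).
have G0 xa : G 0%N xa = 0.
  apply/eqP; rewrite -normr_le0.
  exact: le_trans (le_trans (le_norm1oo G xa (leq0n N)) GP) P0.
have nuE xa : nu xa = expR (- 1).
  have [p1 p2] : 0 < occ q pi nu 0%N xa /\ G 0%N xa = 1 + ln (occ q pi nu 0%N xa).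
    by case: K gr => gr; [exact: KL_gradient (leq0n N) (m0 0%N xa (leq0n N)) gr|exact: Gam_gradient0 m0 gr].
  rewrite G0 /= in p1 p2; rewrite -[LHS]lnK ?posrE //; congr expR; lra.
have [_] := nud; rewrite (eq_bigr _ (fun xa _ => nuE xa)) sumr_const -mulr_natr.
set n := #|_| => e; have := expR1_neq_nat n; case/eqP.
by apply: (@mulIf _ (expR (- 1))); rewrite ?expR_eq0 // expRxMexpNx_1 mulrC e.
Qed.

Lemma powR14 (T : nat) : (0 < T)%N -> exists s : R,
  [/\ 1 <= s, s ^+ 4 = T%:R, s ^+ 3 = T%:R `^ (3 / 4) & s = T%:R `^ (1 / 4)].
Proof.
move=> T0; exists (T%:R `^ (1 / 4)); split => //.
- by rewrite -[leLHS](powRr0 T%:R) ler_powR ?ler1n //; lra.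
- by rewrite -powR_mulrn ?powR_ge0 // -powRrM (_ : 1 / 4 * 4 = 1) ?powRr1 //; field.
- by rewrite -powR_mulrn ?powR_ge0 // -powRrM; congr powR; field.
Qed.

(** [T.+1] keeps the step positive at [T = 0], which the theorem also demands; its inverse stays
    within a factor 2 of T^(1/4) for T >= 1. *)
Definition step_size (T : nat) : R := (T.+1%:R `^ (1 / 4))^-1.

Lemma step_size_gt0 T : 0 < step_size T.
Proof. by rewrite invr_gt0 powR_gt0 // ltr0n. Qed.

Lemma step_size_bounds (T : nat) (s : R) : 1 <= s -> s ^+ 4 = T%:R ->
  (step_size T)^-1 <= 2 * s /\ T%:R * step_size T <= s ^+ 3.
Proof.
move=> s1 s4; have [r [r1 r4 _ rE]] := powR14 (ltn0Sn T).
rewrite /step_size invrK -rE; have s0 : 0 < s by lra.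
split.
  rewrite -(@ler_pXn2r _ 4) ?nnegrE //; try by lra.
  rewrite exprMn r4 -natr1 -s4.
  have : 1 <= s ^+ 4 by rewrite exprn_ege1.
  lra.
rewrite ler_pdivrMr -?s4; last by lra.
have sr : s <= r.
  by rewrite -(@ler_pXn2r _ 4) ?nnegrE ?r4 ?s4 ?ler_nat //; lra.
by rewrite exprSr ler_wpM2l // exprn_ge0 // ltW.
Qed.

Lemma logfactor_unbounded (X A : finType) (N : nat) (delta M : R) :
  (0 < N)%N -> 0 < delta < 1 -> exists T0 : nat, forall T, (T0 <= T)%N ->
  (0 < #|X|)%N -> (0 < #|A|)%N -> (0 < T)%N /\ M <= logfactor X A N T delta.
Proof.
move=> N0 /andP[d0 d1]; exists (Num.bound (expR M)) => T bT X0 A0.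
have eT : expR M < T%:R.
  by apply: lt_le_trans (archi_boundP (expR_ge0 M)) _; rewrite ler_nat.
have T0 : 0 < T%:R :> R by exact: lt_trans (expR_gt0 M) eT.
split; first by rewrite -(ltr0n R).
have c1 : 1 <= #|X|%:R * #|A|%:R * N%:R :> R by rewrite -!natrM ler1n !muln_gt0 X0 A0.
have le : expR M <= #|X|%:R * #|A|%:R * N%:R * T%:R / delta.
  apply: le_trans (ltW eT) _; rewrite ler_pdivlMr //.
  apply: (@le_trans _ _ T%:R); first by rewrite ler_piMr // ltW.
  by rewrite ler_peMl // ltW.
have Y0 := lt_le_trans (expR_gt0 M) le.
by rewrite -[leLHS]expRK /logfactor ler_ln ?posrE ?expR_gt0.
Qed.


(** The [a]'s gather what is independent of [T], and [s] is T^(1/4). The power s^3 comes from B^2 Q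
    / eta and from T eta B^2; L^2 covers the half-integral power of L in B^3 Q. *)
Lemma rate_const_bound (a1 a2 a3 a4 a5 a6 a0 c1 L s B Q r e : R) :
  0 <= a1 -> 0 <= a2 -> 0 <= a3 -> 0 <= a4 -> 0 <= a5 -> 0 <= a6 -> 0 <= a0 -> 0 <= c1 ->
  1 <= L -> 1 <= s -> 1 <= B -> B ^+ 2 = c1 * L -> 0 <= Q -> Q <= a0 * s ^+ 2 ->
  0 <= r <= 2 * s -> 0 <= e <= s ^+ 3 ->
  a1 * (B ^+ 2 * Q) + (a2 + a3 * (B ^+ 2 * Q)) * r + a4 * B * (a5 * (B ^+ 2 * Q) + 1)
    + a6 * (e * B ^+ 2) <=
  (a1 * c1 * a0 + 2 * (a2 + a3 * c1 * a0) + a4 * (a5 * c1 ^+ 2 * a0 + c1) + a6 * c1) * s ^+ 3 * L ^+ 2.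
Proof.
move=> a10 a20 a30 a40 a50 a60 a00 c10 L1 s1 B1 B2 Q0 Qs /andP[r0 rs] /andP[e0 es].
have L0 : 0 <= L by lra.
have s0 : 0 <= s by lra.
have LL : L <= L ^+ 2 by rewrite expr2 ler_peMl.
have L21 : 1 <= L ^+ 2 by rewrite exprn_ege1.
have s23 : s ^+ 2 <= s ^+ 3 by rewrite [s ^+ 3]exprS ler_peMl ?exprn_ge0.
have s13 : s <= s ^+ 3 by rewrite [s ^+ 3]exprS ler_peMr // exprn_ege1.
have s3 : 0 <= s ^+ 3 by rewrite exprn_ge0.
have s2 : 0 <= s ^+ 2 by rewrite exprn_ge0.
have BB : B <= B ^+ 2 by rewrite expr2 ler_peMl //; lra.
set W := B ^+ 2 * Q; set S := s ^+ 3 * L ^+ 2.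
have W0 : 0 <= W by rewrite mulr_ge0 ?sqr_ge0.
have W1 : W <= c1 * a0 * (s ^+ 2 * L).
  have : c1 * L * Q <= c1 * L * (a0 * s ^+ 2) by rewrite ler_wpM2l // mulr_ge0.
  by rewrite /W B2; lra.
have sL : s ^+ 2 * L <= S by apply: ler_pM.
have ca : 0 <= c1 * a0 by rewrite mulr_ge0.
have WS : W <= c1 * a0 * S by apply: le_trans W1 _; rewrite ler_wpM2l.
have rS : r <= 2 * S.
  have : s * 1 <= S by apply: ler_pM.
  lra.
have WrS : W * r <= 2 * (c1 * a0) * S.
  have : W * r <= c1 * a0 * (s ^+ 2 * L) * (2 * s) by apply: ler_pM.
  have -> : c1 * a0 * (s ^+ 2 * L) * (2 * s) = 2 * (c1 * a0) * (s ^+ 3 * L) by ring.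
  have : 2 * (c1 * a0) * (s ^+ 3 * L) <= 2 * (c1 * a0) * S.
    by rewrite ler_wpM2l ?mulr_ge0 // /S ler_wpM2l.
  lra.
have BS : B <= c1 * S.
  apply: le_trans BB _; rewrite B2 ler_wpM2l // -[leLHS]mul1r; apply: ler_pM => //.
  by rewrite exprn_ege1.
have B0 : 0 <= B by lra.
have BW : B * W <= c1 ^+ 2 * a0 * S.
  apply: (@le_trans _ _ ((c1 * L) * (c1 * a0 * (s ^+ 2 * L)))).
    by apply: ler_pM => //; rewrite -B2.
  have -> : c1 * L * (c1 * a0 * (s ^+ 2 * L)) = c1 ^+ 2 * a0 * (s ^+ 2 * L ^+ 2) by ring.
  rewrite ler_wpM2l ?mulr_ge0 ?sqr_ge0 // /S ler_wpM2r //; lra.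
have eS : e * B ^+ 2 <= c1 * S.
  rewrite B2 mulrCA ler_wpM2l //; apply: ler_pM => //.
have := ler_wpM2l a10 WS; have := ler_wpM2l a20 rS; have := ler_wpM2l a30 WrS.
have := ler_wpM2l a40 BS; have := ler_wpM2l (mulr_ge0 a40 a50) BW; have := ler_wpM2l a60 eS.
have -> : (a1 * c1 * a0 + 2 * (a2 + a3 * c1 * a0) + a4 * (a5 * c1 ^+ 2 * a0 + c1) + a6 * c1)
   * s ^+ 3 * L ^+ 2 =
   (a1 * c1 * a0 + 2 * (a2 + a3 * c1 * a0) + a4 * (a5 * c1 ^+ 2 * a0 + c1) + a6 * c1) * S.
  by rewrite /S; ring.
clearbody S W; lra.
Qed.

End Final.

Theorem theorem8 (R : realType) :
  exists (c C : R) (k : nat)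
         (eta : forall (T N cardX cardA : nat) (alpha l Psi delta psi1 : R), R),
  (forall T N cardX cardA alpha l Psi delta psi1,
     0 < eta T N cardX cardA alpha l Psi delta psi1) /\
  forall (X A : finType) (N : nat) (alpha l Psi delta gamma : R),
  (0 < N)%N -> 0 <= alpha < 1 -> 0 < l -> 0 < delta < 1 -> 0 < gamma ->
  exists T0 : nat, forall T : nat, (T0 <= T)%N ->
  forall (K : divergence) (d : measure_display) (Omega : measurableType d)
    (P : probability Omega R)
    (p : trans_kernel R X A) (rho : savec R X A)
    (f : nat -> Omega -> nat -> savec R X A -> R)
    (w w' : nat -> Omega -> traj X A N)
    (pi : nat -> Omega -> policy R X A)
    (g : nat -> Omega -> saseq R X A),
  is_kernel N p -> is_dist rho ->
  (exists pi0, periodic_policy N p rho pi0) ->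
  contracting N p alpha ->
  (forall t om n, (1 <= t <= T)%N -> (1 <= n <= N)%N ->
     convex_fun (f t om n) /\ lipschitz_fun l (f t om n)) ->
  interaction P T p rho w w' pi ->
  (forall om,
     let mu1 := iterate rho (w ^~ om) (w' ^~ om) (pi ^~ om) 1%N in
     mdpp_u K (eta T N #|X| #|A| alpha l Psi delta (psi N K mu1))
       l T delta alpha rho (w ^~ om) (w' ^~ om) (f ^~ om) (pi ^~ om) (g ^~ om)) ->
  forall pi0, periodic_policy N p rho pi0 ->
  exists E : set Omega,
    [/\ measurable E, ((1 - c * delta)%:E <= P E)%E
      & forall om, E om ->
          (forall t, (1 <= t <= T)%N -> exists grad : saseq R X A,
             is_gradient N (psi N K)
               (iterate rho (w ^~ om) (w' ^~ om) (pi ^~ om) t) grad /\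
             norm1oo N grad <= Psi) ->
          periodic_regret N p rho gamma (f ^~ om) (pi ^~ om) T pi0
          <= C * regret_rate X A N alpha l Psi T * logfactor X A N T delta ^+ k].
Proof.
(* The exponent 4 is 2 from [rate_const_bound] plus 2 spent on absorbing constants. *)
exists 10, 1, 4%N, (fun T _ _ _ _ _ _ _ _ => step_size T); split=> [*|]; first exact: step_size_gt0.
move=> X A N alpha l Psi delta gamma N0 a01 l0 d01 g0.
have [d0 d1] := andP d01; have [al0 al1] := andP a01.
have nonempty (rho : savec R X A) : is_dist rho -> (0 < #|X|)%N /\ (0 < #|A|)%N.
  move=> [_ r1]; case: (pickP (fun xa : X * A => true)) => [xa _|none].
    by split; apply/card_gt0P; [exists xa.1|exists xa.2].
  by move: r1; rewrite big_pred0 // => /eqP; rewrite eq_sym oner_eq0.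
(* Here the gradient hypothesis is contradictory and the whole space serves as event. The case is
   set apart because [kappa], by which one divides, must be positive. *)
have [Psi0|Psi0] := lerP Psi 0.
  exists 1%N => T T1 K d Omega P p rho f w w' pi g pk rhod _ contr _ inter run pi0 per.
  have [X0 A0] := nonempty rho rhod.
  exists setT; split; first exact: measurableT.
    by rewrite probability_setT lee_fin; lra.
  move=> om _ grad; exfalso; have [|G [Gg GP]] := grad 1%N; first by rewrite leqnn.
  have [pip _ _] := run om.
  have := psi_gradient_gt0 (est_kernel_is_kernel _ 1 X0) (pip 1%N _) rhod Gg GP.
  by rewrite leqnn T1 => /(_ isT); rewrite ltNge Psi0.
set c := #|{: X * A}|; set D : R := pairs_const N c.
set av := iterate_const N c alpha; set tg := target_const N c alpha; set beta := (1 - alpha)^-1.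
pose a1 := l * N%:R * (beta * D + D) + l * N%:R * (av + tg) + gamma * (beta * D + tg).
pose a2 := 2 * (N.+1 * c)%:R + 2 * Psi.
pose a5 := 2 * tg + 2 * D.
pose a3 := Psi * a5.
pose a4 := 2 * (l * N.+1%:R * N.+1%:R).
pose a6 := l ^+ 2 * N.+1%:R ^+ 2 * (N.+1 ^ 3 * c)%:R.
pose c1 : R := 2 * #|X|%:R.
pose a0 := 6 + 2 * `|ln ((N * c)%:R / delta)|.
pose Kc := a1 * c1 * a0 + 2 * (a2 + a3 * c1 * a0) + a4 * (a5 * c1 ^+ 2 * a0 + c1) + a6 * c1.
pose kappa := l * N%:R ^+ 3 * (1 - alpha)^-1 * #|X|%:R `^ (5 / 4) * #|A|%:R `^ (1 / 4)
    * Psi `^ (1 / 2).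
(* Beyond [T0] the logarithm exceeds the ratio of the actual constant to that of the rate; neither
   depends on [T] or on the divergence. The bound 2 is for the concentration event and for
   [1 <= B]. *)
have [T0 HT0] := logfactor_unbounded X A (Num.max 2 (Kc / kappa)) N0 d01.
exists T0 => T T0T K d Omega P p rho f w w' pi g pk rhod _ contr flip inter run pi0 per.
have [X0 A0] := nonempty rho rhod.
have [T1] := HT0 T T0T X0 A0; rewrite ge_max => /andP[L2 LK].
have pip t om : (1 <= t <= T)%N -> is_policy N (pi t om) by case: (run om) => h _ _; exact: h.
have [bad [mbad pbad Hbad]] := interaction_event pk rhod pip inter d0 N0 T1 X0 A0 L2.
exists (~` bad); split; first exact: measurableC.
  by rewrite probability_setC // (prE P mbad) -EFinB lee_fin; lra.
move=> om nb grad; have [G1 G1' G2 G2'] := Hbad om nb.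
set L := logfactor X A N T delta in L2 LK *.
set B := @Cdelta R X A N T delta in G1 G1' *.
have X1 : 1 <= #|X|%:R :> R by rewrite ler1n.
have B2 : B ^+ 2 = c1 * L.
  by rewrite /B /Cdelta -/L sqr_sqrtr //; apply: mulr_ge0; [exact: mulr_ge0|lra].
have B1 : 1 <= B.
  rewrite -(@ler_pXn2r _ 2) ?nnegrE ?sqrtr_ge0 // expr1n B2 /c1.
  have : 0 <= (#|X|%:R - 1) * L by rewrite mulr_ge0 ?subr_ge0 //; lra.
  lra.
have [s [s1 s4 s3 _]] := @powR14 R T T1.
have sT : Num.sqrt T%:R = s ^+ 2 :> R.
  by rewrite -s4 (_ : s ^+ 4 = (s ^+ 2) ^+ 2) ?sqrtr_sqr ?ger0_norm ?sqr_ge0 // -exprM.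
set lnM := ln ((N * c)%:R / delta).
pose Q := 6 * Num.sqrt T%:R + 2 * lnM.
have M1 : 0 <= lnM.
  apply: ln_ge0; rewrite ler_pdivlMr // mul1r (le_trans (ltW d1)) // ler1n muln_gt0 N0.
  by rewrite /c card_prod muln_gt0 X0.
have s21 : 1 <= s ^+ 2 by rewrite exprn_ege1.
have Q1 : 1 <= Q by rewrite /Q sT; lra.
have G3 n xa : (n < N)%N -> \sum_(1 <= t < T.+1) (scored_visit (w ^~ om) t n xa : R) <= Q.
  move=> _; apply: le_trans (sum_scored_visit _ _ _ _) _.
  by rewrite /Q sT; lra.
have := pathwise_regret X0 pk rhod a01 contr B1 Q1 T1 (ltW l0) (step_size_gt0 T) (ltW g0)
  (fun t n tT nN => (flip t om n tT nN).2) (run om) per grad G1 G1' G2 G2' G3.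
rewrite -/B -/c -/D -/av -/tg -/beta => reg.
have [re eT] := step_size_bounds s1 s4.
have D0 : 0 <= D by exact: ler0n.
have b0 : 0 <= beta by rewrite invr_ge0; lra.
have av0 : 0 <= av by rewrite /av /iterate_const -/D -/beta !addr_ge0 // !mulr_ge0.
have tg0 : 0 <= tg.
  by rewrite /tg /target_const -/D -/beta -/av mulr_ge0 // !addr_ge0 // mulr_ge0.
have a50 : 0 <= a5 by rewrite /a5; lra.
have a10 : 0 <= a1.
  have lN : 0 <= l * N%:R by rewrite mulr_ge0 // ltW.
  have bD : 0 <= beta * D by rewrite mulr_ge0.
  have h1 : 0 <= l * N%:R * (beta * D + D) by rewrite mulr_ge0 ?addr_ge0.
  have h2 : 0 <= l * N%:R * (av + tg) by rewrite mulr_ge0 ?(addr_ge0 av0 tg0).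
  have h3 : 0 <= gamma * (beta * D + tg) by rewrite mulr_ge0 ?(addr_ge0 bD tg0) ?(ltW g0).
  exact: addr_ge0 (addr_ge0 h1 h2) h3.
have a20 : 0 <= a2 by rewrite /a2 addr_ge0 ?mulr_ge0 // ltW.
have a30 : 0 <= a3 by rewrite mulr_ge0 // ltW.
have a40 : 0 <= a4 by rewrite !mulr_ge0 // ltW.
have a60 : 0 <= a6 := mulr_ge0 (mulr_ge0 (sqr_ge0 _) (sqr_ge0 _)) (ler0n _ _).
have a00 : 0 <= a0 by rewrite addr_ge0 // mulr_ge0.
have c10 : 0 <= c1 by rewrite mulr_ge0.
have Qs : Q <= a0 * s ^+ 2.
  rewrite /Q sT /a0 -/lnM ger0_norm //.
  have : 0 <= lnM * (s ^+ 2 - 1) by rewrite mulr_ge0 ?subr_ge0.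
  lra.
have e0 := @step_size_gt0 R T.
have L1 : 1 <= L by lra.
have Q0 : 0 <= Q by lra.
have r01 : 0 <= (@step_size R T)^-1 <= 2 * s by rewrite re invr_ge0 ltW.
have eT0 : 0 <= T%:R * @step_size R T <= s ^+ 3 by rewrite eT mulr_ge0 // ltW.
have RC := rate_const_bound a10 a20 a30 a40 a50 a60 a00 c10 L1 s1 B1 B2 Q0 Qs r01 eT0.
have {}reg : periodic_regret N p rho gamma (f ^~ om) (pi ^~ om) T pi0 <= Kc * s ^+ 3 * L ^+ 2.
  apply: le_trans RC; apply: le_trans reg _; rewrite le_eqVlt; apply/orP; left; apply/eqP.
  by rewrite /a1 /a2 /a3 /a4 /a5 /a6; ring.
have k0 : 0 < kappa.
  by rewrite /kappa !mulr_gt0 ?powR_gt0 ?exprn_gt0 ?invr_gt0 ?ltr0n //; lra.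
apply: le_trans reg _; rewrite mul1r.
have KL : Kc <= kappa * L ^+ 2.
  move: LK; rewrite ler_pdivrMr // mulrC => /le_trans; apply.
  by rewrite ler_wpM2l ?(ltW k0) // expr2 ler_peMl //; lra.
have s30 : 0 <= s ^+ 3 by rewrite exprn_ge0 //; lra.
apply: (@le_trans _ _ (kappa * s ^+ 3 * L ^+ 4)).
  have : Kc * (s ^+ 3 * L ^+ 2) <= kappa * L ^+ 2 * (s ^+ 3 * L ^+ 2).
    by rewrite ler_wpM2r // mulr_ge0 ?sqr_ge0.
  by congr (_ <= _); ring.
rewrite ler_wpM2r ?exprn_ge0 //; first lra.
rewrite /regret_rate -s3 -/kappa lerDl.
apply: mulr_ge0 _ (sqrtr_ge0 _); apply: mulr_ge0 _ (sqr_ge0 _).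
apply: mulr_ge0; last by rewrite invr_ge0 sqr_ge0.
exact: mulr_ge0 (ltW l0) (exprn_ge0 _ (ler0n _ _)).
Qed.
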